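(* Assume (A1)–(A3). Let $(u,p)$ be the solution of the continuous problem, $(\tilde u_h,\tilde p_h)$ its elliptic projection, and $(U_h,P_h)$ a solution of the fully discrete scheme with polynomial degree $q\ge1$ in time (all defined in the context). Then for $0\le n\le N$ $$\|u(t^n)-U_h(t^n)\|_{\mathcal V}\le\|u(t^n)-\tilde u_h(t^n)\|_{\mathcal V}+C_h(u)+C_\tau(p),$$ $$\|\Pi_{q-1}^0(p-P_h)\|_{L^2(0,t^n;\mathcal Q)}\le\|\Pi_{q-1}^0(p-\tilde p_h)\|_{L^2(0,t^n;\mathcal Q)}+C_h(u)+C_\tau(p),$$ with projection errors $C_h(u)=\|B(\dot u-\dot{\tilde u}_h)\|_{L^2(0,t^n;\mathcal Q_0^* )}$ and $C_\tau(p)=\|p-\Pi_q^1p\|_{L^2(0,t^n;\mathcal Q)}$. If, in addition, (A3h) holds, i.e. $\sup_{v_h\in\mathcal V_h,\,\|v_h\|_{\mathcal V}=1}b(v_h,q_h)\ge\beta_h\|q_h\|_{\mathcal Q_0}$ for all $q_h\in\mathcal Q_h$ with some $\beta_h>0$, then $$\|p(t^n)-P_h(t^n)\|_{\mathcal Q_0}\le\|p(t^n)-\tilde p_h(t^n)\|_{\mathcal Q_0}+\beta_h^{-1}\big(C_h(u)+C_\tau(p)\big).$$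
   Context: $\mathcal V,\mathcal Q,\mathcal Q_0$ are real Hilbert spaces with compact embedding $\mathcal Q\subset\mathcal Q_0$; identifying $\mathcal Q_0$ with its dual one has a Gelfand triple $\mathcal Q\subset\mathcal Q_0=\mathcal Q_0^*\subset\mathcal Q^*$. $\langle\cdot,\cdot\rangle$ denotes the duality products. The forms $a:\mathcal V\times\mathcal V\to\mathbb R$, $k:\mathcal Q\times\mathcal Q\to\mathbb R$, $b:\mathcal V\times\mathcal Q_0\to\mathbb R$ are bilinear. Assumptions: (A1) $a$ is bounded, elliptic and symmetric. (A2) $k$ is bounded, elliptic and symmetric. (A3) $b$ is bounded and inf-sup stable: there are $C_b,\beta>0$ with $b(v,q)\le C_b\|v\|_{\mathcal V}\|q\|_{\mathcal Q_0}$ and $\sup_{\|v\|_{\mathcal V}=1}b(v,q)\ge\beta\|q\|_{\mathcal Q_0}$ for all $v\in\mathcal V$, $q\in\mathcal Q_0$. Norms: $\|v\|_{\mathcal V}^2=a(v,v)$, $\|q\|_{\mathcal Q}^2=k(q,q)$, and $\|q\|_{\mathcal Q_0}\le\|q\|_{\mathcal Q}$. $B:\mathcal V\to\mathcal Q_0^*$ is given by $\langle Bv,q\rangle=b(v,q)$. A dot (or $\partial_t$) denotes the time derivative. Continuous problem: $a(u(t),v)-b(v,p(t))=\langle f(t),v\rangle$ for all $v\in\mathcal V$, and $b(\dot u(t),q)+k(p(t),q)=\langle g(t),q\rangle$ for all $q\in\mathcal Q$, $0<t<T$, with $f\in H^1(0,T;\mathcal V^* )$, $g\in L^2(0,T;\mathcal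 Q^* )$; the solution is assumed regular enough for all quantities to be defined ($u\in H^1(0,T;\mathcal V)$, $p\in H^1(0,T;\mathcal Q)$). $\mathcal V_h\subset\mathcal V$, $\mathcal Q_h\subset\mathcal Q$ are finite dimensional subspaces. Elliptic projection: $\tilde u_h(t)\in\mathcal V_h$, $\tilde p_h(t)\in\mathcal Q_h$ with $a(\tilde u_h(t)-u(t),v_h)-b(v_h,\tilde p_h(t)-p(t))=0$ for all $v_h\in\mathcal V_h$ and $k(\tilde p_h(t)-p(t),q_h)=0$ for all $q_h\in\mathcal Q_h$. Time grid: $I_\tau=\{0=t^0<t^1<\dots<t^N=T\}$; $P_q(I_\tau;X)$ is the space of functions whose restriction to each $[t^{n-1},t^n]$ is a polynomial of degree $\le q$ in $t$ with values in $X$. $\Pi_{q-1}^0:L^2(0,T;X)\to P_{q-1}(I_\tau;X)$ is the $L^2$-orthogonal projection. $\Pi_q^1:H^1(0,T;X)\to P_q(I_\tau;X)\cap H^1(0,T;X)$ is defined by $\partial_t\Pi_q^1w=\Pi_{q-1}^0\partial_tw$ and $(\Pi_q^1w)(t^{n-1})=w(t^{n-1})$, $1\le n\le N$. Fully discrete scheme: find $U_h\in P_q(I_\tau;\mathcal V_h)\cap H^1(0,T;\mathcal V_h)$ and $P_h\in P_q(I_\tau;\mathcal Q_h)\cap H^1(0,T;\mathcal Q_h)$ with $U_h(0)=\tilde u_h(0)$, $P_h(0)=\tilde p_h(0)$ and, for $t>0$, $a(U_h(t),v_h)-b(v_h,P_h(t))=\langle\Pi_q^1f(t),v_h\rangle$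 for all $v_h\in\mathcal V_h$, and $b(\dot U_h(t),q_h)+k(\Pi_{q-1}^0P_h(t),q_h)=\langle\Pi_{q-1}^0g(t),q_h\rangle$ for all $q_h\in\mathcal Q_h$. *)

(* Defs.v *)
From HB Require Import structures.
From mathcomp Require Import all_boot all_order all_algebra sesquilinear.
From mathcomp Require Import all_classical all_reals all_analysis.

Set Implicit Arguments.
Unset Strict Implicit.
Unset Printing Implicit Defensive.

Import Order.TTheory GRing.Theory Num.Theory.
Import numFieldNormedType.Exports.

Local Open Scope classical_set_scope.
Local Open Scope ring_scope.

Section Hilbert.
Context {R : realType}.

(* Polarization: in a Hilbert space this is the inner product; the formula
   makes sense in every normed space, in particular in a dual space. *)
Definition inner (X : normedModType R) (x y : X) : R :=
  (`|x + y| ^+ 2 - `|x - y| ^+ 2) / 4.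

(* The norm comes from an inner product: symmetry and inner x x = `|x| ^+ 2
   hold for every norm.  A real Hilbert space is a completeNormedModType
   satisfying this condition. *)
Definition hilbertian (X : normedModType R) : Prop :=
  forall (l : R) (x y z : X), inner (l *: x + y) z = l * inner x z + inner y z.

Definition bounded_form (X Y : normedModType R) (a : X -> Y -> R) : Prop :=
  exists C : R, 0 < C /\ forall x y, `|a x y| <= C * `|x| * `|y|.

Definition elliptic_form (X : normedModType R) (a : X -> X -> R) : Prop :=
  exists c : R, 0 < c /\ forall x, c * `|x| ^+ 2 <= a x x.

Definition sym_form (X : normedModType R) (a : X -> X -> R) : Prop :=
  forall x y, a x y = a y x.

Definition findim_subspace (X : normedModType R) (S : set X) : Prop :=
  exists (n : nat) (e : 'I_n -> X),
    S = [set x | exists c : 'I_n -> R, x = \sum_(i < n) c i *: e i].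

End Hilbert.

Section Dual.
Context {R : realType} (X : normedModType R).

Definition bounded_linear_functional : {pred (X -> R^o)} :=
  fun f => `[< linear f /\ exists M : R, forall x, `|f x| <= M * `|x| >].

Lemma bounded_linear_functional_submod :
  submod_closed bounded_linear_functional.
Proof.
split=> [|k f g /asboolP[lf [M fM]] /asboolP[lg [N gN]]]; apply/asboolP.
  split=> [c x y|]; first by rewrite /= scaler0 addr0.
  by exists 0 => x; rewrite /= normr0 mul0r.
split=> [c x y|].
  have -> z : (k *: f + g) z = k *: f z + g z by [].
  by rewrite lf lg !scalerDr !scalerA [c * k]mulrC addrACA.
exists (`|k| * M + N) => x; rewrite (le_trans (ler_normD (k *: f x) (g x)))//.
by rewrite mulrDl lerD// normrM -mulrA ler_wpM2l.
Qed.

HB.instance Definition _ := GRing.isSubmodClosed.Build R (X -> R^o)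
  bounded_linear_functional bounded_linear_functional_submod.

Record dual := Dual {
  dual_fun :> X -> R^o ;
  dual_funP : dual_fun \in bounded_linear_functional }.

HB.instance Definition _ := [isSub for dual_fun].
HB.instance Definition _ := [Choice of dual by <:].
HB.instance Definition _ := [SubChoice_isSubLmodule of dual by <:].

Definition dual_norm (f : dual) : R :=
  sup [set `|f x| | x in [set x : X | `|x| <= 1]].

Lemma dual_norm_has_sup (f : dual) :
  has_sup [set `|f x| | x in [set x : X | `|x| <= 1]].
Proof.
split; first by exists `|f 0|, 0; rewrite //= normr0.
have /asboolP[_ [M fM]] := dual_funP f.
exists `|M| => _ [x /= x1 <-]; rewrite (le_trans (fM x))//.
by rewrite (le_trans (ler_norm _))// normrM normr_id ler_piMr.
Qed.

Lemma dual_norm_ge (f : dual) x : `|x| <= 1 -> `|f x| <= dual_norm f.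
Proof.
move=> x1; apply: ub_le_sup; last by exists x.
by have [] := dual_norm_has_sup f.
Qed.

Lemma dual_norm_le (f : dual) c :
  (forall x, `|x| <= 1 -> `|f x| <= c) -> dual_norm f <= c.
Proof.
move=> fc; apply: sup_le_ub; first by have [] := dual_norm_has_sup f.
by move=> _ [x /= x1 <-]; exact: fc.
Qed.

Lemma dual_normD (f g : dual) : dual_norm (f + g) <= dual_norm f + dual_norm g.
Proof.
apply: dual_norm_le => x x1; rewrite (le_trans (ler_normD (f x) (g x)))//.
by rewrite lerD// dual_norm_ge.
Qed.

Lemma dual_normZ (l : R) (f : dual) : dual_norm (l *: f) = `|l| * dual_norm f.
Proof.
have le k (g : dual) : dual_norm (k *: g) <= `|k| * dual_norm g.
  apply: dual_norm_le => x x1.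
  by rewrite (_ : (k *: g) x = k * g x)// normrM ler_wpM2l// dual_norm_ge.
have [->|l0] := eqVneq l 0.
  apply/eqP; rewrite eq_le le/= normr0 mul0r.
  by rewrite (le_trans _ (dual_norm_ge _ (_ : `|0| <= 1)))// normr0.
apply/eqP; rewrite eq_le le/= -ler_pdivlMl ?normr_gt0// -normfV.
by rewrite -{1}(scalerK l0 f) le.
Qed.

Lemma dual_norm0_eq0 (f : dual) : dual_norm f = 0 -> f = 0.
Proof.
move=> f0; apply/val_inj/funext => x /=.
have /asboolP[lf _] := dual_funP f.
have f0E : f 0 = 0 by have := lf (-1) 0 0; rewrite scaler0 addr0 scaleN1r addNr.
have [->|x0] := eqVneq x 0; first exact: f0E.
have /eqP : `|f (`|x|^-1 *: x)| = 0.
  apply/eqP; rewrite eq_le normr_ge0 andbT -f0 dual_norm_ge//.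
  by rewrite normrZ normfV normr_id mulVf ?normr_eq0.
rewrite normr_eq0 -[_ *: x]addr0 lf f0E addr0 scaler_eq0.
by rewrite invr_eq0 normr_eq0 (negbTE x0) => /eqP.
Qed.

HB.instance Definition _ := Lmodule_isNormed.Build R dual
  dual_normD dual_normZ dual_norm0_eq0.

End Dual.

Section Bochner.
Context {R : realType} {X : normedModType R}.
Local Notation mu := (@lebesgue_measure R).

Definition simple_function (s : R -> X) : Prop :=
  finite_set (range s) /\ forall x, measurable (s @^-1` [set x]).

Definition simple_integral (D : set R) (s : R -> X) : X :=
  \sum_(x \in range s) fine (mu (D `&` s @^-1` [set x])) *: x.

Definition strongly_measurable (D : set R) (f : R -> X) : Prop :=
  exists s : nat -> R -> X, (forall n, simple_function (s n)) /\
    {ae mu, forall t, D t -> s n t @[n --> \oo] --> f t}.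

(* x is the Bochner integral of f over D, for D of finite measure *)
Definition is_bochner_integral (D : set R) (f : R -> X) (x : X) : Prop :=
  strongly_measurable D f /\
  exists s : nat -> R -> X, [/\ forall n, simple_function (s n),
    (\int[mu]_(t in D) (`|f t - s n t|)%:E)%E @[n --> \oo] --> 0%E &
    simple_integral D (s n) @[n --> \oo] --> x].

Definition L2norm (D : set R) (f : R -> X) : \bar R :=
  ((\int[mu]_(t in D) (`|f t| ^+ 2)%:E) `^ 2^-1)%E.

Definition L2 (D : set R) (f : R -> X) : Prop :=
  strongly_measurable D f /\ (L2norm D f < +oo)%E.

(* z is the weak derivative of (the continuous representative) w *)
Definition is_time_derivative (T : R) (w z : R -> X) : Prop :=
  L2 `]0, T[ z /\
  forall t, 0 <= t <= T -> is_bochner_integral `]0, t[ z (w t - w 0).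

(* H^1(0,T;X); its elements are identified with their continuous
   representatives on [0,T], so that point values make sense *)
Definition H1 (T : R) (w : R -> X) : Prop :=
  exists z, is_time_derivative T w z.

(* determined up to a null set *)
Definition time_derivative (T : R) (w : R -> X) : R -> X :=
  xget (fun=> 0) [set z | is_time_derivative T w z].

End Bochner.

Section TimeDiscretization.
Context {R : realType} {X : normedModType R}.

Definition time_grid (T : R) (N : nat) (tg : nat -> R) : Prop :=
  [/\ tg 0%N = 0, tg N = T & forall n, (n < N)%N -> tg n < tg n.+1].

(* Piecewise polynomials of degree <= q with coefficients in S.  As elements
   of L^2 they may jump at the nodes, hence no condition there. *)
Definition piecewise_poly (N : nat) (tg : nat -> R) (q : nat) (S : set X)
    (z : R -> X) : Prop :=
  forall n, (n < N)%N -> exists c : 'I_q.+1 -> X, (forall i, S (c i)) /\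
    forall t, tg n < t < tg n.+1 -> z t = \sum_(i < q.+1) t ^+ i *: c i.

Definition is_Pi0 (N : nat) (tg : nat -> R) (q : nat) (w z : R -> X) : Prop :=
  piecewise_poly N tg q setT z /\
  forall phi, piecewise_poly N tg q setT phi ->
    (\int[lebesgue_measure]_(t in `]0, tg N[) inner (w t - z t) (phi t))%R = 0.

(* L^2(0,T;X)-orthogonal projection onto piecewise polynomials of degree <= q;
   determined up to the values at the nodes *)
Definition Pi0 (N : nat) (tg : nat -> R) (q : nat) (w : R -> X) : R -> X :=
  xget (fun=> 0) [set z | is_Pi0 N tg q w z].

Definition is_Pi1 (N : nat) (tg : nat -> R) (q : nat) (w z : R -> X) : Prop :=
  [/\ piecewise_poly N tg q setT z,
      is_time_derivative (tg N) z
        (Pi0 N tg q.-1 (time_derivative (tg N) w)) &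
      forall n, (n < N)%N -> z (tg n) = w (tg n)].

(* for 0 < q; determined on [0,T] *)
Definition Pi1 (N : nat) (tg : nat -> R) (q : nat) (w : R -> X) : R -> X :=
  xget (fun=> 0) [set z | is_Pi1 N tg q w z].

End TimeDiscretization.

(* Main.v *)
Require Import Defs.
From HB Require Import structures.
From mathcomp Require Import all_boot all_order all_algebra sesquilinear.
From mathcomp Require Import all_classical all_reals all_analysis.
From mathcomp Require Import measurable_realfun ring lra.

Set Implicit Arguments.
Unset Strict Implicit.
Unset Printing Implicit Defensive.

Import Order.TTheory GRing.Theory Num.Theory.
Import numFieldNormedType.Exports.

Local Open Scope classical_set_scope.
Local Open Scope ring_scope.

(** The discrete solution is compared with the elliptic projection of the
    projections in time of the solution.  Since the elliptic projection only
    involves spatial operators, it is given by bounded linear maps: with the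
    orthogonal projections [PV] and [PQ] onto the discrete spaces, and [A p]
    representing [v |-> b v (PQ p - p)], it is [(PV (u + A p), PQ p)].  The
    errors [Eu = Uh - PV (Pi1 u + A (Pi1 p))] and [Ep = Ph - PQ (Pi1 p)] are
    piecewise polynomials of degree [q] with discrete coefficients, they start
    from zero, and at the nodes they are [Uh - ut] and [Ph - pt].  They satisfy
    [inner Eu v = b v Ep] for discrete [v], because the first equation survives
    the projection [Pi1] (lemma [Pi1_relation]), and tested with polynomials of
    degree [q - 1] in time they satisfy
    [b (Eu^`()) x + inner x (Ph - pt) = b (u^`() - ut^`()) x] for discrete [x]
    (lemma [error_cell]).

    Let [y] be the projection in time of [Ph - pt], [d] that of
    [pt - PQ (Pi1 p)], and [e = y + d], which is the projection of [Ep].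
    Testing the first relation with [Eu^`()] and the second one with [e] gives
    the energy identity (lemma [energy_identity])
    [1/2 |Eu (tn)|^2 + ((y, e)) = ((b (u^`() - ut^`()), e))], where the double
    parentheses integrate over [(0, tn)].  The right hand side is at most
    [Ch * |e|], and [|d| <= Ctau] (lemma [projected_pressure_bound]); elementary
    algebra (lemma [energy_algebra]) then bounds both [|Eu (tn)|] and [|y|] by
    [Ch + Ctau].  The velocity estimate follows from the triangle inequality;
    the pressure estimate in L2, since orthogonally to the discrete pressures
    the projections of [p - Ph] and [p - pt] agree; the pointwise pressure
    estimate, since the discrete inf-sup condition recovers [Ep] from [Eu].

    Functions with values in Hilbert spaces are studied through their
    components.  Dual spaces have the Riesz property too (lemma [riesz_dual]).
    A Bochner integral commutes with bounded functionals, and conversely a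
    vector with the right components is the Bochner integral of a function that
    is approximable in the mean (lemmas [bochner_functional] and
    [bochner_intro]).  A functional of a derivative is determined almost
    everywhere by that functional of the primitive, through Lebesgue
    differentiation (lemma [primitive_unique]).  The projections [Pi0] and [Pi1] exist because the Gram
    matrix of the monomials is invertible and moments are represented by
    vectors (lemmas [local_projection], [Pi0P] and [Pi1P]).  The integrands of
    [Ch] and [Ctau] are measurable only up to null sets, which is why Hoelder's
    inequality is used in a form for lower integrals (lemma
    [Rint_le_lower_hoelder]). *)

(** * Inner products and the Riesz representation *)

Section InnerProduct.
Context {R : realType} {X : normedModType R}.
Implicit Types (x y z r : X) (l : R).

Lemma innerC x y : inner x y = inner y x.
Proof. by rewrite /inner (addrC x) (distrC x). Qed.

Lemma innerxx x : inner x x = `|x| ^+ 2.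
Proof.
rewrite /inner subrr normr0 -mulr2n normrMn exprMn_n expr0n subr0.
by rewrite -[_ *+ _]mulr_natr mulfK ?pnatr_eq0.
Qed.

Hypothesis hX : hilbertian X.

Lemma inner0l y : inner 0 y = 0.
Proof. by have := hX 1 0 0 y; rewrite scaler0 addr0; lra. Qed.

Lemma innerDl x y z : inner (x + y) z = inner x z + inner y z.
Proof. by have := hX 1 x y z; rewrite scale1r mul1r. Qed.

Lemma innerZl l x z : inner (l *: x) z = l * inner x z.
Proof. by have := hX l x 0 z; rewrite inner0l !addr0. Qed.

Lemma innerNl x z : inner (- x) z = - inner x z.
Proof. by rewrite -scaleN1r innerZl mulN1r. Qed.

Lemma innerBl x y z : inner (x - y) z = inner x z - inner y z.
Proof. by rewrite innerDl innerNl. Qed.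

Lemma inner0r y : inner y 0 = 0.
Proof. by rewrite innerC inner0l. Qed.

Lemma innerDr x y z : inner z (x + y) = inner z x + inner z y.
Proof. by rewrite innerC innerDl !(innerC z). Qed.

Lemma innerZr l x z : inner z (l *: x) = l * inner z x.
Proof. by rewrite innerC innerZl (innerC z). Qed.

Lemma innerNr x z : inner z (- x) = - inner z x.
Proof. by rewrite innerC innerNl (innerC z). Qed.

Lemma innerBr x y z : inner z (x - y) = inner z x - inner z y.
Proof. by rewrite innerDr innerNr. Qed.

Lemma inner_suml n (F : 'I_n -> X) z :
  inner (\sum_(i < n) F i) z = \sum_(i < n) inner (F i) z.
Proof.
by elim/big_rec2: _ => [|i a b _ <-]; rewrite ?inner0l ?innerDl.
Qed.

Lemma inner_sumr n (F : 'I_n -> X) z :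
  inner z (\sum_(i < n) F i) = \sum_(i < n) inner z (F i).
Proof. by rewrite innerC inner_suml; under eq_bigr do rewrite innerC. Qed.

Lemma normD_sqr x y :
  `|x + y| ^+ 2 = `|x| ^+ 2 + 2 * inner x y + `|y| ^+ 2.
Proof.
rewrite -!innerxx innerDl !innerDr (innerC y x); ring.
Qed.

Lemma normB_sqr x y :
  `|x - y| ^+ 2 = `|x| ^+ 2 - 2 * inner x y + `|y| ^+ 2.
Proof. rewrite normD_sqr normrN innerNr; ring. Qed.

Lemma inner_le x y : inner x y <= `|x| * `|y|.
Proof.
have [->|y0] := eqVneq y 0; first by rewrite inner0r normr0 mulr0.
have [->|x0] := eqVneq x 0; first by rewrite inner0l normr0 mul0r.
have := sqr_ge0 `| `|y| *: x - `|x| *: y|.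
rewrite normB_sqr !normrZ !normr_id innerZl innerZr !exprMn.
have -> : `|y| ^+ 2 * `|x| ^+ 2 - 2 * (`|y| * (`|x| * inner x y)) +
   `|x| ^+ 2 * `|y| ^+ 2 = 2 * (`|x| * `|y|) * (`|x| * `|y| - inner x y) by ring.
by rewrite pmulr_rge0 ?subr_ge0// !mulr_gt0// normr_gt0.
Qed.

Lemma norm_inner_le x y : `|inner x y| <= `|x| * `|y|.
Proof.
rewrite ler_norml inner_le andbT.
by rewrite lerNl -innerNl -[`|x|]normrN inner_le.
Qed.

Lemma inner_inj x y : (forall z, inner x z = inner y z) -> x = y.
Proof.
move=> xy; apply/eqP; rewrite -subr_eq0 -normr_eq0 -sqrf_eq0.
by rewrite -innerxx innerBl xy subrr.
Qed.

Lemma norm_le_inner x M : 0 <= M -> (forall y, inner x y <= M * `|y|) -> `|x| <= M.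
Proof.
move=> M0 xM; have [->|x0] := eqVneq x 0; first by rewrite normr0.
have := xM x; rewrite innerxx expr2 ler_pM2r ?normr_gt0//.
Qed.

End InnerProduct.

Definition bounded_functional {R : realType} {X : normedModType R}
    (L : X -> R) : Prop :=
  (forall l x y, L (l *: x + y) = l * L x + L y) /\
  exists M, 0 <= M /\ forall x, `|L x| <= M * `|x|.

Definition bounded_map {R : realType} {X Y : normedModType R}
    (A : X -> Y) : Prop :=
  (forall l x y, A (l *: x + y) = l *: A x + A y) /\
  exists M, 0 <= M /\ forall x, `|A x| <= M * `|x|.

(** Completeness of a Hilbert space enters only through this property, which
    passes from a space to its dual without a limit argument. *)
Definition riesz_space {R : realType} (X : normedModType R) : Prop :=
  hilbertian X /\ forall L : X -> R, bounded_functional L ->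
    exists r, forall x, L x = inner r x.

Section BoundedFunctional.
Context {R : realType} {X : normedModType R}.
Implicit Types (x y : X) (L : X -> R).

Lemma bfun0 L : bounded_functional L -> L 0 = 0.
Proof. by case=> lL _; have := lL 1 0 0; rewrite scaler0 addr0; lra. Qed.

Lemma bfunD L x y : bounded_functional L -> L (x + y) = L x + L y.
Proof. by case=> lL _; have := lL 1 x y; rewrite scale1r mul1r. Qed.

Lemma bfunZ L l x : bounded_functional L -> L (l *: x) = l * L x.
Proof.
by move=> bL; have := bL.1 l x 0; rewrite !addr0 (bfun0 bL) addr0.
Qed.

Lemma bfunB L x y : bounded_functional L -> L (x - y) = L x - L y.
Proof.
by move=> bL; rewrite bfunD// -scaleN1r bfunZ// mulN1r.
Qed.

Lemma bfun_sum L n (F : 'I_n -> X) : bounded_functional L ->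
  L (\sum_(i < n) F i) = \sum_(i < n) L (F i).
Proof.
move=> bL; elim/big_rec2: _ => [|i a b _ <-]; first exact: bfun0.
by rewrite bfunD.
Qed.

Lemma inner_bounded r : hilbertian X -> @bounded_functional R X (inner r).
Proof.
move=> hX; split=> [l x y|]; first by rewrite innerDr// innerZr.
by exists `|r|; split => // x; exact: norm_inner_le.
Qed.

End BoundedFunctional.

Section BoundedMap.
Context {R : realType} {X Y Z : normedModType R}.

Lemma bmap0 (A : X -> Y) : bounded_map A -> A 0 = 0.
Proof.
by move=> [lA _]; have := lA (-1) 0 0; rewrite scaler0 addr0 scaleN1r addNr.
Qed.

Lemma bmapD (A : X -> Y) x y : bounded_map A -> A (x + y) = A x + A y.
Proof. by move=> [lA _]; have := lA 1 x y; rewrite !scale1r. Qed.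

Lemma bmapZ (A : X -> Y) l x : bounded_map A -> A (l *: x) = l *: A x.
Proof.
by move=> bA; have := bA.1 l x 0; rewrite !addr0 (bmap0 bA) addr0.
Qed.

Lemma bmapB (A : X -> Y) x y : bounded_map A -> A (x - y) = A x - A y.
Proof.
by move=> bA; rewrite bmapD// -scaleN1r bmapZ// scaleN1r.
Qed.

Lemma bmap_sum (A : X -> Y) n (F : 'I_n -> X) : bounded_map A ->
  A (\sum_(i < n) F i) = \sum_(i < n) A (F i).
Proof.
move=> bA; elim/big_rec2: _ => [|i a b _ <-]; first exact: bmap0.
by rewrite bmapD.
Qed.

Lemma bmap_comp (A : Y -> Z) (C : X -> Y) :
  bounded_map A -> bounded_map C -> bounded_map (A \o C).
Proof.
move=> [lA [M [M0 AM]]] [lC [M' [M'0 CM]]]; split=> [l x y /=|].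
  by rewrite lC lA.
exists (M * M'); split=> [|x /=]; first exact: mulr_ge0.
by rewrite (le_trans (AM _))// -mulrA ler_wpM2l.
Qed.

Lemma bfun_comp (L : Y -> R) (C : X -> Y) :
  bounded_functional L -> bounded_map C -> bounded_functional (L \o C).
Proof.
move=> [lA [M [M0 AM]]] [lC [M' [M'0 CM]]]; split=> [l x y /=|].
  by rewrite lC lA.
exists (M * M'); split=> [|x /=]; first exact: mulr_ge0.
by rewrite (le_trans (AM _))// -mulrA ler_wpM2l.
Qed.

End BoundedMap.

Section Riesz.
Context {R : realType}.

(** A continuous functional attains its norm: an element of minimal norm on
    the hyperplane where the functional is one exists because, by the
    parallelogram identity, minimizing sequences in a convex set are Cauchy,
    and it is orthogonal to the kernel. *)
Theorem riesz_representation (X : completeNormedModType R) :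
  hilbertian X -> riesz_space X.
Proof.
move=> hX; split=> // L bL.
have [L0|/existsNP[x1 x1P]] := pselect (forall x, L x = 0).
  by exists 0 => x; rewrite inner0l// L0.
have [M [M0 LM]] := bL.2.
pose S := [set `|x| ^+ 2 | x in [set x | L x = 1]].
have S0 : S !=set0.
  exists (`|(L x1)^-1 *: x1| ^+ 2), ((L x1)^-1 *: x1) => //=.
  by rewrite bfunZ// mulVf//; exact/eqP.
have lS : has_lbound S by exists 0 => _ [x _ <-]; exact: sqr_ge0.
have iS : has_inf S by split.
pose d := inf S.
have dP x : L x = 1 -> d <= `|x| ^+ 2 by move=> Lx; apply: ge_inf => //; exists x.
(* A minimizing sequence; the midpoint of two of its terms stays on the
   hyperplane, so that the parallelogram identity bounds their distance. *)
have /choice[s sP] : forall n : nat, exists x, L x = 1 /\ `|x| ^+ 2 < d + n.+1%:R^-1.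
  move=> n; have /(inf_adherent)/(_ iS) : 0 < n.+1%:R^-1 :> R by rewrite invr_gt0.
  by move=> [_ [x Lx <-]] xd; exists x.
have sB n m : `|s n - s m| ^+ 2 <= 2 * n.+1%:R^-1 + 2 * m.+1%:R^-1.
  have Lh : L (2^-1 *: (s n + s m)) = 1.
    by rewrite bfunZ// bfunD// (sP n).1 (sP m).1; lra.
  have := dP _ Lh; rewrite normrZ exprMn normfV (normD_sqr hX (s n) (s m)) (normB_sqr hX (s n) (s m)).
  rewrite ger0_norm//; have := (sP n).2; have := (sP m).2.
  move: (`|s n| ^+ 2) (`|s m| ^+ 2) (inner _ _) (n.+1%:R^-1) (m.+1%:R^-1) => A B C D E.
  rewrite expr2; clear; lra.
have cs : cvgn s.
  apply/cauchy_cvgP/cauchy_exP => e e0.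
  have e2 : 0 < e ^+ 2 / 4 by rewrite divr_gt0// exprn_gt0.
  have H := near_infty_natSinv_lt (PosNum e2).
  have [n0 Hn0] := filter_ex H.
  exists (s n0); suff : \forall p \near \oo, ball (s n0) e (s p) by [].
  near=> p; rewrite /= -ball_normE /=.
  suff : `|s n0 - s p| ^+ 2 < e ^+ 2 by rewrite ltr_pXn2r ?nnegrE ?normr_ge0 ?(ltW e0).
  apply: le_lt_trans (sB _ _) _.
  have : p.+1%:R^-1 < e ^+ 2 / 4 by near: p.
  move: Hn0 => /=.
  move: (n0.+1%:R^-1) (p.+1%:R^-1) (e ^+ 2) => A B C.
  clear; lra.
pose x0 := lim (s @ \oo).
have sx0 : s @ \oo --> x0 by [].
have Lc y : `|L x0 - L y| <= M * `|x0 - y| by rewrite -bfunB.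
have small (e : R) : 0 < e -> exists n, `|x0 - s n| < e /\ n.+1%:R^-1 < e.
  move=> e0; move/cvgrPdist_lt : sx0 => /(_ _ e0) sx0.
  have [n [? ?]] := (filter_ex (filterI sx0 (near_infty_natSinv_lt (PosNum e0)))).
  by exists n.
have Lx0 : L x0 = 1.
  apply/eqP; rewrite -subr_eq0 -normr_le0; apply/ler_addgt0Pr => e e0; rewrite add0r.
  have e1 : 0 < e / (M + 1) by rewrite divr_gt0// ltr_wpDl.
  have [n [n1 _]] := small _ e1.
  rewrite -(sP n).1 (le_trans (Lc _))//.
  apply: (@le_trans _ _ (M * (e / (M + 1)))); first by rewrite ler_wpM2l// ltW.
  by apply: ltW; rewrite mulrCA gtr_pMr// ltr_pdivrMr ?mul1r ?ltrDl// ltr_wpDl.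
have d0 : 0 <= d by apply: lb_le_inf => // _ [x _ <-]; exact: sqr_ge0.
have x0d : `|x0| ^+ 2 <= d.
  (* The constant bounds the increase of the square when a norm of at most
     [d + 2] grows by [e' <= 1], plus the excess of the n-th term. *)
  apply/ler_addgt0Pr; suff H (e : R) : 0 < e -> `|x0| ^+ 2 <= d + e by exact: H.
  move=> e0.
  have c0 : 0 < 2 * (d + 2) + 2 by move: d0; clear; lra.
  pose e' : R := Num.min 1 (e / (2 * (d + 2) + 2)).
  have e'0 : 0 < e' by rewrite lt_min ltr01 divr_gt0.
  have e'1 : e' <= 1 by rewrite ge_min lexx.
  have e'c : e' * (2 * (d + 2) + 2) <= e.
    by rewrite -ler_pdivlMr// ge_min lexx orbT.
  have [n [n1 n2]] := small _ e'0.
  have sn := (sP n).2.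
  have nn : `|x0| <= `|s n| + e'.
    have := ler_distD (s n) x0 0; rewrite !subr0; move: n1; clear; lra.
  have sn1 : `|s n| <= d + 2.
    have := sqr_ge0 (`|s n| - 1); move: sn n2 e'1.
    move: (n.+1%:R^-1) (e') (`|s n|) (d); clear=> a b c d; nra.
  apply: (@le_trans _ _ ((`|s n| + e') ^+ 2)).
    by rewrite ler_pXn2r// nnegrE ?addr_ge0// ltW.
  have := normr_ge0 (s n); move: sn n2 e'0 e'1 e'c sn1.
  move: (n.+1%:R^-1) (e') (`|s n|) (d) (e); clear=> a b c d e; nra.
have x0N : 0 < `|x0| ^+ 2.
  rewrite exprn_gt0// normr_gt0; apply/eqP => x00.
  by move: Lx0; rewrite x00 bfun0//; lra.
(* Moving along the kernel does not decrease the norm; the best step gives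
   orthogonality. *)
have orth y : L y = 0 -> inner x0 y = 0.
  move=> Ly.
  have H t : 0 <= 2 * t * inner x0 y + t ^+ 2 * `|y| ^+ 2.
    have : L (x0 + t *: y) = 1 by rewrite bfunD// bfunZ// Ly mulr0 addr0.
    move/dP; rewrite normD_sqr// innerZr// normrZ exprMn real_normK ?num_real//.
    lra.
  have [y0|y0] := eqVneq y 0; first by rewrite y0 inner0r.
  have yN : 0 < `|y| ^+ 2 by rewrite exprn_gt0// normr_gt0.
  have := H (- inner x0 y / `|y| ^+ 2).
  have -> : 2 * (- inner x0 y / `|y| ^+ 2) * inner x0 y +
    (- inner x0 y / `|y| ^+ 2) ^+ 2 * `|y| ^+ 2 = - (inner x0 y ^+ 2 / `|y| ^+ 2).
    by field; rewrite normr_eq0.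
  rewrite oppr_ge0 pmulr_lle0 ?invr_gt0// => h.
  by apply/eqP; rewrite -sqrf_eq0 eq_le h sqr_ge0.
exists ((`|x0| ^+ 2)^-1 *: x0) => y; rewrite innerZl//.
have : inner x0 (y - L y *: x0) = 0.
  by apply: orth; rewrite bfunB// bfunZ// Lx0 mulr1 subrr.
rewrite innerBr// innerZr// innerxx => /eqP; rewrite subr_eq0 => /eqP ->.
by rewrite mulrCA mulVf ?mulr1// gt_eqF.
Unshelve. all: by end_near. Qed.

Lemma dual_bounded (X : normedModType R) (f : dual X) : bounded_functional f.
Proof.
have /asboolP[lf [M fM]] := dual_funP f; split=> [l x y|]; first by rewrite lf.
exists `|M|; split=> // x; rewrite (le_trans (fM _))// ler_wpM2r//.
exact: ler_norm.
Qed.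

Lemma dual_le (X : normedModType R) (f : dual X) x : `|f x| <= `|f| * `|x|.
Proof.
have bf := dual_bounded f.
have [->|x0] := eqVneq x 0; first by rewrite bfun0// !normr0 mulr0.
have := @dual_norm_ge _ _ f (`|x|^-1 *: x).
rewrite normrZ normfV normr_id mulVf ?normr_eq0// lexx => /(_ isT).
by rewrite bfunZ// normrM normfV normr_id mulrC ler_pdivrMr ?normr_gt0.
Qed.

Lemma riesz_dual_element (X : normedModType R) (r : X) : hilbertian X ->
  exists f : dual X, forall x, f x = inner r x.
Proof.
move=> hX; have [lr [M [_ rM]]] := inner_bounded r hX.
have P : (inner r : X -> R^o) \in @bounded_linear_functional R X.
  by apply/asboolP; split; [move=> l x y; rewrite lr|exists M].
by exists (Dual P).
Qed.

Lemma dual_ext (X : normedModType R) (f g : dual X) : (forall x, f x = g x) -> f = g.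
Proof. by move=> fg; apply/val_inj/funext. Qed.

Lemma norm_riesz_dual (X : normedModType R) (r : X) (f : dual X) :
  hilbertian X -> (forall x, f x = inner r x) -> `|f| = `|r|.
Proof.
move=> hX fr; apply/eqP; rewrite eq_le; apply/andP; split.
  apply: dual_norm_le => x x1; rewrite fr (le_trans (norm_inner_le hX _ _))//.
  by rewrite ler_piMr.
apply: norm_le_inner => // y; rewrite -fr.
exact: le_trans (ler_norm _) (dual_le _ _).
Qed.

(** The inner product of a dual space is the polarization of the dual norm;
    on represented functionals it is the inner product of the
    representatives, as the representation is an additive isometry. *)
Lemma inner_dual (X : normedModType R) (f g : dual X) (r s : X) :
  hilbertian X -> (forall x, f x = inner r x) -> (forall x, g x = inner s x) ->
  inner f g = inner r s.
Proof.
move=> hX fr gs; rewrite /inner; congr ((_ ^+ 2 - _ ^+ 2) / _).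
  apply: norm_riesz_dual => // x.
  by rewrite (_ : (f + g) x = f x + g x)// fr gs innerDl.
apply: norm_riesz_dual => // x.
by rewrite (_ : (f - g) x = f x - g x)// fr gs innerBl.
Qed.

Lemma inner_dual_eval (X : normedModType R) (f g : dual X) (s : X) :
  riesz_space X -> (forall x, g x = inner s x) -> inner f g = f s.
Proof.
move=> [hX rX] gs; have [r fr] := rX _ (dual_bounded f).
by rewrite (inner_dual hX fr gs) fr.
Qed.

Lemma eval_bounded (X : normedModType R) (s : X) :
  bounded_functional (fun f : dual X => f s).
Proof.
split=> [l f g //|]; exists `|s|; split => // f.
by rewrite mulrC dual_le.
Qed.

Lemma riesz_dual (X : normedModType R) : riesz_space X -> riesz_space (dual X).
Proof.
move=> rX; have [hX rr] := rX; split=> [l f g h|L bL].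
  have [s hs] := rr _ (dual_bounded h).
  by rewrite !(inner_dual_eval _ rX hs).
have [J JP] := choice (fun r => riesz_dual_element r hX).
have bJ : bounded_map J.
  split=> [l x y|].
    apply: dual_ext => z.
    rewrite (_ : (l *: J x + J y) z = l * J x z + J y z)//.
    by rewrite !JP innerDl// innerZl.
  by exists 1; split=> // x; rewrite mul1r (norm_riesz_dual hX (JP x)).
have [r rP] := rr _ (bfun_comp bL bJ).
exists (J r) => f; have [s fs] := rr _ (dual_bounded f).
rewrite (inner_dual hX (JP r) fs) -rP /=; congr L; apply: dual_ext => x.
by rewrite JP fs.
Qed.

End Riesz.

Section OrthogonalProjection.
Context {R : realType} {X : normedModType R}.
Hypothesis hX : hilbertian X.

(** Gram-Schmidt, adding one spanning vector at a time.  Spanning vectors may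
    be dependent; then the new direction [r] is zero and so is the correction,
    division by zero being zero. *)
Lemma orthogonal_projection (S : set X) : findim_subspace S ->
  exists P : X -> X, [/\ bounded_map P, forall x, S (P x),
    forall x s, S s -> inner (P x) s = inner x s & forall x, `|P x| <= `|x|].
Proof.
move=> [n [e ->]]; elim: n e => [|n IH] e.
  exists (fun=> 0); split=> [|x|x s [c ->]|x].
  - by split=> [l x y|]; [rewrite scaler0 addr0|exists 0; split=> // x; rewrite normr0 mul0r].
  - by exists (fun=> 0); rewrite big_ord0.
  - by rewrite big_ord0 !inner0r.
  - by rewrite normr0.
have [P [bP SP oP nP]] := IH (fun i => e (widen_ord (leqnSn n) i)).
have [r rE] : exists r, r = e ord_max - P (e ord_max) by eexists.
pose P' x := P x + (inner x r / `|r| ^+ 2) *: r.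
have inS x : exists c : 'I_n.+1 -> R, P' x = \sum_(i < n.+1) c i *: e i.
  have [c cP] := SP x; have [c' c'P] := SP (e ord_max).
  pose k := inner x r / `|r| ^+ 2.
  (* Only the last index is not below [n]; it carries the new direction. *)
  exists (fun i => if insub (val i) is Some j then c j - k * c' j else k).
  rewrite big_ord_recr /= insubF ?ltnn// /P' -/k [in k *: r]rE scalerBr cP c'P addrA addrAC.
  congr (_ + _); rewrite scaler_sumr -sumrB; apply: eq_bigr => i _.
  rewrite insubT//= => ni.
  rewrite (_ : Sub _ _ = i); last exact: val_inj.
  by rewrite scalerBl scalerA.
have rP x : inner r (P x) = 0 by rewrite rE innerBl// (oP _ _ (SP x)) subrr.
have oP' x s : (exists c : 'I_n.+1 -> R, s = \sum_(i < n.+1) c i *: e i) ->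
   inner (P' x) s = inner x s.
  move=> [c ->]; rewrite big_ord_recr /=.
  set w := \sum_(i < n) _.
  have Sw : exists c' : 'I_n -> R,
      w = \sum_(i < n) c' i *: e (widen_ord (leqnSn n) i).
    by exists (fun i => c (widen_ord (leqnSn n) i)).
  have rw : inner r w = 0 by rewrite rE innerBl// (oP _ w) // subrr.
  have -> : e ord_max = r + P (e ord_max) by rewrite rE subrK.
  rewrite /P' innerDl// innerZl// !innerDr// !innerZr// !innerDr// rw.
  rewrite (oP x w Sw) (innerC (P x) r) !rP (oP x (P (e ord_max)) (SP _)) innerxx.
  have [->|r0] := eqVneq r 0; first by rewrite !inner0r// normr0; ring.
  by field; rewrite normr_eq0.
have nP' x : `|P' x| <= `|x|.
  apply: norm_le_inner => // y.
  have : `|P' x| <= `|x|.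
    have [->|p0] := eqVneq (P' x) 0; first by rewrite normr0.
    have p0' : 0 < `|P' x| by rewrite normr_gt0.
    rewrite -(ler_pM2r p0') -expr2 -innerxx oP'//.
    exact: inner_le.
  by move=> H; rewrite (le_trans (inner_le _ _ _))// ler_wpM2r.
exists P'; split=> //.
split=> [l x y|]; last by exists 1; split => // x; rewrite mul1r.
rewrite /P' (bP.1) innerDl// innerZl// scalerDr scalerA addrACA; congr (_ + _).
by rewrite -scalerDl mulrDl (mulrA l (inner x r)).
Qed.

End OrthogonalProjection.
(** * Integrals of functions that are only almost everywhere measurable *)

Section Integral.
Context {R : realType}.
Notation mu := (@lebesgue_measure R).
Implicit Types (D E : set (measurableTypeR R)) (F G H : R -> R).

Import HBNNSimple.

Lemma ae_imp (P Q : R -> Prop) : (forall t, P t -> Q t) ->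
  {ae mu, forall t, P t} -> {ae mu, forall t, Q t}.
Proof. by move=> PQ; apply: filterS PQ; exact: (ae_filter_ringOfSetsType mu). Qed.

Lemma ae_imp2 (P1 P2 Q : R -> Prop) : (forall t, P1 t -> P2 t -> Q t) ->
  {ae mu, forall t, P1 t} -> {ae mu, forall t, P2 t} -> {ae mu, forall t, Q t}.
Proof. by move=> PQ; apply: filterS2 PQ; exact: (ae_filter_ringOfSetsType mu). Qed.

Lemma ae_imp3 (P1 P2 P3 Q : R -> Prop) :
  (forall t, P1 t -> P2 t -> P3 t -> Q t) ->
  {ae mu, forall t, P1 t} -> {ae mu, forall t, P2 t} -> {ae mu, forall t, P3 t} ->
  {ae mu, forall t, Q t}.
Proof. by move=> PQ; apply: filterS3 PQ; exact: (ae_filter_ringOfSetsType mu). Qed.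

(** Outside a measurable null set a simple function below [f] is below [g];
    cutting it off there does not change its integral. *)
Lemma ge0_le_integral_ae D (f g : R -> \bar R) : measurable D ->
  (forall t, D t -> 0 <= f t)%E -> (forall t, D t -> 0 <= g t)%E ->
  {ae mu, forall t, D t -> (f t <= g t)%E} ->
  (\int[mu]_(t in D) f t <= \int[mu]_(t in D) g t)%E.
Proof.
move=> mD f0 g0 [N [mN N0 fgN]].
rewrite !ge0_integralE //= ge_ereal_sup// => _ [h/= hf] <-.
pose h' := mul_nnsfun h (indic_nnsfun R (measurableC mN)).
apply: le_ereal_sup_tmp; exists (sintegral mu h'); last first.
  rewrite -!integralT_nnsfun (@ge0_ae_eq_integral _ _ _ mu setT (EFin \o h) (EFin \o h'))//.
  - exact/measurable_EFinP.
  - exact/measurable_EFinP.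
  - by move=> x _; rewrite lee_fin; exact: fun_ge0.
  - by move=> x _; rewrite lee_fin; exact: fun_ge0.
  - exists N; split=> // t /= tP; apply: contrapT => Nt; apply: tP => _.
    by rewrite mindicE mem_set// mulr1.
exists h' => //= t; rewrite patchE; case: ifPn => tD.
- rewrite /h' /= mindicE; have [Nt|Nt] := pselect (N t).
  + rewrite memNset; last by move=> /(_ Nt).
    by rewrite mulr0 g0//; exact/set_mem.
  + rewrite mem_set// mulr1; have := hf t; rewrite patchE tD => /le_trans; apply.
    by apply: contrapT => tfg; apply: Nt; apply: fgN => /= /(_ (set_mem tD)).
- have := hf t; rewrite patchE (negbTE tD) lee_fin => ht0.
  by rewrite /h' /= lee_fin mindicE mulr_le0_ge0.
Qed.

Lemma ge0_eq_integral_ae D (f g : R -> \bar R) : measurable D ->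
  (forall t, D t -> 0 <= f t)%E -> (forall t, D t -> 0 <= g t)%E ->
  {ae mu, forall t, D t -> f t = g t} ->
  (\int[mu]_(t in D) f t = \int[mu]_(t in D) g t)%E.
Proof.
move=> mD f0 g0 fg; apply/eqP; rewrite eq_le.
by apply/andP; split; apply: ge0_le_integral_ae => //;
  apply: ae_imp _ fg => t fgt Dt; rewrite fgt.
Qed.

(** The integral of a nonnegative function is a supremum over simple functions
    below it, so that altering any function on a null set, even in a
    nonmeasurable way, does not change its integral. *)
Lemma eq_integral_ae D (f g : R -> \bar R) : measurable D ->
  {ae mu, forall t, D t -> f t = g t} ->
  (\int[mu]_(t in D) f t = \int[mu]_(t in D) g t)%E.
Proof.
move=> mD fg; rewrite integralE [RHS]integralE; congr (_ - _)%E.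
all: by apply: ge0_eq_integral_ae => //; apply: ae_imp _ fg => t fgt Dt;
  rewrite ?funeposE ?funenegE fgt.
Qed.

Lemma eq_Rintegral_ae D F G : measurable D ->
  {ae mu, forall t, D t -> F t = G t} ->
  (\int[mu]_(t in D) F t = \int[mu]_(t in D) G t)%R.
Proof.
move=> mD FG; rewrite /Rintegral; congr fine; apply: eq_integral_ae => //.
by apply: ae_imp _ FG => t FGt Dt; rewrite FGt.
Qed.

(** Measurability is Borel measurability, and the Borel sigma-algebra is not
    complete: a limit that exists only almost everywhere, such as a strongly
    measurable function, need only agree with a measurable function up to a
    null set. *)
Definition ae_measurable D F := exists2 G, measurable_fun D G &
  {ae mu, forall t, D t -> F t = G t}.

Definition ae_integrable D F := exists2 G, mu.-integrable D (EFin \o G) &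
  {ae mu, forall t, D t -> F t = G t}.

Section Algebra.
Variable (D : set (measurableTypeR R)) (mD : measurable D).

Lemma ae_integrable_ext F G : {ae mu, forall t, D t -> F t = G t} ->
  ae_integrable D F -> ae_integrable D G.
Proof.
move=> FG [F' iF' FF']; exists F' => //.
by apply: ae_imp2 _ FG FF' => t FG FF' Dt; rewrite -FG// FF'.
Qed.

Lemma ae_integrable_eq F G : (forall t, D t -> F t = G t) ->
  ae_integrable D F -> ae_integrable D G.
Proof. by move=> FG; apply: ae_integrable_ext; apply: aeW. Qed.

Lemma ae_integrableW F : mu.-integrable D (EFin \o F) -> ae_integrable D F.
Proof. by move=> iF; exists F => //; apply: aeW. Qed.

Lemma ae_integrableD F G : ae_integrable D F -> ae_integrable D G ->
  ae_integrable D (fun t => F t + G t).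
Proof.
move=> [F' iF FF'] [G' iG GG']; exists (fun t => F' t + G' t).
  exact: (integrableD mD iF iG).
by apply: ae_imp2 _ FF' GG' => t FF' GG' Dt; rewrite FF'// GG'.
Qed.

Lemma ae_integrableZ l F : ae_integrable D F ->
  ae_integrable D (fun t => l * F t).
Proof.
move=> [F' iF FF']; exists (fun t => l * F' t).
  exact: (integrableZl mD l iF).
by apply: ae_imp _ FF' => t FF' Dt; rewrite FF'.
Qed.

Lemma ae_integrableB F G : ae_integrable D F -> ae_integrable D G ->
  ae_integrable D (fun t => F t - G t).
Proof.
move=> iF iG.
apply: (@ae_integrable_eq (fun t => F t + (-1) * G t)).
  by move=> t _; rewrite mulN1r.
by apply: ae_integrableD => //; exact: ae_integrableZ.
Qed.

Lemma ae_integrable0 : ae_integrable D (fun=> 0).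
Proof. by apply: ae_integrableW; exact: integrable0. Qed.

Lemma ae_integrable_sum n (F : 'I_n -> R -> R) :
  (forall i, ae_integrable D (F i)) ->
  ae_integrable D (fun t => \sum_(i < n) F i t).
Proof.
move=> iF; elim: n F iF => [|n IH] F iF.
  by apply: ae_integrable_eq ae_integrable0 => t _; rewrite big_ord0.
apply: (@ae_integrable_eq (fun t => F ord0 t + \sum_(i < n) F (lift ord0 i) t)).
  by move=> t _; rewrite big_ord_recl.
by apply: ae_integrableD => //; apply: IH.
Qed.

Lemma ae_integrable_norm F : ae_integrable D F ->
  ae_integrable D (fun t => `|F t|).
Proof.
move=> [F' iF FF']; exists (fun t => `|F' t|).
  exact: (integrable_norm iF).
by apply: ae_imp _ FF' => t FF' Dt; rewrite FF'.
Qed.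

Lemma RintD F G : ae_integrable D F -> ae_integrable D G ->
  (\int[mu]_(t in D) (F t + G t) =
   \int[mu]_(t in D) F t + \int[mu]_(t in D) G t)%R.
Proof.
move=> [F' iF FF'] [G' iG GG'].
rewrite (eq_Rintegral_ae mD FF') (eq_Rintegral_ae mD GG') -RintegralD//.
apply: eq_Rintegral_ae => //.
by apply: ae_imp2 _ FF' GG' => t FF' GG' Dt; rewrite FF'// GG'.
Qed.

Lemma RintZ l F : ae_integrable D F ->
  (\int[mu]_(t in D) (l * F t) = l * \int[mu]_(t in D) F t)%R.
Proof.
move=> [F' iF FF']; rewrite (eq_Rintegral_ae mD FF') -RintegralZl//.
apply: eq_Rintegral_ae => //.
by apply: ae_imp _ FF' => t FF' Dt; rewrite FF'.
Qed.

Lemma RintB F G : ae_integrable D F -> ae_integrable D G ->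
  (\int[mu]_(t in D) (F t - G t) =
   \int[mu]_(t in D) F t - \int[mu]_(t in D) G t)%R.
Proof.
move=> iF iG; rewrite -mulN1r -RintZ// -RintD//; last exact: ae_integrableZ.
by apply: eq_Rintegral => t _; rewrite mulN1r.
Qed.

Lemma Rint0 : (\int[mu]_(t in D) 0 = 0)%R.
Proof. by rewrite Rintegral_cst// mul0r. Qed.

Lemma Rint_sum n (F : 'I_n -> R -> R) :
  (forall i, ae_integrable D (F i)) ->
  (\int[mu]_(t in D) (\sum_(i < n) F i t) =
   \sum_(i < n) \int[mu]_(t in D) F i t)%R.
Proof.
move=> iF; elim: n F iF => [|n IH] F iF.
  by rewrite big_ord0 -[RHS]Rint0; apply: eq_Rintegral => t _; rewrite big_ord0.
rewrite big_ord_recl -IH// -RintD//; last exact: ae_integrable_sum.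
by apply: eq_Rintegral => t _; rewrite big_ord_recl.
Qed.

Lemma le_Rint F G : ae_integrable D F -> ae_integrable D G ->
  {ae mu, forall t, D t -> F t <= G t} ->
  (\int[mu]_(t in D) F t <= \int[mu]_(t in D) G t)%R.
Proof.
move=> iF iG FG; rewrite -subr_ge0 -RintB//.
have [H iH HFG] := ae_integrableB iG iF.
rewrite (eq_Rintegral_ae mD HFG).
rewrite (@eq_Rintegral_ae _ _ (fun t => `|H t|))//.
  by apply: Rintegral_ge0.
apply: ae_imp2 _ FG HFG => t FG HFG Dt.
by rewrite -HFG// ger0_norm// subr_ge0 FG.
Qed.

Lemma norm_Rint_le F : ae_integrable D F ->
  `|\int[mu]_(t in D) F t|%R <= (\int[mu]_(t in D) `|F t|)%R.
Proof.
move=> [F' iF FF']; rewrite (eq_Rintegral_ae mD FF').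
rewrite (@eq_Rintegral_ae _ (fun t => `|F t|) (fun t => `|F' t|))//.
  exact: le_normr_Rintegral.
by apply: ae_imp _ FF' => t FF' Dt; rewrite FF'.
Qed.

Lemma ae_integrable_le F G : ae_measurable D F -> ae_integrable D G ->
  {ae mu, forall t, D t -> `|F t| <= G t} -> ae_integrable D F.
Proof.
move=> [F' mF FF'] [G' iG GG'] FG.
(* Truncation at the bound makes the domination hold everywhere. *)
pose K t := Num.min (Num.max (F' t) (- G' t)) (G' t).
have FK : {ae mu, forall t, D t -> F t = K t}.
  apply: ae_imp3 _ FF' GG' FG => t FF' GG' FG Dt.
  have := FG Dt; rewrite ler_norml GG'// FF'// => /andP[h1 h2].
  by rewrite /K max_l// min_l.
have mG : measurable_fun D G' by apply/measurable_EFinP; exact: measurable_int iG.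
exists K => //; apply: (le_integrable mD _ _ iG); last first.
  move=> t Dt /=; rewrite lee_fin /K.
  have [g0|g0] := leP 0 (G' t).
    rewrite (ger0_norm g0) ler_norml ge_min lexx orbT andbT le_min.
    by rewrite le_max lexx orbT /= (le_trans _ g0)// oppr_le0.
  rewrite min_r// le_max; apply/orP; right.
  by rewrite (le_trans (ltW g0))// oppr_ge0 ltW.
apply/measurable_EFinP/measurable_minr => //; apply: measurable_maxr => //.
exact: measurableT_comp.
Qed.

Lemma ge0_ae_integrableP F : ae_measurable D F -> (forall t, D t -> 0 <= F t) ->
  (\int[mu]_(t in D) (F t)%:E < +oo)%E -> ae_integrable D F.
Proof.
move=> [G mG FG] F0 Foo; exists G => //; apply/integrableP; split.
  exact/measurable_EFinP.
rewrite (le_lt_trans _ Foo)// le_eqVlt; apply/orP; left; apply/eqP.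
apply: eq_integral_ae => //; apply: ae_imp _ FG => t FG Dt /=.
by rewrite -FG// ger0_norm// F0.
Qed.

Lemma ge0_integral_Rint F : ae_integrable D F -> (forall t, D t -> 0 <= F t) ->
  (\int[mu]_(t in D) (F t)%:E)%E = (\int[mu]_(t in D) F t)%R%:E.
Proof.
move=> [G iG FG] F0; rewrite (eq_Rintegral_ae mD FG).
rewrite (@eq_integral_ae _ _ (EFin \o G))//; last first.
  by apply: ae_imp _ FG => t FG Dt; rewrite /= FG.
by rewrite /Rintegral fineK//; exact: integrable_fin_num.
Qed.

End Algebra.

Lemma ae_integrableS D E F : measurable D -> measurable E -> E `<=` D ->
  ae_integrable D F -> ae_integrable E F.
Proof.
move=> mD mE ED [G iG FG]; exists G; first exact: integrableS iG.
by apply: ae_imp _ FG => t FG /ED.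
Qed.

Lemma ae_integrable_subitv (a b c d : R) F : a <= c -> d <= b ->
  ae_integrable `]a, b[ F -> ae_integrable `]c, d[ F.
Proof.
move=> ac db; apply: ae_integrableS => // t /=; rewrite !in_itv/=.
by move=> /andP[ct td]; rewrite (le_lt_trans ac)// (lt_le_trans td).
Qed.

Lemma integrable_patch_itv (a b : R) F : mu.-integrable `]a, b[ (EFin \o F) ->
  mu.-integrable setT (EFin \o (F \_ `]a, b[)).
Proof.
move=> iF; rewrite -restrict_EFin.
exact: (@integrable_mkcond _ _ _ mu `]a, b[ (EFin \o F) (measurable_itv _)).1.
Qed.

Let point_ae (c : R) : {ae mu, forall t, t != c}.
Proof.
exists [set c]; split=> //; first exact: lebesgue_measure_set1.
by move=> t /= /negP; rewrite negbK => /eqP.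
Qed.

Lemma ae_integrable_cat (a b c : R) F : a <= b -> b <= c ->
  ae_integrable `]a, b[ F -> ae_integrable `]b, c[ F ->
  ae_integrable `]a, c[ F /\ (\int[mu]_(t in `]a, c[) F t =
   \int[mu]_(t in `]a, b[) F t + \int[mu]_(t in `]b, c[) F t)%R.
Proof.
move=> ab bc [G iG FG] [H iH FH].
pose K := (G \_ `]a, b[) \+ (H \_ `]b, c[).
have FK : {ae mu, forall t, `]a, c[%classic t -> F t = K t}.
  apply: ae_imp3 _ FG FH (point_ae b) => t FG FH tb; rewrite /= in_itv/= => /andP[at_ tc].
  rewrite /K /= !patchE; case: (ltP t b) => tb'.
    rewrite mem_set ?memNset ?addr0 ?FG//= in_itv/= ?at_ ?tb'//.
    by rewrite ltNge (ltW tb').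
  have {}tb' : b < t by rewrite lt_neqAle eq_sym tb tb'.
  rewrite memNset ?mem_set ?add0r ?FH//= in_itv/= ?tb' ?tc//.
  by rewrite (ltNge t b) (ltW tb') andbF.
have iGT := integrable_patch_itv iG; have iHT := integrable_patch_itv iH.
have iKT : mu.-integrable setT (EFin \o K).
  exact: (integrableD measurableT iGT iHT).
have iK : mu.-integrable `]a, c[ (EFin \o K) by exact: integrableS iKT.
split; first by exists K.
rewrite (eq_Rintegral_ae (measurable_itv _) FK) (eq_Rintegral_ae (measurable_itv _) FG).
rewrite (eq_Rintegral_ae (measurable_itv _) FH).
rewrite [in LHS]Rintegral_mkcond [X in X + _]Rintegral_mkcond [X in _ + X]Rintegral_mkcond.
rewrite -RintegralD//; apply: eq_Rintegral => t _.
rewrite patchE; case: ifPn => // /negP tac.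
rewrite !patchE !memNset ?addr0//= in_itv/= => /andP[t1 t2]; apply: tac; rewrite inE /= in_itv/=.
  by rewrite (le_lt_trans ab).
by rewrite t1 (lt_le_trans t2).
Qed.

Lemma Rint_itv0 (a b : R) F : b <= a -> (\int[mu]_(t in `]a, b[) F t = 0)%R.
Proof. by move=> ba; rewrite set_itv_ge ?Rintegral_set0// bnd_simp -leNgt. Qed.

Lemma Rint_sub (a b c : R) F : a <= b -> b <= c -> ae_integrable `]a, c[ F ->
  (\int[mu]_(t in `]b, c[) F t =
   \int[mu]_(t in `]a, c[) F t - \int[mu]_(t in `]a, b[) F t)%R.
Proof.
move=> ab bc iF; have [||_ ->] := @ae_integrable_cat a b c F ab bc.
- exact: ae_integrable_subitv iF.
- exact: ae_integrable_subitv iF.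
- by rewrite addrC addKr.
Qed.

Lemma ae_integrable_grid (tg : nat -> R) n F :
  (forall m, (m < n)%N -> tg m < tg m.+1) ->
  (forall m, (m < n)%N -> ae_integrable `]tg m, tg m.+1[ F) ->
  [/\ tg 0%N <= tg n, ae_integrable `]tg 0%N, tg n[ F &
  (\int[mu]_(t in `]tg 0%N, tg n[) F t =
    \sum_(m < n) \int[mu]_(t in `]tg m, tg m.+1[) F t)%R].
Proof.
elim: n => [|n IH] tgS iF.
  split=> //; last by rewrite big_ord0 Rint_itv0.
  by rewrite set_itv_ge ?bnd_simp ?ltxx//; apply: ae_integrableW; exact: integrable_set0.
have [||t0 i0 e0] := IH; [by move=> m /ltnW; exact: tgS|by move=> m /ltnW; exact: iF|].
have tn := tgS n (ltnSn n).
have [iF' eF] := ae_integrable_cat t0 (ltW tn) i0 (iF n (ltnSn n)).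
by split=> //; [exact: le_trans (ltW tn)|rewrite eF e0 big_ord_recr].
Qed.

Lemma ae_integrable_continuous (a b : R) F : continuous F ->
  ae_integrable `]a, b[ F.
Proof.
move=> cF; apply: ae_integrableW.
apply: (@integrableS _ _ _ mu `[a, b]) => //.
  exact: subset_itv_oo_cc.
apply: continuous_compact_integrable; first exact: segment_compact.
exact: continuous_subspaceT.
Qed.

Lemma ae_integrable_horner (a b : R) (p : {poly R}) :
  ae_integrable `]a, b[ (horner p).
Proof. by apply: ae_integrable_continuous => x; exact: continuous_horner. Qed.

Lemma ae_integrable_hornerM (a b : R) (p : {poly R}) F :
  ae_integrable `]a, b[ F -> ae_integrable `]a, b[ (fun t => p.[t] * F t).
Proof.
move=> iF.
have [M MP] : exists M, forall t, t \in `[a, b] -> `|p.[t]| <= M.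
  have [ab|ba] := leP a b; last first.
    by exists 0 => t; rewrite in_itv/= => /andP[at_ /(le_trans at_)]; rewrite leNgt ba.
  have cp : {within `[a, b], continuous (fun t => `|p.[t]|)}.
    apply: continuous_subspaceT => x; apply: cvg_norm; exact: continuous_horner.
  by have [c _ cP] := EVT_max ab cp; exists `|p.[c]|.
have [G iG FG] := iF.
apply: (@ae_integrable_le _ _ _ (fun t => M * `|F t|)) => //.
- exists (fun t => p.[t] * G t); last by apply: ae_imp _ FG => t FG Dt; rewrite FG.
  apply: measurable_funM; first exact: measurable_poly.
  by apply/measurable_EFinP; exact: measurable_int iG.
- by apply: ae_integrableZ => //; exact: ae_integrable_norm.
- apply: aeW => t /=; rewrite in_itv/= => /andP[at_ tb]; rewrite normrM ler_wpM2r//.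
  by apply: MP; rewrite in_itv/= !ltW.
Qed.

Lemma FTC_horner (a b : R) (p : {poly R}) : a <= b ->
  (\int[mu]_(t in `]a, b[) p^`().[t] = p.[b] - p.[a])%R.
Proof.
rewrite le_eqVlt => /predU1P[->|ab]; first by rewrite Rint_itv0// subrr.
have -> : (\int[mu]_(t in `]a, b[) p^`().[t] = \int[mu]_(t in `[a, b]) p^`().[t])%R.
  rewrite /Rintegral; congr fine; rewrite [RHS]integral_itv_bndoo//.
  by apply/measurable_EFinP; exact: measurable_poly.
rewrite /Rintegral (@continuous_FTC2 _ _ (horner p))//.
- by apply: continuous_subspaceT => x; exact: continuous_horner.
- split.
  + by move=> x _; exact: derivable_horner.
  + by apply: cvg_at_right_filter; exact: continuous_horner.
  + by apply: cvg_at_left_filter; exact: continuous_horner.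
- by move=> x _; rewrite -derivE.
Qed.

(** The antiderivative is constant, and by Lebesgue differentiation it has
    the integrand as its derivative almost everywhere. *)
Lemma Rint0_ae_eq0 (a b : R) F : ae_integrable `]a, b[ F ->
  (forall t, a < t < b -> (\int[mu]_(s in `]a, t[) F s = 0)%R) ->
  {ae mu, forall t, `]a, b[%classic t -> F t = 0}.
Proof.
move=> [G iG FG] F0.
pose K := G \_ `]a, b[.
have iK : mu.-integrable setT (EFin \o K) := integrable_patch_itv iG.
have iKy (y : R) : mu.-integrable [set` Interval (BRight a) (BRight y)] (EFin \o K).
  exact: integrableS iK.
have lK : locally_integrable [set: R] K.
  split.
  - by apply/measurable_EFinP; exact: measurable_int iK.
  - exact: openT.
  - move=> C _ cC; have mC := compact_measurable cC.
    have iC : mu.-integrable (C : set (measurableTypeR R)) (EFin \o K).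
      exact: integrableS iK.
    by have /integrableP[] := iC.
have H := FTC1 iKy lK.
apply: ae_imp2 _ (FG) H => x FG' H /= xab; have := xab; rewrite in_itv/= => /andP[ax xb].
rewrite FG'//; have [|_] := H; first by rewrite ?bnd_simp.
rewrite {2}/K patchE mem_set// => <-.
rewrite derive1E (@near_eq_derive _ _ _ _ (cst 0))// ?oner_neq0 ?derive_cst//.
have xI : x \in `]a, b[ by [].
apply: filterS (near_in_itvoo xI) => y yab; rewrite /cst -(F0 y); last first.
  by move: yab; rewrite in_itv.
move: yab; rewrite in_itv/= => /andP[ay yb].
rewrite -Rintegral_itv_bndo_bndc; last exact: integrableS iK.
symmetry; apply: eq_Rintegral_ae => //; apply: ae_imp _ FG => t FGt.
rewrite /= in_itv/= => /andP[at_ ty].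
have tab : `]a, b[%classic t by rewrite /= in_itv/= at_ (lt_trans ty).
by rewrite FGt// /K patchE mem_set.
Qed.

(** Continuity of the antiderivative carries an identity with a polynomial
    from an open interval to its endpoints. *)
Lemma Rint_eq_horner_closed (a b : R) F (p : {poly R}) : a < b ->
  ae_integrable `]a, b[ F ->
  (forall t, a < t < b -> (\int[mu]_(s in `]a, t[) F s = p.[t])%R) ->
  p.[a] = 0 /\ (\int[mu]_(s in `]a, b[) F s = p.[b])%R.
Proof.
move=> ab [G iG FG] Fp.
pose K := G \_ `]a, b[.
have iK : mu.-integrable setT (EFin \o K) := integrable_patch_itv iG.
pose P t := parameterized_integral mu a t K.
have PE t : t <= b -> P t = (\int[mu]_(s in `]a, t[) F s)%R.
  move=> tb; rewrite /P /parameterized_integral.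
  have -> : (\int[mu]_(s in `]a, t[) F s = \int[mu]_(s in `]a, t[) K s)%R.
    apply: eq_Rintegral_ae => //; apply: ae_imp _ FG => s FGs.
    rewrite /= in_itv/= => /andP[as_ st].
    have sab : `]a, b[%classic s by rewrite /= in_itv/= as_ (lt_le_trans st).
    by rewrite FGs// /K patchE mem_set.
  rewrite /Rintegral; congr fine; rewrite integral_itv_bndoo//.
  apply: (@measurable_int _ _ _ mu); exact: integrableS iK.
have iKab : mu.-integrable `[a, b] (EFin \o K) by exact: integrableS iK.
have /(continuous_within_itvP _ ab)[_ ca cb] :=
  parameterized_integral_continuous (ltW ab) iKab.
have Pp x : a < x < b -> P x = p.[x].
  by move=> /andP[ax xb]; rewrite PE ?ltW// Fp// ax.
split.
- have P0 : P a = 0 by rewrite /P /parameterized_integral set_itv1 Rintegral_set1.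
  rewrite -[RHS]P0; apply: (@cvg_unique _ (@Rhausdorff R) (P x @[x --> a^'+])) => //.
  have pa : p.[x] @[x --> a^'+] --> p.[a].
    by apply: cvg_at_right_filter; exact: continuous_horner.
  apply: cvg_trans pa; apply: near_eq_cvg.
  near=> x; rewrite Pp//; apply/andP; split; near: x.
    exact: nbhs_right_gt.
  exact: nbhs_right_lt.
- rewrite -PE//; apply: (@cvg_unique _ (@Rhausdorff R) (P x @[x --> b^'-])) => //.
  have pb : p.[x] @[x --> b^'-] --> p.[b].
    by apply: cvg_at_left_filter; exact: continuous_horner.
  apply: cvg_trans pb; apply: near_eq_cvg.
  near=> x; rewrite Pp//; apply/andP; split; near: x.
    exact: nbhs_left_gt.
  exact: nbhs_left_lt.
Unshelve. all: by end_near. Qed.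

(** Hoelder's inequality without measurability of the first factor [h]: by
    Young's inequality a multiple of [F] minus a multiple of [y ^+ 2] stays
    below [h ^+ 2], so that its integral stays below the lower integral; then
    the parameter is optimized. *)
Lemma Rint_le_lower_hoelder D F (h y : R -> R) (A : R) : measurable D ->
  ae_integrable D F -> ae_integrable D (fun t => y t ^+ 2) ->
  (forall t, D t -> 0 <= y t) -> (forall t, D t -> F t <= `|h t| * y t) ->
  0 <= A -> (\int[mu]_(t in D) (`|h t| ^+ 2)%:E <= (A ^+ 2)%:E)%E ->
  (\int[mu]_(t in D) F t <= A * Num.sqrt (\int[mu]_(t in D) (y t ^+ 2)))%R.
Proof.
move=> mD iF iy y0 Fhy A0 hA.
set I := (\int[mu]_(t in D) F t)%R; set Y2 := (\int[mu]_(t in D) (y t ^+ 2))%R.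
have Y0 : 0 <= Y2 by apply: Rintegral_ge0 => t _; exact: sqr_ge0.
have key (l : R) : 0 < l -> 2 * I <= l * A ^+ 2 + l^-1 * Y2.
  move=> l0.
  pose phi t := (2 * l^-1) * F t - (l^-1 ^+ 2) * y t ^+ 2.
  have iphi : ae_integrable D phi.
    by apply: ae_integrableB => //; exact: ae_integrableZ.
  have phih t : D t -> phi t <= `|h t| ^+ 2.
    move=> Dt; have := Fhy t Dt; rewrite /phi.
    have := sqr_ge0 (`|h t| - l^-1 * y t).
    have : 0 < l^-1 by rewrite invr_gt0.
    move: (l^-1) (`|h t|) (y t) (F t) => a b c d; clear=> *; nra.
  pose phip t := Num.max (phi t) 0.
  have phipE t : phip t = 2^-1 * (phi t + `|phi t|).
    rewrite /phip; have [h0|h0] := leP (phi t) 0.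
      by rewrite ler0_norm// subrr mulr0.
    by rewrite gtr0_norm//; move: (phi t); clear=> *; lra.
  have iphip : ae_integrable D phip.
    apply: (@ae_integrable_eq _ (fun t => 2^-1 * (phi t + `|phi t|))).
      by move=> t _; rewrite phipE.
    by apply: ae_integrableZ => //; apply: ae_integrableD => //; exact: ae_integrable_norm.
  have : (\int[mu]_(t in D) phi t <= A ^+ 2)%R.
    apply: (@le_trans _ _ (\int[mu]_(t in D) phip t)%R).
      by apply: le_Rint => //; apply: aeW => t _; rewrite /phip le_max lexx.
    rewrite -lee_fin -ge0_integral_Rint//; last first.
      by move=> t _; rewrite /phip le_max lexx orbT.
    apply: le_trans hA; apply: ge0_le_integral_ae; first exact: mD.
    - by move=> t _; rewrite lee_fin /phip le_max lexx orbT.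
    - by move=> t _; rewrite lee_fin sqr_ge0.
    - by apply: aeW => t Dt; rewrite lee_fin /phip ge_max phih// sqr_ge0.
  rewrite RintB ?RintZ//; [|exact: ae_integrableZ|exact: ae_integrableZ].
  rewrite -/I -/Y2 -(ler_pM2l l0) mulrBr.
  rewrite (_ : l * (2 * l^-1 * I) = 2 * I); last by field; rewrite gt_eqF.
  rewrite (_ : l * (l^-1 ^+ 2 * Y2) = l^-1 * Y2); last by field; rewrite gt_eqF.
  by rewrite lerBlDr.
have [s s0 Ys] : exists2 s, 0 <= s & Y2 = s ^+ 2.
  by exists (Num.sqrt Y2); rewrite ?sqrtr_ge0// sqr_sqrtr.
rewrite Ys sqrtr_sqr ger0_norm//; rewrite {}Ys in key.
apply/ler_addgt0Pr; suff H (e : R) : 0 < e -> I <= A * s + e by exact: H.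
move=> e0.
(* The optimal parameter is [s / A]; both are shifted by [d] since they may be
   zero. *)
pose d : R := e / (A + s + 1).
have d0 : 0 < d by rewrite divr_gt0// ltr_wpDl// addr_ge0.
have As : 0 < A + d by rewrite ltr_wpDl.
have ss : 0 < s + d by rewrite ltr_wpDl.
have := key ((s + d) / (A + d)); rewrite divr_gt0// => /(_ isT).
rewrite invf_div => H.
have h1 : (s + d) / (A + d) * A ^+ 2 <= (s + d) * A.
  rewrite -mulrA ler_pM2l// expr2 mulrA ler_piMl// mulrC ler_pdivrMr// mul1r.
  by rewrite lerDl ltW.
have h2 : (A + d) / (s + d) * s ^+ 2 <= (A + d) * s.
  rewrite -mulrA ler_pM2l// expr2 mulrA ler_piMl// mulrC ler_pdivrMr// mul1r.
  by rewrite lerDl ltW.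
have h3 : d * (A + s) <= e.
  by rewrite /d mulrAC ler_pdivrMr ?ltr_wpDl ?addr_ge0// ler_pM2l// lerDl.
by move: H h1 h2 h3 A0 s0; move: (_ / _ * _) (_ / _ * _) => a b; move: e0; clear; lra.
Qed.

End Integral.
(** * Bochner integrals and bounded functionals *)

Section FiniteValued.
Context {R : realType}.

(** The property of being a simple function for maps into any type, so that
    simple functions can be composed and paired. *)
Definition finite_valued {U : Type} (s : R -> U) : Prop :=
  finite_set (range s) /\ forall x, measurable (s @^-1` [set x]).

Lemma finite_valued_preimage {U : Type} (s : R -> U) (S : set U) :
  finite_valued s -> measurable (s @^-1` S).
Proof.
move=> [fs ms].
have -> : s @^-1` S = \bigcup_(x in range s `&` S) (s @^-1` [set x]).
  apply/seteqP; split=> [t St|t [x [_ Sx] /= ->]//].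
  by exists (s t) => //; split=> //; exists t.
by apply: fin_bigcup_measurable => //; exact: finite_setIl.
Qed.

Lemma finite_valued_comp {U W : Type} (g : U -> W) (s : R -> U) :
  finite_valued s -> finite_valued (g \o s).
Proof.
move=> fs; split=> [|x].
  by rewrite -(image_comp s g); apply: finite_image; exact: fs.1.
exact: (@finite_valued_preimage _ s (g @^-1` [set x]) fs).
Qed.

Lemma finite_valued_pair {U W : Type} (s : R -> U) (s' : R -> W) :
  finite_valued s -> finite_valued s' -> finite_valued (fun t => (s t, s' t)).
Proof.
move=> [fs ms] [fs' ms']; split=> [|[x y]].
  apply: sub_finite_set (finite_setX fs fs') => _ [t _ <-].
  by split; exists t.
rewrite (_ : _ @^-1` _ = s @^-1` [set x] `&` s' @^-1` [set y]).
  exact: measurableI.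
by apply/seteqP; split=> t /= => [[-> ->]|[-> ->]].
Qed.

End FiniteValued.

Section Bochner.
Context {R : realType}.
Notation mu := (@lebesgue_measure R).
Implicit Types (X Y : normedModType R).

Import HBSimple.

Lemma simple_decomposition X (s : R -> X) : simple_function s ->
  exists n (y : 'I_n -> X) (A : 'I_n -> set (measurableTypeR R)),
  [/\ forall i, measurable (A i),
      forall t, s t = \sum_(i < n) \1_(A i) t *: y i &
      forall D, simple_integral D s =
        \sum_(i < n) fine (mu (D `&` A i)) *: y i].
Proof.
move=> [fs ms].
pose r := finmap.enum_fset (fset_set (range s)).
exists (size r), (tnth (in_tuple r)), (fun i => s @^-1` [set tnth (in_tuple r) i]).
split=> [i|t|D]; first exact: ms.
- have st : s t \in r by rewrite in_fset_set// inE; exists t.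
  rewrite -(big_tnth _ _ r predT (fun y => \1_(s @^-1` [set y]) t *: y)).
  rewrite (bigD1_seq (s t))//=; last exact: finmap.fset_uniq.
  rewrite indicE mem_set//= scale1r big1 ?addr0// => y yst.
  rewrite indicE memNset ?scale0r// => /= sty.
  by rewrite sty eqxx in yst.
- rewrite /simple_integral fsbig_finite//.
  by rewrite -(big_tnth _ _ r predT (fun y => fine (mu (D `&` s @^-1` [set y])) *: y)).
Qed.

Lemma simple_functional X (s : R -> X) (L : X -> R) D :
  measurable (D : set (measurableTypeR R)) -> (mu D < +oo)%E ->
  simple_function s -> bounded_functional L ->
  ae_integrable D (fun t => L (s t)) /\
  L (simple_integral D s) = (\int[mu]_(t in D) L (s t))%R.
Proof.
move=> mD Doo /simple_decomposition[n [y [A [mA sE iE]]]] bL.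
have LsE t : L (s t) = \sum_(i < n) L (y i) * \1_(A i) t.
  by rewrite sE (bfun_sum _ bL); apply: eq_bigr => i _; rewrite (bfunZ _ _ bL) mulrC.
have iA i : ae_integrable D (\1_(A i) : R -> R).
  apply: ae_integrableW; apply: measurable_bounded_integrable => //.
  exists 1; split => // M M1 t _ /=.
  by rewrite indicE; case: (_ \in _); rewrite ?normr1 ?normr0 ltW// (lt_trans _ M1).
have iLA i : ae_integrable D (fun t => L (y i) * \1_(A i) t) by exact: ae_integrableZ.
split.
  apply: (@ae_integrable_eq _ _ (fun t => \sum_(i < n) L (y i) * \1_(A i) t)).
    by move=> t _; rewrite LsE.
  exact: ae_integrable_sum.
rewrite iE (bfun_sum _ bL).
transitivity (\int[mu]_(t in D) (\sum_(i < n) L (y i) * \1_(A i) t))%R; last first.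
  by apply: eq_Rintegral => t _; rewrite LsE.
rewrite Rint_sum//; apply: eq_bigr => i _; rewrite RintZ// (bfunZ _ _ bL) mulrC.
by congr (_ * _); rewrite /Rintegral integral_indic// setIC.
Qed.

(** Measurable images of a strongly measurable function are taken up to a null
    set, because the limits that define it exist almost everywhere only. *)
Lemma strongly_measurable_comp X D (f : R -> X) (phi : X -> R) :
  measurable (D : set (measurableTypeR R)) -> strongly_measurable D f ->
  continuous phi -> ae_measurable D (fun t => phi (f t)).
Proof.
move=> mD [s [ss [N [mN N0 sN]]]] cphi.
have sf t : D t -> ~ N t -> s n t @[n --> \oo] --> f t.
  by move=> Dt Nt; apply: contrapT => H; apply: Nt; apply: sN => /= /(_ Dt).
exists (fun t => phi (f t) * \1_(~` N) t); last first.
  exists N; split=> // t /= H; apply: contrapT => Nt; apply: H => Dt.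
  by rewrite indicE mem_set ?mulr1.
apply: (@measurable_fun_cvg _ _ _ _ (fun n t => phi (s n t) * \1_(~` N) t)).
- move=> n; apply: measurable_funM; last first.
    by apply: measurable_funTS; exact: measurable_indic (measurableC mN).
  move=> _ Y mY; apply: measurableI => //.
  exact: (@finite_valued_preimage _ _ (s n) (phi @^-1` Y) (ss n)).
- move=> t Dt; rewrite indicE; have [Nt|Nt] := pselect (N t).
    rewrite memNset; last by move=> /(_ Nt).
    by rewrite mulr0; under eq_fun do rewrite mulr0; exact: cvg_cst.
  rewrite mem_set// mulr1; under eq_fun do rewrite mulr1.
  by apply: continuous_cvg; [exact: cphi|exact: sf].
Qed.

Lemma strongly_measurable_map X Y D (f : R -> X) (A : X -> Y) :
  strongly_measurable D f -> continuous A -> strongly_measurable D (A \o f).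
Proof.
move=> [s [ss sf]] cA; exists (fun n => A \o s n); split=> [n|].
  exact: finite_valued_comp (ss n).
apply: ae_imp _ sf => t sf Dt.
by apply: continuous_cvg; [exact: cA|exact: sf].
Qed.

Lemma strongly_measurableD X D (f g : R -> X) :
  strongly_measurable D f -> strongly_measurable D g ->
  strongly_measurable D (fun t => f t + g t).
Proof.
move=> [s [ss sf]] [s' [ss' sg]]; exists (fun n t => s n t + s' n t); split=> [n|].
  exact: (finite_valued_comp (fun xy => xy.1 + xy.2)
           (finite_valued_pair (ss n) (ss' n))).
by apply: ae_imp2 _ sf sg => t sf sg Dt; apply: cvgD; [exact: sf|exact: sg].
Qed.

Lemma strongly_measurable_ext X D (f g : R -> X) :
  {ae mu, forall t, D t -> f t = g t} ->
  strongly_measurable D f -> strongly_measurable D g.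
Proof.
move=> fg [s [ss sf]]; exists s; split=> //.
by apply: ae_imp2 _ fg sf => t fg sf Dt; rewrite -fg//; exact: sf.
Qed.

Lemma strongly_measurableS X D E (f : R -> X) : E `<=` D ->
  strongly_measurable D f -> strongly_measurable E f.
Proof.
by move=> ED [s [ss sf]]; exists s; split=> //; apply: ae_imp _ sf => t sf /ED.
Qed.

Lemma strongly_measurable_simple X D (s : R -> X) : simple_function s ->
  strongly_measurable D s.
Proof.
by move=> ss; exists (fun=> s); split=> //; apply: aeW => t _; exact: cvg_cst.
Qed.

Lemma bmap_continuous X Y (A : X -> Y) : bounded_map A -> continuous A.
Proof.
move=> bA x; have [M [M0 AM]] := bA.2.
have M1 : 0 < M + 1 by rewrite ltr_wpDl.
apply/cvgrPdist_lt => e e0; have e1 : 0 < e / (M + 1) by rewrite divr_gt0.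
near=> y; rewrite -(bmapB _ _ bA) (le_lt_trans (AM _))//.
apply: (@le_lt_trans _ _ ((M + 1) * `|x - y|)); first by rewrite ler_wpM2r// lerDl.
rewrite mulrC -ltr_pdivlMr//; near: y; exact: filterS (nbhsx_ballx x _ e1).
Unshelve. all: by end_near. Qed.

Lemma bfun_continuous X (L : X -> R) : bounded_functional L -> continuous L.
Proof. by move=> bL; exact: (@bmap_continuous X R^o L). Qed.

Lemma strongly_measurableB X D (f g : R -> X) :
  strongly_measurable D f -> strongly_measurable D g ->
  strongly_measurable D (fun t => f t - g t).
Proof.
move=> sf sg; apply: strongly_measurableD => //.
by apply: (strongly_measurable_map sg) => x; exact: opp_continuous.
Qed.

Lemma strongly_measurable_norm X D (f : R -> X) :
  measurable (D : set (measurableTypeR R)) ->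
  strongly_measurable D f -> ae_measurable D (fun t => `|f t|).
Proof.
by move=> mD sf; apply: strongly_measurable_comp => //; exact: norm_continuous.
Qed.

(** Approximability by simple functions in the mean; unlike the Bochner
    integral itself it does not mention the value of the integral, which in a
    space with inner product is determined by its components. *)
Definition bochner_integrable X D (f : R -> X) : Prop :=
  strongly_measurable D f /\ forall e, 0 < e -> exists s, [/\ simple_function s,
    ae_integrable D (fun t => `|f t - s t|) &
    (\int[mu]_(t in D) `|f t - s t|)%R <= e].

Lemma bochner_integral_integrable X D (f : R -> X) x :
  measurable (D : set (measurableTypeR R)) ->
  is_bochner_integral D f x ->
  forall e, 0 < e -> exists s, [/\ simple_function s,
    ae_integrable D (fun t => `|f t - s t|),
    (\int[mu]_(t in D) `|f t - s t|)%R <= e & `|simple_integral D s - x| < e].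
Proof.
move=> mD [sf [s [ss fs sx]]] e e0.
move/fine_cvgP : fs => [/= f1 /cvgr0Pnorm_lt /(_ _ e0) f2].
move/cvgrPdist_lt : sx => /(_ _ e0) f3.
have [n [[n1 n2] n3]] := filter_ex (filterI (filterI f1 f2) f3).
have ii : ae_integrable D (fun t => `|f t - s n t|).
  apply: ge0_ae_integrableP => //.
    apply: strongly_measurable_norm => //; apply: strongly_measurableB => //.
    exact: strongly_measurable_simple.
  by move: n1; rewrite ge0_fin_numE//; exact: integral_ge0.
exists (s n); split=> //; last by rewrite distrC.
move: n2; rewrite /= ger0_norm ?fine_ge0 ?integral_ge0//; exact: ltW.
Qed.

Lemma is_bochner_integrable X D (f : R -> X) x :
  measurable (D : set (measurableTypeR R)) ->
  is_bochner_integral D f x -> bochner_integrable D f.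
Proof.
move=> mD bf; split=> [|e e0]; first exact: bf.1.
by have [s [? ? ? _]] := bochner_integral_integrable mD bf e0; exists s.
Qed.

Lemma bochner_integrable_functional X D (f : R -> X) (L : X -> R) :
  measurable (D : set (measurableTypeR R)) -> (mu D < +oo)%E ->
  bochner_integrable D f -> bounded_functional L ->
  ae_integrable D (fun t => L (f t)).
Proof.
move=> mD Doo [sf bf] bL.
have [s [ss is_ _]] := bf 1 ltr01.
have [M [M0 LM]] := bL.2.
have [iLs _] := simple_functional mD Doo ss bL.
apply: (@ae_integrable_le _ _ mD _ (fun t => M * `|f t - s t| + `|L (s t)|)).
- by apply: (strongly_measurable_comp mD sf); exact: bfun_continuous.
- by apply: ae_integrableD => //; [exact: ae_integrableZ|exact: ae_integrable_norm].
- apply: aeW => t _.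
  rewrite -{1}(subrK (s t) (f t)) (bfunD _ _ bL) (le_trans (ler_normD _ _))//.
  by rewrite lerD2r.
Qed.

(** True for simple functions; both sides depend continuously on the function
    in the mean. *)
Lemma bochner_functional X D (f : R -> X) x (L : X -> R) :
  measurable (D : set (measurableTypeR R)) -> (mu D < +oo)%E ->
  is_bochner_integral D f x -> bounded_functional L ->
  L x = (\int[mu]_(t in D) L (f t))%R.
Proof.
move=> mD Doo bf bL; have [M [M0 LM]] := bL.2.
have iLf := bochner_integrable_functional mD Doo (is_bochner_integrable mD bf) bL.
apply/eqP; rewrite -subr_eq0 -normr_le0; apply/ler_addgt0Pr.
suff H (e : R) : 0 < e -> `|L x - (\int[mu]_(t in D) L (f t))%R| <= 0 + e.
  by move=> e e0; exact: H.
move=> e0; have M1 : 0 < 2 * M + 1 by rewrite ltr_wpDl// mulr_ge0.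
have [|s [ss is_ ie se]] := bochner_integral_integrable mD bf (e := e / (2 * M + 1)).
  by rewrite divr_gt0.
have [iLs Ls] := simple_functional mD Doo ss bL.
have h1 : `|L x - L (simple_integral D s)| <= M * (e / (2 * M + 1)).
  rewrite -(bfunB _ _ bL) (le_trans (LM _))// ler_wpM2l// distrC; exact: ltW.
have h2 : `|L (simple_integral D s) - (\int[mu]_(t in D) L (f t))%R|
    <= M * (e / (2 * M + 1)).
  rewrite distrC Ls -RintB// (le_trans (norm_Rint_le _ _))//.
    exact: ae_integrableB.
  apply: le_trans (ler_wpM2l M0 ie); rewrite -RintZ//; apply: le_Rint => //.
  - by apply: ae_integrable_norm => //; exact: ae_integrableB.
  - exact: ae_integrableZ.
  - by apply: aeW => t _; rewrite -(bfunB _ _ bL).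
rewrite add0r (le_trans (ler_distD (L (simple_integral D s)) _ _))//.
apply: le_trans (lerD h1 h2) _.
have -> : M * (e / (2 * M + 1)) + M * (e / (2 * M + 1)) = e * (2 * M) / (2 * M + 1).
  by ring.
by rewrite ler_pdivrMr// ler_pM2l// lerDl.
Qed.

(** In an inner product space, an approximable function has a Bochner integral
    as soon as a vector has the right components: the distance from the
    integral of an approximating simple function to that vector is bounded by
    testing with the difference itself. *)
Lemma bochner_intro X D (f : R -> X) x :
  measurable (D : set (measurableTypeR R)) -> (mu D < +oo)%E ->
  hilbertian X -> bochner_integrable D f ->
  (forall y, inner y x = (\int[mu]_(t in D) inner y (f t))%R) ->
  is_bochner_integral D f x.
Proof.
move=> mD Doo hX bf wx; have [sf af] := bf; split=> //.
have /choice[s sP] : forall n : nat, exists s, [/\ simple_function s,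
    ae_integrable D (fun t => `|f t - s t|) &
    (\int[mu]_(t in D) `|f t - s t|)%R <= n.+1%:R^-1].
  by move=> n; apply: af; rewrite invr_gt0.
have cvi : (fun n : nat => n.+1%:R^-1 : R) @ \oo --> (0 : R) by exact: cvg_harmonic.
exists s; split=> [n||]; first by have [] := sP n.
- apply: (@squeeze_cvge _ _ _ _ (fun=> 0%E) _ (fun n : nat => (n.+1%:R^-1)%:E)).
  + apply: nearW => n; have [_ is_ ie] := sP n.
    by rewrite ge0_integral_Rint// !lee_fin ie andbT; apply: Rintegral_ge0.
  + exact: cvg_cst.
  + by apply: cvg_EFin => //; exact: nearW.
- apply/cvgrPdist_le => e e0.
  have /cvgrPdist_le/(_ _ e0) := cvi; apply: filterS => n.
  rewrite sub0r normrN ger0_norm ?invr_ge0// => ne.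
  have [ss is_ ie] := sP n.
  apply: le_trans ne; apply: norm_le_inner => // y.
  have by_ := inner_bounded y hX.
  have [iys ys] := simple_functional mD Doo ss by_.
  have iyf := bochner_integrable_functional mD Doo bf by_.
  rewrite innerC innerBr// wx ys -RintB// mulrC.
  apply: le_trans (ler_wpM2l (normr_ge0 y) ie); rewrite -RintZ//; apply: le_Rint => //.
  + exact: ae_integrableB.
  + exact: ae_integrableZ.
  + by apply: aeW => t _; rewrite -innerBr// inner_le.
Qed.

Lemma bochner_integrableD X D (f g : R -> X) :
  measurable (D : set (measurableTypeR R)) ->
  bochner_integrable D f -> bochner_integrable D g ->
  bochner_integrable D (fun t => f t + g t).
Proof.
move=> mD [sf af] [sg ag]; split=> [|e e0]; first exact: strongly_measurableD.
have e2 : 0 < e / 2 by rewrite divr_gt0.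
have [s [ss is_ ie]] := af _ e2; have [s' [ss' is' ie']] := ag _ e2.
have ss2 : simple_function (fun t => s t + s' t).
  exact: (finite_valued_comp (fun xy => xy.1 + xy.2) (finite_valued_pair ss ss')).
have le2 t : `|f t + g t - (s t + s' t)| <= `|f t - s t| + `|g t - s' t|.
  by rewrite opprD addrACA ler_normD.
have i2 : ae_integrable D (fun t => `|f t + g t - (s t + s' t)|).
  apply: (@ae_integrable_le _ _ mD _ (fun t => `|f t - s t| + `|g t - s' t|)).
  - apply: strongly_measurable_norm => //; apply: strongly_measurableB.
      exact: strongly_measurableD.
    exact: strongly_measurable_simple.
  - exact: ae_integrableD.
  - by apply: aeW => t _; rewrite normr_id.
exists (fun t => s t + s' t); split=> //.
rewrite (splitr e); apply: le_trans (lerD ie ie'); rewrite -RintD//.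
by apply: le_Rint => //; [exact: ae_integrableD|exact: aeW].
Qed.

Lemma bochner_integrable_map X Y D (A : X -> Y) (f : R -> X) :
  measurable (D : set (measurableTypeR R)) -> bounded_map A ->
  bochner_integrable D f -> bochner_integrable D (fun t => A (f t)).
Proof.
move=> mD bA [sf af]; have [M [M0 AM]] := bA.2.
have sAf : strongly_measurable D (fun t => A (f t)).
  by apply: (strongly_measurable_map sf); exact: bmap_continuous.
split=> // e e0; have M1 : 0 < M + 1 by rewrite ltr_wpDl.
have [|s [ss is_ ie]] := af (e / (M + 1)); first by rewrite divr_gt0.
have sAs : simple_function (fun t => A (s t)) by exact: (finite_valued_comp A ss).
have iA : ae_integrable D (fun t => `|A (f t) - A (s t)|).
  apply: (@ae_integrable_le _ _ mD _ (fun t => M * `|f t - s t|)).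
  - apply: strongly_measurable_norm => //; apply: strongly_measurableB => //.
    exact: strongly_measurable_simple.
  - exact: ae_integrableZ.
  - by apply: aeW => t _; rewrite normr_id -(bmapB _ _ bA).
exists (fun t => A (s t)); split=> //.
apply: (@le_trans _ _ (M * (e / (M + 1)))).
  apply: le_trans (ler_wpM2l M0 ie); rewrite -RintZ//.
  apply: le_Rint => //; first exact: ae_integrableZ.
  by apply: aeW => t _; rewrite -(bmapB _ _ bA).
by rewrite mulrA ler_pdivrMr// mulrC ler_pM2l// lerDl.
Qed.

Lemma bochner_integrable_ext X D (f g : R -> X) :
  measurable (D : set (measurableTypeR R)) ->
  {ae mu, forall t, D t -> f t = g t} ->
  bochner_integrable D f -> bochner_integrable D g.
Proof.
move=> mD fg [sf af]; split=> [|e e0]; first exact: strongly_measurable_ext sf.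
have [s [ss is_ ie]] := af _ e0.
have fg' : {ae mu, forall t, D t -> `|f t - s t| = `|g t - s t|}.
  by apply: ae_imp _ fg => t fg Dt; rewrite fg.
exists s; split=> //; first exact: ae_integrable_ext is_.
by rewrite -(eq_Rintegral_ae mD fg').
Qed.

Lemma bochner_integrableS X D E (f : R -> X) :
  measurable (D : set (measurableTypeR R)) ->
  measurable (E : set (measurableTypeR R)) -> E `<=` D ->
  bochner_integrable D f -> bochner_integrable E f.
Proof.
move=> mD mE ED [sf af]; split=> [|e e0]; first exact: strongly_measurableS sf.
have [s [ss is_ ie]] := af _ e0.
exists s; split=> //; first exact: ae_integrableS is_.
apply: le_trans ie; rewrite -lee_fin.
rewrite -!ge0_integral_Rint//; last exact: ae_integrableS is_.
rewrite integral_mkcond [leRHS]integral_mkcond.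
apply: ge0_le_integral_ae => //.
- by move=> t _; rewrite patchE; case: ifPn.
- by move=> t _; rewrite patchE; case: ifPn.
- apply: aeW => t _; rewrite !patchE.
  case: ifPn => [tE|_]; last by case: ifPn => _; rewrite ?lee_fin.
  by rewrite mem_set//; apply: ED; exact: set_mem.
Qed.

Lemma bochner_integrable_scale X D (F : R -> R) (c : X) :
  measurable (D : set (measurableTypeR R)) -> (mu D < +oo)%E ->
  ae_integrable D F -> bochner_integrable D (fun t => F t *: c).
Proof.
move=> mD Doo [G iG FG].
have FG' : {ae mu, forall t, D t -> G t *: c = F t *: c}.
  by apply: ae_imp _ FG => t FG Dt; rewrite FG.
apply: bochner_integrable_ext FG' _ => //.
have bc : @bounded_map R R^o X (fun r => r *: c).
  split=> [l x y|]; first by rewrite scalerDl scalerA.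
  by exists `|c|; split=> // x; rewrite normrZ mulrC.
apply: (@bochner_integrable_map R^o X D (fun r => r *: c) G) => //.
have [g [ig Gg cg]] := approximation_sfun_integrable mD iG.
have sg n : simple_function (g n : R -> R^o).
  split=> [|x]; first by have := @fimfunP _ _ (g n).
  exact: (@measurable_funPTI _ _ _ _ (g n)).
have sG : strongly_measurable D (G : R -> R^o).
  exists g; split=> //; apply: aeW => t Dt.
  by move/fine_cvgP : (Gg t Dt) => [].
split=> // e e0.
move/fine_cvgP : cg => [/= f1 /cvgr0Pnorm_lt /(_ _ e0) f2].
have [n [n1 n2]] := filter_ex (filterI f1 f2).
have ii : ae_integrable D (fun t => `|G t - g n t|).
  apply: ge0_ae_integrableP => //.
    apply: (@strongly_measurable_norm R^o) => //; apply: strongly_measurableB => //.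
    exact: strongly_measurable_simple.
  by move: n1; rewrite ge0_fin_numE//; exact: integral_ge0.
exists (g n); split=> //.
move: n2; rewrite /= ger0_norm ?fine_ge0 ?integral_ge0//; exact: ltW.
Qed.

(** The norm of a strongly measurable function is measurable up to a null set,
    so that finiteness of the lower integral is integrability. *)
Lemma L2E X D (f : R -> X) : measurable (D : set (measurableTypeR R)) ->
  L2 D f <-> strongly_measurable D f /\ ae_integrable D (fun t => `|f t| ^+ 2).
Proof.
move=> mD; split=> -[sf h]; split=> //.
- apply: ge0_ae_integrableP => //.
    apply: (@strongly_measurable_comp X D f (fun x => `|x| ^+ 2)) => // x.
    by apply: cvgM; exact: norm_continuous.
  move: h; rewrite /L2norm !ltey; apply: contra => /eqP h; apply/eqP.
  by apply: eqy_poweR => //; rewrite invr_gt0.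
- by rewrite /L2norm ge0_integral_Rint// poweR_lty// ltry.
Qed.

End Bochner.
(** * Weak integrability and weak time derivatives *)

Section WeakIntegrability.
Context {R : realType}.
Notation mu := (@lebesgue_measure R).
Implicit Types (X Y : normedModType R).

(** Dominated functions with integrable components: their moments against
    polynomials exist through the Riesz property, and bounded functionals reduce
    every statement about them to real functions. *)
Definition weakly_integrable X D (w : R -> X) : Prop :=
  (forall L : X -> R, bounded_functional L -> ae_integrable D (fun t => L (w t))) /\
  exists2 psi, ae_integrable D psi & {ae mu, forall t, D t -> `|w t| <= psi t}.

Lemma weakly_integrableD X D (w z : R -> X) :
  measurable (D : set (measurableTypeR R)) ->
  weakly_integrable D w -> weakly_integrable D z ->
  weakly_integrable D (fun t => w t + z t).
Proof.
move=> mD [iw [psi ipsi wpsi]] [iz [phi iphi zphi]]; split=> [L bL|].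
  apply: (@ae_integrable_eq _ _ (fun t => L (w t) + L (z t))).
    by move=> t _; rewrite bfunD.
  by apply: ae_integrableD => //; [exact: iw|exact: iz].
exists (fun t => psi t + phi t); first exact: ae_integrableD.
apply: ae_imp2 _ wpsi zphi => t wpsi zphi Dt.
by rewrite (le_trans (ler_normD _ _))// lerD// ?wpsi ?zphi.
Qed.

Lemma weakly_integrable_map X Y D (A : X -> Y) (w : R -> X) :
  measurable (D : set (measurableTypeR R)) -> bounded_map A ->
  weakly_integrable D w -> weakly_integrable D (fun t => A (w t)).
Proof.
move=> mD bA [iw [psi ipsi wpsi]]; split=> [L bL|].
  exact: (iw (L \o A) (bfun_comp bL bA)).
have [M [M0 AM]] := bA.2.
exists (fun t => M * psi t); first exact: ae_integrableZ.
apply: ae_imp _ wpsi => t wpsi Dt.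
by rewrite (le_trans (AM _))// ler_wpM2l// wpsi.
Qed.

Lemma weakly_integrableB X D (w z : R -> X) :
  measurable (D : set (measurableTypeR R)) ->
  weakly_integrable D w -> weakly_integrable D z ->
  weakly_integrable D (fun t => w t - z t).
Proof.
move=> mD iw iz; apply: weakly_integrableD => //.
apply: (@weakly_integrable_map X X D (fun x => - x)) => //.
split=> [l x y|]; first by rewrite opprD scalerN.
by exists 1; split=> // x; rewrite normrN mul1r.
Qed.

Lemma weakly_integrableS X D E (w : R -> X) :
  measurable (D : set (measurableTypeR R)) ->
  measurable (E : set (measurableTypeR R)) -> E `<=` D ->
  weakly_integrable D w -> weakly_integrable E w.
Proof.
move=> mD mE ED [iw [psi ipsi wpsi]]; split=> [L bL|].
  by apply: (@ae_integrableS _ D) => //; exact: iw.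
exists psi; first exact: (@ae_integrableS _ D).
by apply: ae_imp _ wpsi => t wpsi /ED.
Qed.

Lemma bochner_integrable_weakly X D (w : R -> X) :
  measurable (D : set (measurableTypeR R)) -> (mu D < +oo)%E ->
  strongly_measurable D w -> ae_integrable D (fun t => `|w t|) ->
  weakly_integrable D w.
Proof.
move=> mD Doo sw iw; split=> [L bL|]; last first.
  by exists (fun t => `|w t|) => //; exact: aeW.
have [M [M0 LM]] := bL.2.
apply: (@ae_integrable_le _ _ mD _ (fun t => M * `|w t|)).
- by apply: (strongly_measurable_comp mD sw); exact: bfun_continuous.
- exact: ae_integrableZ.
- exact: aeW.
Qed.

Lemma ae_integrable_cst (a b : R) (c : R) : ae_integrable `]a, b[ (fun=> c).
Proof. by apply: ae_integrable_continuous => x; exact: cvg_cst. Qed.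

Lemma itv_finite_measure (a b : R) : (mu `]a, b[ < +oo)%E.
Proof. by rewrite lebesgue_measure_itv/=; case: ifPn => // _; rewrite -EFinB ltry. Qed.

Lemma L2_weakly X (a b : R) (w : R -> X) : L2 `]a, b[ w ->
  weakly_integrable `]a, b[ w.
Proof.
move=> /(L2E _ (measurable_itv _))[sw iw].
apply: bochner_integrable_weakly => //; first exact: itv_finite_measure.
apply: (@ae_integrable_le _ _ _ _ (fun t => 1 + `|w t| ^+ 2)) => //.
- exact: strongly_measurable_norm.
- by apply: ae_integrableD => //; exact: ae_integrable_cst.
- apply: aeW => t _; rewrite normr_id.
  have := sqr_ge0 (`|w t| - 1); have := normr_ge0 (w t).
  by move: (`|w t|) => r; clear; nra.
Qed.

Lemma norm_Rint_functional X (a b : R) (w : R -> X) (psi : R -> R) (p : {poly R})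
    (L : X -> R) M : 0 <= M -> (forall x, `|L x| <= M * `|x|) ->
  bounded_functional L -> weakly_integrable `]a, b[ w ->
  ae_integrable `]a, b[ psi ->
  {ae mu, forall t, `]a, b[%classic t -> `|w t| <= psi t} ->
  `|\int[mu]_(t in `]a, b[) (p.[t] * L (w t))|%R <=
  M * (\int[mu]_(t in `]a, b[) `|p.[t] * psi t|)%R.
Proof.
move=> M0 LM bL [iw _] ipsi wpsi.
have i1 := ae_integrable_hornerM p (iw L bL).
have i2 : ae_integrable `]a, b[ (fun t => `|p.[t] * psi t|).
  by apply: ae_integrable_norm => //; exact: ae_integrable_hornerM.
apply: le_trans (norm_Rint_le _ i1) _ => //; rewrite -RintZ//.
apply: le_Rint => //; [exact: ae_integrable_norm|exact: ae_integrableZ|].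
apply: ae_imp _ wpsi => t wpsi Dt.
have h := wpsi Dt.
rewrite !normrM mulrCA ler_wpM2l// (le_trans (LM _))// ler_wpM2l//.
exact: le_trans h (ler_norm _).
Qed.

Lemma moment_exists X (a b : R) (w : R -> X) (p : {poly R}) : riesz_space X ->
  weakly_integrable `]a, b[ w -> exists m, forall x,
    inner m x = (\int[mu]_(t in `]a, b[) (p.[t] * inner (w t) x))%R.
Proof.
move=> [hX rX] iw.
have bi x : @bounded_functional R X (fun y => inner y x).
  have := inner_bounded x hX; congr bounded_functional.
  by apply/funext => y; rewrite innerC.
have iwx x := ae_integrable_hornerM p (iw.1 _ (bi x)).
have [psi ipsi wpsi] := iw.2.
have [|m mP] := rX (fun x => \int[mu]_(t in `]a, b[) (p.[t] * inner (w t) x))%R.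
  split=> [l x y|].
    rewrite -RintZ// -RintD//; last exact: ae_integrableZ.
    apply: eq_Rintegral => t _; rewrite innerDr// innerZr//; ring.
  exists (\int[mu]_(t in `]a, b[) `|p.[t] * psi t|)%R; split.
    by apply: Rintegral_ge0.
  move=> x; rewrite mulrC; apply: (@norm_Rint_functional X a b w psi p (fun y => inner y x)) => // y.
  by rewrite mulrC norm_inner_le.
by exists m => x; rewrite -mP.
Qed.

End WeakIntegrability.

Section Primitive.
Context {R : realType}.
Notation mu := (@lebesgue_measure R).
Variable T : R.
Implicit Types (h dh : R -> R).

(** Absolute continuity of [h] on [[0, T]] in integral form. *)
Definition primitive h dh : Prop := ae_integrable `]0, T[ dh /\
  forall t, 0 <= t <= T -> h t - h 0 = (\int[mu]_(s in `]0, t[) dh s)%R.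

Lemma primitiveD h dh h' dh' : primitive h dh -> primitive h' dh' ->
  primitive (fun t => h t + h' t) (fun t => dh t + dh' t).
Proof.
move=> [i1 p1] [i2 p2]; split=> [|t t0T]; first exact: ae_integrableD.
have /andP[_ tT] := t0T.
rewrite RintD//; [|exact: ae_integrable_subitv i1|exact: ae_integrable_subitv i2].
rewrite -p1// -p2//; ring.
Qed.

Lemma primitiveZ l h dh : primitive h dh ->
  primitive (fun t => l * h t) (fun t => l * dh t).
Proof.
move=> [i1 p1]; split=> [|t t0T]; first exact: ae_integrableZ.
have /andP[_ tT] := t0T.
rewrite RintZ//; last exact: ae_integrable_subitv i1.
rewrite -p1//; ring.
Qed.

Lemma primitiveB h dh h' dh' : primitive h dh -> primitive h' dh' ->
  primitive (fun t => h t - h' t) (fun t => dh t - dh' t).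
Proof.
move=> P P'; have [i p] := primitiveD P (primitiveZ (-1) P').
split=> [|t /p].
  by apply: ae_integrable_eq i => t _; rewrite mulN1r.
rewrite !mulN1r => ->; apply: eq_Rintegral => s _; by rewrite mulN1r.
Qed.

Lemma primitive_itv h dh a t : primitive h dh -> 0 <= a -> a <= t -> t <= T ->
  (\int[mu]_(s in `]a, t[) dh s)%R = h t - h a.
Proof.
move=> [i p] a0 at_ tT; rewrite (@Rint_sub _ 0)//; last first.
  exact: ae_integrable_subitv i.
rewrite -!p ?a0 ?tT ?(le_trans a0) ?(le_trans at_)//; ring.
Qed.

(** The difference of two derivatives has a constant primitive. *)
Lemma primitive_unique h dh dh' : primitive h dh -> primitive h dh' ->
  {ae mu, forall t, `]0, T[%classic t -> dh t = dh' t}.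
Proof.
move=> P P'.
have [i p] := primitiveB P P'.
have H : {ae mu, forall t, `]0, T[%classic t -> dh t - dh' t = 0}.
  apply: Rint0_ae_eq0 => // t /andP[t0 tT].
  by rewrite -p ?subrr// !ltW.
by apply: ae_imp _ H => t H /H /eqP; rewrite subr_eq0 => /eqP.
Qed.

Lemma primitive_horner h dh a b (p : {poly R}) : primitive h dh ->
  0 <= a -> a < b -> b <= T -> (forall t, a < t < b -> h t = p.[t]) ->
  [/\ h a = p.[a], h b = p.[b] &
    {ae mu, forall t, `]a, b[%classic t -> dh t = p^`().[t]}].
Proof.
move=> P a0 ab bT hp.
have i : ae_integrable `]a, b[ dh by exact: ae_integrable_subitv P.1.
have [|ha hb] := @Rint_eq_horner_closed _ a b dh (p - (h a)%:P) ab i.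
  move=> t /andP[at_ tb].
  rewrite (primitive_itv P)// ?ltW// ?(lt_le_trans tb)//.
  by rewrite hornerD hornerN hornerC hp// at_.
have pa : h a = p.[a].
  by move/eqP: ha; rewrite hornerD hornerN hornerC subr_eq0 => /eqP.
split=> //.
  move: hb; rewrite (primitive_itv P)// ?ltW// hornerD hornerN hornerC.
  by move/addIr.
have H : {ae mu, forall t, `]a, b[%classic t -> dh t - p^`().[t] = 0}.
  apply: Rint0_ae_eq0 => [|t /andP[at_ tb]].
    by apply: ae_integrableB => //; exact: ae_integrable_horner.
  rewrite RintB//; last 2 first.
  - by apply: ae_integrable_subitv i => //; exact: ltW.
  - exact: ae_integrable_horner.
  rewrite (primitive_itv P)// ?ltW// ?(lt_le_trans tb)//.
  by rewrite FTC_horner ?ltW// hp ?at_// pa subrr.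
by apply: ae_imp _ H => t H /H /eqP; rewrite subr_eq0 => /eqP.
Qed.

Lemma primitive_integrable h dh : 0 < T -> primitive h dh ->
  ae_integrable `]0, T[ h.
Proof.
move=> T0 [[G iG dhG] p].
pose K := G \_ `]0, T[.
have iK : mu.-integrable setT (EFin \o K) := integrable_patch_itv iG.
have iK0T : mu.-integrable `[0, T] (EFin \o K) by exact: integrableS iK.
pose P t := parameterized_integral mu 0 t K.
have cP := parameterized_integral_continuous (ltW T0) iK0T.
have iP : ae_integrable `]0, T[ P.
  apply: ae_integrableW; apply: (@integrableS _ _ _ mu `[0, T]) => //.
    exact: subset_itv_oo_cc.
  by apply: continuous_compact_integrable => //; exact: segment_compact.
apply: (@ae_integrable_eq _ _ (fun t => P t + h 0)); last first.
  by apply: ae_integrableD => //; exact: ae_integrable_cst.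
move=> t /=; rewrite in_itv/= => /andP[t0 tT].
have -> : P t = h t - h 0; last by rewrite subrK.
rewrite p ?ltW// /P /parameterized_integral.
have -> : (\int[mu]_(s in `]0, t[) dh s = \int[mu]_(s in `]0, t[) K s)%R.
  apply: eq_Rintegral_ae => //; apply: ae_imp _ dhG => s FGs.
  rewrite /= in_itv/= => /andP[as_ st].
  have sab : `]0, T[%classic s by rewrite /= in_itv/= as_ (lt_trans st).
  by rewrite FGs// /K patchE mem_set.
rewrite /Rintegral; congr fine; rewrite integral_itv_bndoo//.
apply: (@measurable_int _ _ _ mu); exact: integrableS iK.
Qed.

End Primitive.

Section TimeDerivative.
Context {R : realType}.
Notation mu := (@lebesgue_measure R).
Variables (T : R) (T0 : 0 < T).
Implicit Types (X Y : normedModType R).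

Lemma time_derivativeP X (w : R -> X) : H1 T w ->
  is_time_derivative T w (time_derivative T w).
Proof. by move=> [z wz]; apply: xgetPex; exists z. Qed.

Lemma time_derivative_weakly X (w z : R -> X) : is_time_derivative T w z ->
  weakly_integrable `]0, T[ z.
Proof. by move=> [/L2_weakly]. Qed.

Lemma time_derivative_primitive X (w z : R -> X) (L : X -> R) :
  is_time_derivative T w z -> bounded_functional L ->
  primitive T (fun t => L (w t)) (fun t => L (z t)).
Proof.
move=> wz bL; split=> [|t t0T].
  exact: (time_derivative_weakly wz).1.
rewrite -bfunB//; apply: bochner_functional => //.
  exact: itv_finite_measure.
exact: wz.2.
Qed.

Lemma time_derivative_bochner X (w z : R -> X) : is_time_derivative T w z ->
  bochner_integrable `]0, T[ z.
Proof.
move=> [_ /(_ T)]; rewrite lexx ltW// => /(_ isT).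
exact: is_bochner_integrable.
Qed.

(** Componentwise primitives suffice for a time derivative, in view of the
    characterization of Bochner integrals by components. *)
Lemma is_time_derivative_intro X (w z : R -> X) : hilbertian X ->
  ae_integrable `]0, T[ (fun t => `|z t| ^+ 2) -> bochner_integrable `]0, T[ z ->
  (forall y, primitive T (fun t => inner y (w t)) (fun t => inner y (z t))) ->
  is_time_derivative T w z.
Proof.
move=> hX z2 bz wz; split; first by apply/L2E => //; split => //; exact: bz.1.
move=> t t0T; apply: bochner_intro => //.
- exact: itv_finite_measure.
- apply: bochner_integrableS bz => //.
  by move=> s /=; rewrite !in_itv/= => /andP[-> /lt_le_trans]; apply; case/andP: t0T.
- by move=> y; rewrite innerBr// (wz y).2.
Qed.

Lemma ae_integrable_sqr_norm_le X Y (z : R -> X) (z' : R -> Y) M :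
  strongly_measurable `]0, T[ z' -> ae_integrable `]0, T[ (fun t => `|z t| ^+ 2) ->
  0 <= M -> (forall t, `|z' t| <= M * `|z t|) ->
  ae_integrable `]0, T[ (fun t => `|z' t| ^+ 2).
Proof.
move=> sz' z2 M0 le_z'.
apply: (@ae_integrable_le _ _ _ _ (fun t => M ^+ 2 * `|z t| ^+ 2)) => //.
- apply: (@strongly_measurable_comp _ Y _ z' (fun x => `|x| ^+ 2)) => // x.
  by apply: cvgM; exact: norm_continuous.
- exact: ae_integrableZ.
- apply: aeW => t _; rewrite ger0_norm// -exprMn.
  by rewrite ler_pXn2r ?nnegrE ?mulr_ge0.
Qed.

Lemma is_time_derivative_map X Y (A : X -> Y) (w z : R -> X) :
  hilbertian Y -> bounded_map A -> is_time_derivative T w z ->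
  is_time_derivative T (fun t => A (w t)) (fun t => A (z t)).
Proof.
move=> hY bA wz; have bz := time_derivative_bochner wz.
have bAz : bochner_integrable `]0, T[ (fun t => A (z t)).
  exact: bochner_integrable_map.
have /(L2E _ (measurable_itv _))[sz z2] := wz.1.
have [M [M0 AM]] := bA.2.
apply: is_time_derivative_intro => //.
  by apply: ae_integrable_sqr_norm_le z2 M0 _ => //; exact: bAz.1.
by move=> y; apply: (time_derivative_primitive wz (bfun_comp (inner_bounded y hY) bA)).
Qed.

Lemma is_time_derivativeD X (w z w' z' : R -> X) : hilbertian X ->
  is_time_derivative T w z -> is_time_derivative T w' z' ->
  is_time_derivative T (fun t => w t + w' t) (fun t => z t + z' t).
Proof.
move=> hX wz wz'.
have bz := time_derivative_bochner wz; have bz' := time_derivative_bochner wz'.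
have bzz' : bochner_integrable `]0, T[ (fun t => z t + z' t).
  exact: bochner_integrableD.
have /(L2E _ (measurable_itv _))[sz z2] := wz.1.
have /(L2E _ (measurable_itv _))[sz' z2'] := wz'.1.
apply: is_time_derivative_intro => //.
- apply: (@ae_integrable_le _ _ _ _ (fun t => 2 * (`|z t| ^+ 2 + `|z' t| ^+ 2))) => //.
  + apply: (@strongly_measurable_comp _ X _ (fun t => z t + z' t) (fun x => `|x| ^+ 2)) => //.
      exact: bzz'.1.
    by move=> x; apply: cvgM; exact: norm_continuous.
  + by apply: ae_integrableZ => //; exact: ae_integrableD.
  + apply: aeW => t _; rewrite ger0_norm//.
    have h := ler_normD (z t) (z' t).
    apply: (@le_trans _ _ ((`|z t| + `|z' t|) ^+ 2)).
      by rewrite ler_pXn2r// nnegrE ?addr_ge0.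
    have := sqr_ge0 (`|z t| - `|z' t|).
    by move: (`|z t|) (`|z' t|) => r s; clear; nra.
- move=> y; have by_ := inner_bounded y hX.
  have := primitiveD (time_derivative_primitive wz by_)
    (time_derivative_primitive wz' by_).
  congr primitive; apply/funext => t; by rewrite innerDr.
Qed.

Lemma is_time_derivative_ext X (w w' z : R -> X) :
  (forall t, 0 <= t <= T -> w t = w' t) ->
  is_time_derivative T w z -> is_time_derivative T w' z.
Proof.
move=> ww' [z2 wz]; split=> // t t0T; have := wz t t0T.
by rewrite !ww'// lexx ltW.
Qed.

(** A function in H^1 is bounded by its initial value and the integral of the
    norm of its derivative, as one sees by testing with its increment. *)
Lemma H1_weakly X (w : R -> X) : hilbertian X -> H1 T w ->
  weakly_integrable `]0, T[ w.
Proof.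
move=> hX [z wz]; split=> [L bL|].
  exact: primitive_integrable (time_derivative_primitive wz bL).
have [iz [psi ipsi zpsi]] := time_derivative_weakly wz.
exists (fun=> (\int[mu]_(s in `]0, T[) `|psi s|)%R + `|w 0|).
  exact: ae_integrable_cst.
apply: aeW => t /=; rewrite in_itv/= => /andP[t0 tT].
rewrite -{1}(subrK (w 0) (w t)) (le_trans (ler_normD _ _))// lerD2r.
have iabs : ae_integrable `]0, T[ (fun s => `|psi s|) by exact: ae_integrable_norm.
apply: norm_le_inner => // [|y]; first by apply: Rintegral_ge0.
have by_ := inner_bounded y hX.
have [iyz yz] := time_derivative_primitive wz by_.
rewrite innerC innerBr// yz; last by rewrite !ltW.
apply: (@le_trans _ _ (\int[mu]_(s in `]0, t[) (`|y| * `|psi s|))%R).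
  apply: le_Rint => //.
  - by apply: ae_integrable_subitv iyz => //; exact: ltW.
  - by apply: ae_integrableZ => //; apply: ae_integrable_subitv iabs => //; exact: ltW.
  - apply: ae_imp _ zpsi => s zpsi; rewrite /= in_itv/= => /andP[s0 st].
    rewrite (le_trans (inner_le hX _ _))// ler_wpM2l// (le_trans _ (ler_norm _))//.
    by apply: zpsi; rewrite /= in_itv/= s0 (lt_trans st).
rewrite RintZ//; last by apply: ae_integrable_subitv iabs => //; exact: ltW.
rewrite mulrC ler_wpM2r//.
have : 0 <= (\int[mu]_(s in `]t, T[) `|psi s|)%R by apply: Rintegral_ge0.
by rewrite (Rint_sub (ltW t0) (ltW tT) iabs) subr_ge0.
Qed.

End TimeDerivative.
(** * Vector-valued polynomials on an interval *)

Section VectorPolynomial.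
Context {R : realType}.
Notation mu := (@lebesgue_measure R).

(** The square vanishes almost everywhere, by continuity everywhere on the
    interval, and a nonzero polynomial has fewer roots than its size. *)
Lemma Rint_sqr_horner_eq0 (a b : R) (p : {poly R}) : a < b ->
  (\int[mu]_(t in `]a, b[) p.[t] ^+ 2 = 0)%R -> p = 0.
Proof.
move=> ab p0.
have ip : ae_integrable `]a, b[ (fun t => p.[t] ^+ 2).
  by apply: ae_integrable_eq (ae_integrable_horner a b (p ^+ 2)) => t _; rewrite horner_exp.
have [N [mN N0 pN]] : {ae mu, forall t, `]a, b[%classic t -> p.[t] ^+ 2 = 0}.
  apply: Rint0_ae_eq0 => // t /andP[at_ tb]; apply/eqP; rewrite eq_le.
  have h1 : 0 <= (\int[mu]_(s in `]a, t[) p.[s] ^+ 2)%R.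
    by apply: Rintegral_ge0 => s _; exact: sqr_ge0.
  have h2 : 0 <= (\int[mu]_(s in `]t, b[) p.[s] ^+ 2)%R.
    by apply: Rintegral_ge0 => s _; exact: sqr_ge0.
  rewrite h1 andbT; move: h2; rewrite (Rint_sub (ltW at_) (ltW tb) ip) p0.
  by rewrite sub0r oppr_ge0.
have p_zero t : a < t < b -> p.[t] = 0.
  move=> /andP[at_ tb]; apply/eqP; apply: contrapT => /negP pt.
  have : \forall s \near t, p.[s] != 0.
    have := @continuous_horner _ p t; move/cvgrPdist_lt/(_ `|p.[t]|).
    rewrite normr_gt0 => /(_ pt); apply: filterS => s.
    by apply: contraTneq => ->; rewrite subr0 ltxx.
  move=> [e /= e0 ep].
  pose c := Num.min (t + e) b.
  have tc : t < c by rewrite lt_min ltrDl e0.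
  have : (mu `]t, c[ <= mu N)%E.
    apply: le_measure; rewrite ?inE//.
    move=> s; rewrite /= in_itv/= => /andP[ts]; rewrite lt_min => /andP[se sb].
    apply: pN => /= /(_ _) H.
    have sab : `]a, b[%classic s by rewrite /= in_itv/= (lt_trans at_ ts) sb.
    have := ep s; rewrite /= distrC gtr0_norm ?subr_gt0// ltrBlDl => /(_ se).
    by have := H sab; move=> /eqP; rewrite sqrf_eq0 => ->.
  rewrite N0 lebesgue_measure_itv/= lte_fin tc -EFinB lee_fin.
  by rewrite subr_le0 leNgt tc.
apply: contrapT => /eqP pn0.
(* As many distinct points of the interval as the size of the polynomial. *)
pose r := [seq a + (b - a) / j.+2%:R | j <- iota 0 (size p)].
have ba : 0 < b - a by rewrite subr_gt0.
have rr : all (root p) r.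
  apply/allP => _ /mapP[j _ ->]; rewrite /root p_zero// ltrDl divr_gt0//=.
  rewrite -ltrBrDl -[ltRHS]mulr1 ltr_pM2l// invf_lt1 ?ltr1n//.
have ur : uniq r.
  rewrite map_inj_uniq ?iota_uniq// => i j /addrI /(mulfI (lt0r_neq0 ba)) /invr_inj.
  by move/eqP; rewrite eqr_nat => /eqP[].
by have := max_poly_roots pn0 rr ur; rewrite size_map size_iota ltnn.
Qed.

Section Components.
Context {X : normedModType R} {n : nat}.
Implicit Types (c : 'I_n -> X) (L : X -> R).

Definition vpoly c (t : R) : X := \sum_(i < n) t ^+ i *: c i.

Definition component_poly L c : {poly R} := \sum_(i < n) L (c i) *: 'X^i.

Lemma horner_component L c t : bounded_functional L ->
  L (vpoly c t) = (component_poly L c).[t].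
Proof.
move=> bL; rewrite (bfun_sum _ bL) horner_sum; apply: eq_bigr => i _.
by rewrite (bfunZ _ _ bL) hornerZ hornerXn mulrC.
Qed.

Lemma size_component L c : (size (component_poly L c) <= n)%N.
Proof.
apply: leq_trans (size_sum _ _ _) _; apply/bigmax_leqP => i _.
by rewrite (leq_trans (size_scale_leq _ _))// size_polyXn.
Qed.

Lemma ae_integrable_component (a b : R) L c : bounded_functional L ->
  ae_integrable `]a, b[ (fun t => L (vpoly c t)).
Proof.
move=> bL; apply: ae_integrable_eq (ae_integrable_horner a b (component_poly L c)).
by move=> t _; rewrite horner_component.
Qed.

Lemma Rint_test_poly (a b : R) (F G : R -> R) :
  ae_integrable `]a, b[ F -> ae_integrable `]a, b[ G ->
  (forall i : 'I_n, (\int[mu]_(t in `]a, b[) ('X^i.[t] * F t) =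
    \int[mu]_(t in `]a, b[) ('X^i.[t] * G t))%R) ->
  forall p : {poly R}, (size p <= n)%N ->
  (\int[mu]_(t in `]a, b[) (p.[t] * F t) =
   \int[mu]_(t in `]a, b[) (p.[t] * G t))%R.
Proof.
move=> iF iG FG p pn.
have pE (H : R -> R) : ae_integrable `]a, b[ H ->
    (\int[mu]_(t in `]a, b[) (p.[t] * H t) =
     \sum_(i < n) p`_i * \int[mu]_(t in `]a, b[) ('X^i.[t] * H t))%R.
  move=> iH; transitivity
    (\int[mu]_(t in `]a, b[) (\sum_(i < n) p`_i * ('X^i.[t] * H t)))%R.
    apply: eq_Rintegral => t _; rewrite (horner_coef_wide t pn) mulr_suml.
    by apply: eq_bigr => i _; rewrite hornerXn mulrA.
  rewrite Rint_sum//; last first.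
    by move=> i; apply: ae_integrableZ => //; exact: ae_integrable_hornerM.
  by apply: eq_bigr => i _; rewrite RintZ//; exact: ae_integrable_hornerM.
by rewrite !pE//; apply: eq_bigr => i _; rewrite FG.
Qed.

End Components.

(** Testing each component with itself. *)
Lemma vpoly_eq0 {X : normedModType R} n (a b : R) (c : 'I_n -> X) :
  hilbertian X -> a < b ->
  (forall (p : {poly R}) x, (size p <= n)%N ->
    (\int[mu]_(t in `]a, b[) (p.[t] * inner x (vpoly c t)) = 0)%R) ->
  forall t, vpoly c t = 0.
Proof.
move=> hX ab c0 t; apply: (inner_inj hX) => x.
rewrite inner0l// innerC (horner_component c t (inner_bounded x hX)).
rewrite (@Rint_sqr_horner_eq0 a b (component_poly (inner x) c)) ?horner0//.
rewrite -[RHS](c0 (component_poly (inner x) c) x (size_component _ _)).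
apply: eq_Rintegral => s _.
by rewrite (horner_component c s (inner_bounded x hX)) expr2.
Qed.

(** The monomials are independent on an interval, so their Gram matrix is
    invertible, and its inverse applied to the moments gives the coefficients
    of the orthogonal projection. *)
Lemma local_projection {X : normedModType R} n (a b : R) (w : R -> X) :
  riesz_space X -> a < b -> weakly_integrable `]a, b[ w ->
  exists c : 'I_n -> X, forall (p : {poly R}) x, (size p <= n)%N ->
    (\int[mu]_(t in `]a, b[) (p.[t] * inner x (w t)) =
     \int[mu]_(t in `]a, b[) (p.[t] * inner x (vpoly c t)))%R.
Proof.
move=> rX ab iw; have hX := rX.1.
pose G : 'M[R]_n := \matrix_(i, j) (\int[mu]_(t in `]a, b[) ('X^i * 'X^j : {poly R}).[t])%R.
have uG : G \in unitmx.
  rewrite unitmxE unitfE; apply/det0P => -[v v0 vG].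
  pose p : {poly R} := \sum_(i < n) v 0 i *: 'X^i.
  have pcoef (i : 'I_n) : p`_i = v 0 i.
    rewrite coef_sum (bigD1 i)//= coefZ coefXn eqxx mulr1 big1 ?addr0// => j ji.
    by rewrite coefZ coefXn eq_sym (_ : (_ == _) = false) ?mulr0//; apply/negbTE.
  suff p0 : p = 0.
    by case/eqP: v0; apply/rowP => i; rewrite !mxE -pcoef p0 coef0.
  apply: (Rint_sqr_horner_eq0 ab).
  have -> : (\int[mu]_(t in `]a, b[) p.[t] ^+ 2 = \sum_(j < n) v 0 j * (v *m G) 0 j)%R.
    have iXX (i j : nat) (r : R) : ae_integrable `]a, b[
        (fun t => r * ('X^i * 'X^j : {poly R}).[t]).
      by apply: ae_integrableZ => //; exact: ae_integrable_horner.
    transitivity (\int[mu]_(t in `]a, b[) (\sum_(j < n) v 0 j *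
       (\sum_(i < n) v 0 i * ('X^i * 'X^j : {poly R}).[t])))%R.
      apply: eq_Rintegral => t _.
      rewrite expr2 {1}/p horner_sum mulr_suml; apply: eq_bigr => j _.
      rewrite hornerZ -mulrA; congr (_ * _).
      rewrite mulr_sumr; apply: eq_bigr => i _.
      by rewrite hornerZ hornerM; ring.
    rewrite Rint_sum//; last first.
      by move=> j; apply: ae_integrableZ => //; exact: ae_integrable_sum.
    apply: eq_bigr => j _; rewrite RintZ//; last exact: ae_integrable_sum.
    congr (_ * _); rewrite Rint_sum// mxE; apply: eq_bigr => i _.
    by rewrite RintZ ?mxE//; exact: ae_integrable_horner.
  by rewrite vG big1// => j _; rewrite mxE mulr0.
have /choice[m mP] := fun i : 'I_n => moment_exists ('X^i) rX iw.
pose c i := \sum_(j < n) invmx G i j *: m j.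
exists c => p x; apply: Rint_test_poly.
- exact: iw.1 _ (inner_bounded x hX).
- exact: ae_integrable_component (inner_bounded x hX).
- move=> k.
  transitivity (inner (m k) x).
    by rewrite mP; apply: eq_Rintegral => t _; rewrite innerC.
  have E1 t : inner x (vpoly c t) = \sum_(i < n) inner (c i) x * 'X^i.[t].
    rewrite inner_sumr//; apply: eq_bigr => i _.
    by rewrite innerZr// hornerXn mulrC innerC.
  transitivity (\int[mu]_(t in `]a, b[)
     (\sum_(i < n) inner (c i) x * ('X^k * 'X^i : {poly R}).[t]))%R; last first.
    apply: eq_Rintegral => t _; rewrite E1 mulr_sumr; apply: eq_bigr => i _.
    by rewrite hornerM; ring.
  rewrite Rint_sum//; last first.
    by move=> i; apply: ae_integrableZ => //; exact: ae_integrable_horner.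
  transitivity (\sum_(i < n) G k i * inner (c i) x); last first.
    apply: eq_bigr => i _; rewrite RintZ//; last exact: ae_integrable_horner.
    by rewrite mxE mulrC.
  transitivity (\sum_(j < n) (G *m invmx G) k j * inner (m j) x).
    rewrite mulmxV// (bigD1 k)//= mxE eqxx mul1r big1 ?addr0// => j jk.
    by rewrite mxE eq_sym (negbTE jk) mul0r.
  under eq_bigr => j _ do rewrite mxE mulr_suml.
  rewrite exchange_big /=; apply: eq_bigr => i _.
  rewrite /c inner_suml// mulr_sumr; apply: eq_bigr => j _.
  by rewrite innerZl// mulrA.
Qed.

End VectorPolynomial.
(** * Piecewise polynomials and the projections in time *)

Section Grid.
Context {R : realType}.
Notation mu := (@lebesgue_measure R).
Variables (N : nat) (tg : nat -> R).
Hypothesis tg0 : tg 0%N = 0.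
Hypothesis tgS : forall n, (n < N)%N -> tg n < tg n.+1.

Lemma grid_le m n : (m <= n)%N -> (n <= N)%N -> tg m <= tg n.
Proof.
elim: n => [|n IH]; first by rewrite leqn0 => /eqP ->.
rewrite leq_eqVlt => /predU1P[-> //|]; rewrite ltnS => mn nN.
by rewrite (le_trans (IH mn (ltnW nN)))// ltW// tgS.
Qed.

Lemma grid_ge0 m : (m <= N)%N -> 0 <= tg m.
Proof. by move=> mN; rewrite -tg0 grid_le. Qed.

Lemma grid_subset m n : (m < n)%N -> (n <= N)%N ->
  `]tg m, tg m.+1[ `<=` `]0, tg n[.
Proof.
move=> mn nN t; rewrite /= !in_itv/= => /andP[mt tm].
rewrite (le_lt_trans _ mt) ?grid_ge0 ?(ltnW (leq_trans mn nN))//=.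
by rewrite (lt_le_trans tm)// grid_le.
Qed.

Lemma grid_disjoint m n t : (m < N)%N -> (n < N)%N ->
  tg m < t < tg m.+1 -> tg n < t < tg n.+1 -> m = n.
Proof.
have H i j : (j < N)%N -> (i < j)%N -> tg i < t < tg i.+1 -> tg j < t < tg j.+1 -> False.
  move=> jN ij /andP[_ ti] /andP[tj _].
  have := lt_trans tj ti; rewrite ltNge grid_le//; exact: ltnW.
move=> mN nN hm hn; case: (ltngtP m n) => // mn; exfalso.
  exact: (H m n).
exact: (H n m).
Qed.

Lemma grid_ae n (P : R -> Prop) : (n <= N)%N ->
  (forall m, (m < n)%N -> {ae mu, forall t, `]tg m, tg m.+1[%classic t -> P t}) ->
  {ae mu, forall t, `]0, tg n[%classic t -> P t}.
Proof.
elim: n => [|n IH] nN aP.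
  by apply: aeW => t /=; rewrite tg0 in_itv/= => /andP[/lt_trans] /[apply]; rewrite ltxx.
have h1 : {ae mu, forall t, t != tg n}.
  exists [set tg n]; split=> //; first exact: lebesgue_measure_set1.
  by move=> t /= /negP; rewrite negbK => /eqP.
have h2 := IH (ltnW nN) (fun m mn => aP m (ltnW mn)).
apply: ae_imp3 _ h1 h2 (aP n (ltnSn n)) => t tn h2 h3.
rewrite /= in_itv/= => /andP[t0 tt].
have [h|h] := ltP t (tg n); first by apply: h2; rewrite /= in_itv/= t0.
by apply: h3; rewrite /= in_itv/= tt lt_neqAle eq_sym tn h.
Qed.

Lemma grid_integral n (F : R -> R) : (n <= N)%N ->
  (forall m, (m < n)%N -> ae_integrable `]tg m, tg m.+1[ F) ->
  ae_integrable `]0, tg n[ F /\ (\int[mu]_(t in `]0, tg n[) F t =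
    \sum_(m < n) \int[mu]_(t in `]tg m, tg m.+1[) F t)%R.
Proof.
move=> nN iF.
have tgSn m : (m < n)%N -> tg m < tg m.+1.
  by move=> mn; apply: tgS; exact: leq_trans nN.
by have [_] := ae_integrable_grid tgSn iF; rewrite tg0.
Qed.

Lemma weakly_integrable_cell (X : normedModType R) m (w : R -> X) : (m < N)%N ->
  weakly_integrable `]0, tg N[ w -> weakly_integrable `]tg m, tg m.+1[ w.
Proof.
by move=> mN; apply: weakly_integrableS => //; exact: grid_subset.
Qed.

(** Prescribes a function on each cell; it vanishes at the nodes, where
    piecewise polynomials are arbitrary. *)
Definition grid_fun (X : normedModType R) (F : nat -> R -> X) (t : R) : X :=
  \sum_(m < N) \1_(`]tg m, tg m.+1[%classic) t *: F m t.

Lemma grid_funE (X : normedModType R) (F : nat -> R -> X) m t :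
  (m < N)%N -> tg m < t < tg m.+1 -> grid_fun F t = F m t.
Proof.
move=> mN mt; rewrite /grid_fun (bigD1 (Ordinal mN))//= indicE mem_set//=.
rewrite scale1r big1 ?addr0// => i im.
rewrite indicE memNset ?scale0r//= in_itv/= => it.
by case/eqP: im; apply/val_inj => /=; exact: grid_disjoint it mt.
Qed.

Section Piecewise.
Context {X : normedModType R} (hX : hilbertian X).
Implicit Types (w z : R -> X) (q n : nat).

Lemma piecewise_vpoly q (S : set X) z m : piecewise_poly N tg q S z -> (m < N)%N ->
  exists c : 'I_q.+1 -> X, (forall i, S (c i)) /\
    forall t, tg m < t < tg m.+1 -> z t = vpoly c t.
Proof. by move=> pz mN; have [c [Sc zc]] := pz m mN; exists c. Qed.

Lemma piecewise_polyT q (S : set X) z :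
  piecewise_poly N tg q S z -> piecewise_poly N tg q setT z.
Proof. by move=> pz n nN; have [c [Sc zc]] := pz n nN; exists c. Qed.

Lemma piecewise_polyB q z z' : piecewise_poly N tg q setT z ->
  piecewise_poly N tg q setT z' ->
  piecewise_poly N tg q setT (fun t => z t - z' t).
Proof.
move=> pz pz' n nN; have [c [_ zc]] := pz n nN; have [c' [_ zc']] := pz' n nN.
exists (fun i => c i - c' i); split=> // t tn; rewrite zc// zc'// -sumrB.
by apply: eq_bigr => i _; rewrite scalerBr.
Qed.

Lemma piecewise_poly_map (Y : normedModType R) (A : X -> Y) (S : set Y) q z :
  bounded_map A -> (forall x, S (A x)) -> piecewise_poly N tg q setT z ->
  piecewise_poly N tg q S (fun t => A (z t)).
Proof.
move=> bA SA pz n nN; have [c [_ zc]] := pz n nN.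
exists (fun i => A (c i)); split=> // t tn; rewrite zc// (bmap_sum _ bA).
by apply: eq_bigr => i _; rewrite (bmapZ _ _ bA).
Qed.

Lemma inner_vpoly n n' (c : 'I_n -> X) (c' : 'I_n' -> X) t :
  inner (vpoly c t) (vpoly c' t) =
  (\sum_(i < n) \sum_(j < n') inner (c i) (c' j) *: ('X^i * 'X^j : {poly R})).[t].
Proof.
rewrite inner_suml// horner_sum; apply: eq_bigr => i _.
rewrite inner_sumr// horner_sum; apply: eq_bigr => j _.
by rewrite innerZl// innerZr// hornerZ hornerM !hornerXn; ring.
Qed.

Lemma piecewise_inner_integrable q q' z z' n : (n <= N)%N ->
  piecewise_poly N tg q setT z -> piecewise_poly N tg q' setT z' ->
  ae_integrable `]0, tg n[ (fun t => inner (z t) (z' t)).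
Proof.
move=> nN pz pz'; apply: (grid_integral nN _).1 => m mn.
have mN := leq_trans mn nN.
have [c [_ zc]] := piecewise_vpoly pz mN; have [c' [_ zc']] := piecewise_vpoly pz' mN.
apply: ae_integrable_eq (ae_integrable_horner _ _ _) => t; rewrite /= in_itv/= => tm.
by rewrite zc// zc'// inner_vpoly.
Qed.

Lemma piecewise_sqr_integrable q z n : (n <= N)%N ->
  piecewise_poly N tg q setT z -> ae_integrable `]0, tg n[ (fun t => `|z t| ^+ 2).
Proof.
move=> nN pz; apply: ae_integrable_eq (piecewise_inner_integrable nN pz pz) => t _.
by rewrite innerxx.
Qed.

Lemma bochner_integrable_sum D n (F : 'I_n -> R -> X) :
  measurable (D : set (measurableTypeR R)) -> (mu D < +oo)%E ->
  (forall i, bochner_integrable D (F i)) ->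
  bochner_integrable D (fun t => \sum_(i < n) F i t).
Proof.
move=> mD Doo; elim: n F => [|n IH] F bF.
  apply: (@bochner_integrable_ext _ _ _ (fun t => (0 : R) *: (0 : X))) => //.
    by apply: aeW => t _; rewrite scaler0 big_ord0.
  by apply: bochner_integrable_scale => //; exact: ae_integrable0.
apply: (@bochner_integrable_ext _ _ _ (fun t => F ord0 t + \sum_(i < n) F (lift ord0 i) t)) => //.
  by apply: aeW => t _; rewrite big_ord_recl.
by apply: bochner_integrableD => //; exact: IH.
Qed.

(** Up to the nodes a piecewise polynomial is a finite sum of bounded scalar
    functions times fixed vectors. *)
Lemma piecewise_bochner q z : piecewise_poly N tg q setT z ->
  bochner_integrable `]0, tg N[ z.
Proof.
move=> pz.
have /choice[c cP] : forall m, exists c : 'I_q.+1 -> X, (m < N)%N ->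
    forall t, tg m < t < tg m.+1 -> z t = vpoly c t.
  move=> m; have [mN|_] := boolP (m < N)%N; last by exists (fun=> 0).
  by have [c [_ zc]] := piecewise_vpoly pz mN; exists c.
apply: (@bochner_integrable_ext _ _ _ (grid_fun (fun m => vpoly (c m)))) => //.
  apply: grid_ae => // m mN; apply: aeW => t; rewrite /= in_itv/= => tm.
  by rewrite (grid_funE _ mN)// (cP m).
apply: bochner_integrable_sum => //; first exact: itv_finite_measure.
move=> m.
apply: (@bochner_integrable_ext _ _ _ (fun t => \sum_(i < q.+1)
    (\1_(`]tg m, tg m.+1[%classic) t * t ^+ i) *: c m i)) => //.
  apply: aeW => t _; rewrite scaler_sumr; apply: eq_bigr => i _.
  by rewrite scalerA.
apply: bochner_integrable_sum => //; first exact: itv_finite_measure.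
move=> i; apply: bochner_integrable_scale => //; first exact: itv_finite_measure.
apply: (@ae_integrable_le _ _ _ _ (fun t => `|('X^i : {poly R}).[t]|)) => //.
- exists (fun t => \1_(`]tg m, tg m.+1[%classic) t * t ^+ i); last exact: aeW.
  apply: measurable_funM; first exact: measurable_indic.
  by apply: measurable_funTS; exact: exprn_measurable.
- by apply: ae_integrable_norm => //; exact: ae_integrable_horner.
- apply: aeW => t _; rewrite normrM hornerXn ler_piMl// indicE.
  by case: (_ \in _); rewrite ?normr1 ?normr0.
Qed.

Lemma piecewise_weakly q z : piecewise_poly N tg q setT z ->
  weakly_integrable `]0, tg N[ z.
Proof.
move=> pz; apply: L2_weakly; apply/L2E => //; split.
  exact: (piecewise_bochner pz).1.
exact: piecewise_sqr_integrable pz.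
Qed.

Lemma is_Pi0_intro q w z : weakly_integrable `]0, tg N[ w ->
  piecewise_poly N tg q setT z ->
  (forall m, (m < N)%N -> forall (p : {poly R}) x, (size p <= q.+1)%N ->
    (\int[mu]_(t in `]tg m, tg m.+1[) (p.[t] * inner x (w t)) =
     \int[mu]_(t in `]tg m, tg m.+1[) (p.[t] * inner x (z t)))%R) ->
  is_Pi0 N tg q w z.
Proof.
move=> iw pz wz; split=> // phi pphi.
have iwz : weakly_integrable `]0, tg N[ (fun t => w t - z t).
  by apply: weakly_integrableB => //; exact: piecewise_weakly pz.
have E m (mN : (m < N)%N) : ae_integrable `]tg m, tg m.+1[
    (fun t => inner (w t - z t) (phi t)) /\
    (\int[mu]_(t in `]tg m, tg m.+1[) inner (w t - z t) (phi t) = 0)%R.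
  have [c [_ phic]] := piecewise_vpoly pphi mN.
  have eqF t : `]tg m, tg m.+1[%classic t -> \sum_(i < q.+1) ('X^i : {poly R}).[t] *
      inner (c i) (w t - z t) = inner (w t - z t) (phi t).
    rewrite /= in_itv/= => tm; rewrite phic// inner_sumr//; apply: eq_bigr => i _.
    by rewrite innerZr// hornerXn innerC.
  have im (u : R -> X) (i : 'I_q.+1) : weakly_integrable `]0, tg N[ u -> ae_integrable `]tg m, tg m.+1[
      (fun t => ('X^i : {poly R}).[t] * inner (c i) (u t)).
    move=> iu; apply: ae_integrable_hornerM.
    exact: (weakly_integrable_cell mN iu).1 _ (inner_bounded _ hX).
  split.
    apply: ae_integrable_eq eqF _; apply: ae_integrable_sum => // i.
    exact: im.
  transitivity (\int[mu]_(t in `]tg m, tg m.+1[) (\sum_(i < q.+1)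
    ('X^i : {poly R}).[t] * inner (c i) (w t - z t)))%R.
    by apply: eq_Rintegral => t /set_mem tm; rewrite eqF.
  rewrite Rint_sum//; last by move=> i; exact: im.
  apply: big1 => i _.
  have := wz m mN ('X^i) (c i); rewrite size_polyXn => /(_ (ltn_ord i)) E.
  transitivity (\int[mu]_(t in `]tg m, tg m.+1[) (('X^i : {poly R}).[t] * inner (c i) (w t)
     - ('X^i : {poly R}).[t] * inner (c i) (z t)))%R.
    by apply: eq_Rintegral => t _; rewrite innerBr// mulrBr.
  rewrite RintB ?E ?subrr//; apply: im => //.
  exact: piecewise_weakly pz.
have [_ ->] := grid_integral (leqnn N) (fun m mN => (E m mN).1).
by apply: big1 => m _; exact: (E m _).2.
Qed.

(** Orthogonality to all vector-valued piecewise polynomials is tested with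
    those supported in one cell and having one component. *)
Lemma is_Pi0_test q w z m : weakly_integrable `]0, tg N[ w ->
  is_Pi0 N tg q w z -> (m < N)%N ->
  forall (p : {poly R}) x, (size p <= q.+1)%N ->
    (\int[mu]_(t in `]tg m, tg m.+1[) (p.[t] * inner x (w t)) =
     \int[mu]_(t in `]tg m, tg m.+1[) (p.[t] * inner x (z t)))%R.
Proof.
move=> iw [pz wz] mN p x sp.
have iz := piecewise_weakly pz.
have cell u : weakly_integrable `]0, tg N[ u ->
    ae_integrable `]tg m, tg m.+1[ (fun t => inner x (u t)).
  by move=> iu; exact: (weakly_integrable_cell mN iu).1 _ (inner_bounded _ hX).
have iwm := cell _ iw; have izm := cell _ iz.
pose phi := grid_fun (fun n t => if n == m then p.[t] *: x else 0).
have phiE n t : (n < N)%N -> tg n < t < tg n.+1 ->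
    phi t = if n == m then p.[t] *: x else 0.
  by move=> nN tn; rewrite /phi (grid_funE _ nN).
have pphi : piecewise_poly N tg q setT phi.
  move=> n nN; exists (fun i => if n == m then p`_i *: x else 0); split=> // t tn.
  rewrite (phiE n)//; case: ifPn => _; last by rewrite big1// => i _; rewrite scaler0.
  rewrite (horner_coef_wide t sp) scaler_suml; apply: eq_bigr => i _.
  by rewrite scalerA mulrC.
have iF n : (n < N)%N ->
    ae_integrable `]tg n, tg n.+1[ (fun t => inner (w t - z t) (phi t)).
  move=> nN; have [->{nN n}|nm] := eqVneq n m.
    apply: (@ae_integrable_eq _ _ (fun t => p.[t] * (inner x (w t) - inner x (z t)))).
      move=> t; rewrite /= in_itv/= => tm.
      by rewrite (phiE m)// eqxx innerZr// -innerBr// innerC.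
    by apply: ae_integrable_hornerM; exact: ae_integrableB.
  apply: (@ae_integrable_eq _ _ (fun=> 0)); last exact: ae_integrable0.
  move=> t; rewrite /= in_itv/= => tm.
  by rewrite (phiE n)// (negbTE nm) inner0r.
have [_] := grid_integral (leqnn N) iF.
rewrite wz// (bigD1 (Ordinal mN))//= big1 ?addr0; last first.
  move=> n nm; rewrite -[RHS](@Rint0 _ `]tg n, tg n.+1[)//; apply: eq_Rintegral => t.
  rewrite inE/= in_itv/= => tn.
  rewrite (phiE n)// ifF ?inner0r//; apply: contraNF nm => /eqP nm.
  by apply/eqP/val_inj.
move=> H; apply/eqP; rewrite -subr_eq0 -RintB//; [|exact: ae_integrable_hornerM..].
apply/eqP; rewrite [RHS]H; apply: eq_Rintegral => t; rewrite inE/= in_itv/= => tm.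
by rewrite (phiE m)// eqxx innerZr// innerBl// mulrBr !(innerC x).
Qed.

End Piecewise.

Section Projections.
Context {X : normedModType R} (rX : riesz_space X).
Implicit Types (w z : R -> X) (q n : nat).
Let hX : hilbertian X := rX.1.

Lemma Pi0P q w : weakly_integrable `]0, tg N[ w ->
  is_Pi0 N tg q w (Pi0 N tg q w).
Proof.
move=> iw; apply: xgetPex.
have /choice[c cP] : forall m, exists c : 'I_q.+1 -> X, (m < N)%N ->
    forall (p : {poly R}) x, (size p <= q.+1)%N ->
    (\int[mu]_(t in `]tg m, tg m.+1[) (p.[t] * inner x (w t)) =
     \int[mu]_(t in `]tg m, tg m.+1[) (p.[t] * inner x (vpoly c t)))%R.
  move=> m; have [mN|_] := boolP (m < N)%N; last by exists (fun=> 0).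
  have [c cP] := local_projection q.+1 rX (tgS mN) (weakly_integrable_cell mN iw).
  by exists c.
exists (grid_fun (fun m => vpoly (c m))); apply: is_Pi0_intro => //.
  move=> m mN; exists (c m); split=> // t tm; exact: grid_funE.
move=> m mN p x sp; rewrite (cP m)//; apply: eq_Rintegral => t.
by rewrite inE/= in_itv/= => tm; rewrite (grid_funE _ mN).
Qed.

Lemma Pi0_piecewise q w : weakly_integrable `]0, tg N[ w ->
  piecewise_poly N tg q setT (Pi0 N tg q w).
Proof. by move=> /(@Pi0P q)[]. Qed.

Lemma Pi0_test q w m (p : {poly R}) (L : X -> R) :
  weakly_integrable `]0, tg N[ w -> (m < N)%N -> (size p <= q.+1)%N ->
  bounded_functional L ->
  (\int[mu]_(t in `]tg m, tg m.+1[) (p.[t] * L (w t)) =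
   \int[mu]_(t in `]tg m, tg m.+1[) (p.[t] * L (Pi0 N tg q w t)))%R.
Proof.
move=> iw mN sp bL; have [r rL] := rX.2 _ bL.
have := is_Pi0_test hX iw (Pi0P q iw) mN r sp.
by under eq_Rintegral do rewrite -rL; under [in RHS]eq_Rintegral do rewrite -rL.
Qed.

(** The projection keeps the integral over each cell, so that the primitives of
    a function and of its projection agree at all nodes. *)
Lemma Pi0_primitive_node q (w z dw : R -> X) x n : (n <= N)%N ->
  weakly_integrable `]0, tg N[ dw ->
  primitive (tg N) (fun t => inner x (w t)) (fun t => inner x (dw t)) ->
  primitive (tg N) (fun t => inner x (z t)) (fun t => inner x (Pi0 N tg q dw t)) ->
  inner x (z 0) = inner x (w 0) -> inner x (z (tg n)) = inner x (w (tg n)).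
Proof.
move=> nN idw [_ dwx] [_ dzx] zw0.
have ipi := piecewise_weakly hX (Pi0_piecewise q idw).
have tn : 0 <= tg n <= tg N by rewrite grid_ge0// grid_le.
have cell v m : weakly_integrable `]0, tg N[ v -> (m < n)%N ->
    ae_integrable `]tg m, tg m.+1[ (fun t => inner x (v t)).
  move=> iv mn; have mN := leq_trans mn nN.
  exact: (weakly_integrable_cell mN iv).1 _ (inner_bounded x hX).
have := dzx _ tn; have := dwx _ tn; rewrite zw0.
have [_ ->] := grid_integral nN (fun m => @cell _ m idw).
have [_ ->] := grid_integral nN (fun m => @cell _ m ipi).
have -> : (\sum_(m < n) \int[mu]_(t in `]tg m, tg m.+1[) inner x (dw t) =
   \sum_(m < n) \int[mu]_(t in `]tg m, tg m.+1[) inner x (Pi0 N tg q dw t))%R.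
  apply: eq_bigr => m _.
  have := @Pi0_test q dw m 1 (inner x) idw (leq_trans (ltn_ord m) nN).
  rewrite size_poly1 => /(_ isT (inner_bounded x hX)).
  under eq_Rintegral do rewrite hornerC mul1r.
  by under [in X in _ = X -> _]eq_Rintegral do rewrite hornerC mul1r.
by move=> <- /addIr.
Qed.

(** The primitive of the projected derivative, defined through its
    components; it meets the given function at every node because the
    projection keeps the mean over each cell. *)
Lemma Pi1P q w : (0 < q)%N -> 0 < tg N -> H1 (tg N) w ->
  is_Pi1 N tg q w (Pi1 N tg q w).
Proof.
case: q => // q _ T0 hw; apply: xgetPex.
have dw := time_derivativeP hw; set dtw := time_derivative (tg N) w in dw *.
have idw := time_derivative_weakly dw.
set z0 := Pi0 N tg q dtw.
have pz0 : piecewise_poly N tg q setT z0 by exact: Pi0_piecewise.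
have iz0 : weakly_integrable `]0, tg N[ z0 by exact: piecewise_weakly pz0.
have bi x := inner_bounded x hX.
have iz0x x := iz0.1 _ (bi x).
have /choice[v vP] : forall t, exists v, t <= tg N -> forall x,
    inner x v = (\int[mu]_(s in `]0, t[) inner x (z0 s))%R.
  move=> t; have [tT|_] := boolP (t <= tg N); last by exists 0.
  have iz0t : weakly_integrable `]0, t[ z0.
    apply: weakly_integrableS iz0 => // s; rewrite /= !in_itv/= => /andP[-> /=].
    by move=> /lt_le_trans; apply.
  have [v vP] := moment_exists 1 rX iz0t.
  exists v => _ x; rewrite innerC vP; apply: eq_Rintegral => s _.
  by rewrite hornerC mul1r innerC.
pose Z t := w 0 + v t.
have Zp x : primitive (tg N) (fun t => inner x (Z t)) (fun t => inner x (z0 t)).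
  split=> [|t /andP[t0 tT]]; first exact: iz0x.
  have v0 : inner x (v 0) = 0 by rewrite vP ?ltW// Rint_itv0.
  by rewrite /Z !innerDr// v0 vP//; ring.
have Zn n : (n <= N)%N -> Z (tg n) = w (tg n).
  move=> nN; apply: (inner_inj hX) => x; rewrite !(innerC _ x).
  apply: (Pi0_primitive_node nN idw _ (Zp x)).
    exact: time_derivative_primitive dw (bi x).
  by rewrite /Z innerDr// vP ?ltW// Rint_itv0// addr0.
exists Z; split=> [m mN||n nN]; last by apply: Zn; exact: ltnW.
- have [c [_ zc]] := piecewise_vpoly pz0 mN.
  (* The monomials are integrated, which shifts the coefficients by one place;
     the constant coefficient is fixed by the value at the left node. *)
  pose V t : X := \sum_(i < q.+1) t ^+ i.+1 *: (i.+1%:R^-1 *: c i).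
  pose c' (j : 'I_q.+2) := if unlift ord0 j is Some i then i.+1%:R^-1 *: c i
    else w (tg m) - V (tg m).
  have c'E t : \sum_(i < q.+2) t ^+ i *: c' i = w (tg m) - V (tg m) + V t.
    rewrite big_ord_recl expr0 scale1r /c' unlift_none; congr (_ + _).
    by apply: eq_bigr => i _; rewrite liftK.
  exists c'; split=> // t tm; rewrite c'E; apply: (inner_inj hX) => x.
  rewrite !(innerC _ x) innerDr// innerBr// -(Zn m (ltnW mN)).
  pose P : {poly R} := \sum_(i < q.+1) (inner x (c i) / i.+1%:R) *: 'X^(i.+1).
  have VP s : inner x (V s) = P.[s].
    rewrite inner_sumr// horner_sum; apply: eq_bigr => i _.
    by rewrite !innerZr// hornerZ hornerXn; ring.
  have P' : P^`() = component_poly (inner x) c.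
    rewrite /P raddf_sum; apply: eq_bigr => i _ /=.
    rewrite derivZ derivXn /= -['X^i *+ _]scaler_nat scalerA -mulrA mulVf ?mulr1//.
  have /andP[mt tm1] := tm.
  have := primitive_itv (Zp x) (grid_ge0 (ltnW mN)) (ltW mt) (le_trans (ltW tm1) (grid_le mN (leqnn N))).
  rewrite !VP.
  have -> : (\int[mu]_(s in `]tg m, t[) inner x (z0 s) =
      \int[mu]_(s in `]tg m, t[) P^`().[s])%R.
    apply: eq_Rintegral => s; rewrite inE/= in_itv/= => /andP[s1 s2].
    by rewrite zc ?s1 ?(lt_trans s2)// P' horner_component.
  rewrite FTC_horner ?ltW// => H; apply/eqP; rewrite -subr_eq0; apply/eqP.
  by move: H; move: (P.[t]) (P.[tg m]) (inner _ _) (inner _ _) => A B C D; lra.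
- apply: is_time_derivative_intro => //.
  + exact: piecewise_sqr_integrable pz0.
  + exact: piecewise_bochner pz0.
Qed.

End Projections.

End Grid.
(** * Quadratic identities and L2 norms *)

Section CellCalculus.
Context {R : realType}.
Notation mu := (@lebesgue_measure R).

(** Testing with a vector-valued polynomial amounts to testing with monomials,
    one coefficient at a time. *)
Lemma Rint_coefficients (a b : R) n (F G : 'I_n -> R -> R) :
  (forall i, ae_integrable `]a, b[ (F i)) ->
  (forall i, ae_integrable `]a, b[ (G i)) ->
  (forall i : 'I_n, (\int[mu]_(t in `]a, b[) ('X^i.[t] * F i t) =
    \int[mu]_(t in `]a, b[) ('X^i.[t] * G i t))%R) ->
  (\int[mu]_(t in `]a, b[) (\sum_(i < n) t ^+ i * F i t) =
   \int[mu]_(t in `]a, b[) (\sum_(i < n) t ^+ i * G i t))%R.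
Proof.
move=> iF iG FG.
have E (H : 'I_n -> R -> R) : (forall i, ae_integrable `]a, b[ (H i)) ->
    (\int[mu]_(t in `]a, b[) (\sum_(i < n) t ^+ i * H i t) =
     \sum_(i < n) \int[mu]_(t in `]a, b[) ('X^i.[t] * H i t))%R.
  move=> iH; rewrite -Rint_sum//; last by move=> i; exact: ae_integrable_hornerM.
  apply: eq_Rintegral => t _; apply: eq_bigr => i _; by rewrite hornerXn.
by rewrite !E//; apply: eq_bigr => i _; rewrite FG.
Qed.

Context {X : normedModType R}.

Lemma bfun_vpoly n (L : X -> R) (c : 'I_n -> X) t : bounded_functional L ->
  L (vpoly c t) = \sum_(i < n) t ^+ i * L (c i).
Proof.
move=> bL; rewrite (bfun_sum _ bL); apply: eq_bigr => i _.
by rewrite (bfunZ _ _ bL).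
Qed.

Definition derive_coef n (c : 'I_n.+1 -> X) (i : 'I_n) : X :=
  i.+1%:R *: c (lift ord0 i).

Lemma vpoly_derive n (c : 'I_n.+1 -> X) t :
  vpoly (derive_coef c) t = \sum_(i < n.+1) ('X^i : {poly R})^`().[t] *: c i.
Proof.
rewrite big_ord_recl derivXn mulr0n horner0 scale0r add0r; apply: eq_bigr => i _.
by rewrite derivXn /= hornerMn hornerXn scalerA mulr_natr.
Qed.

Lemma horner_component_derive n (c : 'I_n.+1 -> X) (L : X -> R) t :
  bounded_functional L ->
  L (vpoly (derive_coef c) t) = (component_poly L c)^`().[t].
Proof.
move=> bL; rewrite vpoly_derive (bfun_sum _ bL) /component_poly raddf_sum.
rewrite horner_sum; apply: eq_bigr => i _.
by rewrite (bfunZ _ _ bL) /= derivZ hornerZ mulrC.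
Qed.

(** The derivative of half the square of the norm. *)
Lemma Rint_energy n (c : 'I_n.+1 -> X) (a b : R) : hilbertian X -> a <= b ->
  (\int[mu]_(t in `]a, b[) inner (vpoly c t) (vpoly (derive_coef c) t) =
   2^-1 * (`|vpoly c b| ^+ 2 - `|vpoly c a| ^+ 2))%R.
Proof.
move=> hX ab.
pose P : {poly R} :=
  \sum_(i < n.+1) \sum_(j < n.+1) inner (c i) (c j) *: ('X^i * 'X^j).
have PE t : `|vpoly c t| ^+ 2 = P.[t] by rewrite -innerxx inner_vpoly.
have P'E t : P^`().[t] = 2 * inner (vpoly c t) (vpoly (derive_coef c) t).
  have -> : inner (vpoly c t) (vpoly (derive_coef c) t) =
    \sum_(i < n.+1) \sum_(j < n.+1) inner (c i) (c j) * (t ^+ i * ('X^j)^`().[t]).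
    rewrite vpoly_derive inner_suml//; apply: eq_bigr => i _.
    rewrite inner_sumr//; apply: eq_bigr => j _.
    by rewrite innerZl// innerZr//; ring.
  rewrite mulr_natl mulr2n.
  set S := \sum_(i < n.+1) _.
  have {1}-> : S =
    \sum_(i < n.+1) \sum_(j < n.+1) inner (c i) (c j) * (t ^+ j * ('X^i)^`().[t]).
    rewrite /S exchange_big /=; apply: eq_bigr => i _; apply: eq_bigr => j _.
    by rewrite (innerC (c j)).
  rewrite /S -big_split /= /P raddf_sum horner_sum; apply: eq_bigr => i _.
  rewrite /= raddf_sum horner_sum -big_split /=; apply: eq_bigr => j _.
  rewrite derivZ derivM hornerZ hornerD !hornerM !hornerXn; ring.
rewrite !PE -FTC_horner// -RintZ//; last exact: ae_integrable_horner.
by apply: eq_Rintegral => t _; rewrite P'E mulrA mulVf ?mul1r// pnatr_eq0.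
Qed.

End CellCalculus.

Section L2Norm.
Context {R : realType}.
Notation mu := (@lebesgue_measure R).
Implicit Types X : normedModType R.

Lemma L2norm_ge0 X (D : set R) (f : R -> X) : (0 <= L2norm D f)%E.
Proof. exact: poweR_ge0. Qed.

Lemma L2normE X D (f : R -> X) : measurable (D : set (measurableTypeR R)) ->
  ae_integrable D (fun t => `|f t| ^+ 2) ->
  L2norm D f = (Num.sqrt (\int[mu]_(t in D) (`|f t| ^+ 2))%R)%:E.
Proof.
move=> mD i2; rewrite /L2norm ge0_integral_Rint//= powR12_sqrt//.
by apply: Rintegral_ge0 => t _; exact: sqr_ge0.
Qed.

Lemma L2norm_integral_le X (D : set R) (f : R -> X) (A : R) :
  L2norm D f = A%:E -> (\int[mu]_(t in D) (`|f t| ^+ 2)%:E <= (A ^+ 2)%:E)%E.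
Proof.
have : (0 <= \int[mu]_(t in D) (`|f t| ^+ 2)%:E)%E.
  by apply: integral_ge0 => t _; rewrite lee_fin sqr_ge0.
rewrite /L2norm; case: (\int[mu]_(t in D) _)%E => [r| |]//=.
  move=> r0 [<-]; rewrite powR12_sqrt ?sqr_sqrtr//.
by rewrite ?invr_eq0 ?pnatr_eq0.
Qed.

(** Here [Y] and [D] are the norms of two vectors, [s] is their inner product
    and [E] the norm of their sum.  If [Y > C + D], then the left factor
    [Y ^+ 2 + s] of the energy inequality is positive, and squaring
    [Y ^+ 2 + s <= C * E] gives a contradiction, since the difference of the
    squares is increasing in [s] and positive at the extreme value
    [s = - Y * D]. *)
Lemma energy_algebra (U Y D E s C : R) : 0 <= U -> 0 <= Y -> 0 <= D -> 0 <= E ->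
  0 <= C -> `|s| <= Y * D -> E ^+ 2 = Y ^+ 2 + 2 * s + D ^+ 2 ->
  2^-1 * U ^+ 2 <= C * E - (Y ^+ 2 + s) -> U <= C + D /\ Y <= C + D.
Proof.
move=> U0 Y0 D0 E0 C0; rewrite ler_norml => /andP[s1 s2] E2 H.
split.
- have sE : s + D ^+ 2 <= D * E.
    have [h|h] := leP (s + D ^+ 2) 0; first by rewrite (le_trans h)// mulr_ge0.
    rewrite -(@ler_pXn2r _ 2)// ?nnegrE ?mulr_ge0 ?(ltW h)//.
    rewrite exprMn E2; nra.
  rewrite -(@ler_pXn2r _ 2)// ?nnegrE ?addr_ge0//.
  have := sqr_ge0 (E - 2^-1 * (C + D)); have := sqr_ge0 (C + D); nra.
- rewrite leNgt; apply/negP => CY.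
  have YD : 0 < Y - D by lra.
  have Ys : 0 < Y ^+ 2 + s.
    have : 0 < Y * (Y - D) by rewrite mulr_gt0//; lra.
    by rewrite mulrBr -expr2; lra.
  have Hs : Y ^+ 2 + s <= C * E by have := sqr_ge0 U; lra.
  have : (Y ^+ 2 + s) ^+ 2 <= (C * E) ^+ 2.
    by rewrite ler_pXn2r// nnegrE ?mulr_ge0// ltW.
  rewrite exprMn E2 leNgt => /negP; apply.
  rewrite -subr_gt0.
  have -> : (Y ^+ 2 + s) ^+ 2 - C ^+ 2 * (Y ^+ 2 + 2 * s + D ^+ 2) =
    (s + Y * D) * ((s + Y * D) + 2 * (Y * (Y - D) - C ^+ 2)) +
    (Y ^+ 2 - C ^+ 2) * (Y - D) ^+ 2 by ring.
  have h1 : 0 <= s + Y * D by lra.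
  have h2 : C ^+ 2 <= Y * (Y - D).
    by rewrite expr2 ler_pM//; lra.
  have h3 : 0 < Y ^+ 2 - C ^+ 2 by nra.
  have h4 : 0 < (Y ^+ 2 - C ^+ 2) * (Y - D) ^+ 2 by rewrite mulr_gt0// exprn_gt0.
  have h5 : 0 <= (s + Y * D) * ((s + Y * D) + 2 * (Y * (Y - D) - C ^+ 2)).
    by rewrite mulr_ge0//; lra.
  lra.
Qed.

End L2Norm.

Section PiecewiseL2.
Context {R : realType}.
Notation mu := (@lebesgue_measure R).
Variables (N : nat) (tg : nat -> R).
Hypothesis tg0 : tg 0%N = 0.
Hypothesis tgS : forall n, (n < N)%N -> tg n < tg n.+1.
Context {X : normedModType R} (hX : hilbertian X).
Variables (q n : nat) (nN : (n <= N)%N).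

Lemma piecewise_inner_le (z z' : R -> X) : piecewise_poly N tg q setT z ->
  piecewise_poly N tg q setT z' ->
  `|\int[mu]_(t in `]0, tg n[) inner (z t) (z' t)|%R <=
  Num.sqrt (\int[mu]_(t in `]0, tg n[) (`|z t| ^+ 2))%R *
  Num.sqrt (\int[mu]_(t in `]0, tg n[) (`|z' t| ^+ 2))%R.
Proof.
move=> pz pz'.
have i1 := piecewise_inner_integrable tg0 tgS hX nN pz pz'.
have i2 := piecewise_sqr_integrable tg0 tgS hX nN pz.
have i2' := piecewise_sqr_integrable tg0 tgS hX nN pz'.
have Z0 : 0 <= (\int[mu]_(t in `]0, tg n[) (`|z t| ^+ 2))%R.
  by apply: Rintegral_ge0 => t _; exact: sqr_ge0.
have hz : (\int[mu]_(t in `]0%R, tg n[) (`| `|z t| | ^+ 2)%:E <=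
    (Num.sqrt (\int[mu]_(t in `]0, tg n[) (`|z t| ^+ 2))%R ^+ 2)%:E)%E.
  rewrite sqr_sqrtr// -ge0_integral_Rint//.
  by under eq_integral do rewrite normr_id.
rewrite ler_norml; apply/andP; split.
- rewrite lerNl -mulN1r -RintZ//.
  apply: (Rint_le_lower_hoelder _ _ i2' _ _ _ hz) => //; first exact: ae_integrableZ.
  move=> t _; rewrite mulN1r -innerNr// normr_id -[`|z' t|]normrN; exact: inner_le.
- apply: (Rint_le_lower_hoelder _ i1 i2' _ _ _ hz) => // t _.
  by rewrite normr_id; exact: inner_le.
Qed.

Lemma piecewise_norm_sqrD (z z' : R -> X) : piecewise_poly N tg q setT z ->
  piecewise_poly N tg q setT z' ->
  (\int[mu]_(t in `]0, tg n[) (`|z t + z' t| ^+ 2) =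
   \int[mu]_(t in `]0, tg n[) (`|z t| ^+ 2) +
   2 * \int[mu]_(t in `]0, tg n[) inner (z t) (z' t) +
   \int[mu]_(t in `]0, tg n[) (`|z' t| ^+ 2))%R.
Proof.
move=> pz pz'.
have i1 := piecewise_inner_integrable tg0 tgS hX nN pz pz'.
have i2 := piecewise_sqr_integrable tg0 tgS hX nN pz.
have i2' := piecewise_sqr_integrable tg0 tgS hX nN pz'.
have iZ : ae_integrable `]0, tg n[ (fun t => 2 * inner (z t) (z' t)).
  exact: ae_integrableZ.
have iS : ae_integrable `]0, tg n[ (fun t => `|z t| ^+ 2 + 2 * inner (z t) (z' t)).
  exact: ae_integrableD.
rewrite -RintZ// -RintD// -RintD//.
by apply: eq_Rintegral => t _; rewrite normD_sqr.
Qed.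

Lemma piecewise_minkowski (z z' : R -> X) : piecewise_poly N tg q setT z ->
  piecewise_poly N tg q setT z' ->
  Num.sqrt (\int[mu]_(t in `]0, tg n[) (`|z t + z' t| ^+ 2))%R <=
  Num.sqrt (\int[mu]_(t in `]0, tg n[) (`|z t| ^+ 2))%R +
  Num.sqrt (\int[mu]_(t in `]0, tg n[) (`|z' t| ^+ 2))%R.
Proof.
move=> pz pz'; have := piecewise_inner_le pz pz'.
rewrite piecewise_norm_sqrD//.
set a := (\int[mu]_(t in `]0, tg n[) (`|z t| ^+ 2))%R.
set b := (\int[mu]_(t in `]0, tg n[) (`|z' t| ^+ 2))%R.
set c := (\int[mu]_(t in `]0, tg n[) inner (z t) (z' t))%R.
have a0 : 0 <= a by apply: Rintegral_ge0 => t _; exact: sqr_ge0.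
have b0 : 0 <= b by apply: Rintegral_ge0 => t _; exact: sqr_ge0.
rewrite ler_norml => /andP[_ H].
have S0 : 0 <= Num.sqrt a + Num.sqrt b by rewrite addr_ge0 ?sqrtr_ge0.
rewrite -[leRHS](ger0_norm S0).
rewrite -sqrtr_sqr ler_wsqrtr// sqrrD !sqr_sqrtr//.
rewrite lerD2r lerD2l mulr2n; move: H; clear; lra.
Qed.

End PiecewiseL2.
(** * Errors of the discrete scheme *)

Section ProjectedRelation.
Context {R : realType}.
Notation mu := (@lebesgue_measure R).
Variables (N : nat) (tg : nat -> R).
Hypothesis tg0 : tg 0%N = 0.
Hypothesis tgS : forall n, (n < N)%N -> tg n < tg n.+1.
Hypothesis T0 : 0 < tg N.
Variables (q : nat) (q0 : (0 < q)%N).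

Let N0 : (0 < N)%N.
Proof. by rewrite lt0n; apply: contraTneq T0 => ->; rewrite tg0 ltxx. Qed.

Lemma Pi1_primitive (X : normedModType R) (L : X -> R) (w : R -> X) :
  riesz_space X -> bounded_functional L -> H1 (tg N) w ->
  primitive (tg N) (fun t => L (Pi1 N tg q w t))
    (fun t => L (Pi0 N tg q.-1 (time_derivative (tg N) w) t)) /\
  Pi1 N tg q w 0 = w 0.
Proof.
move=> rX bL hw; have [_ dz zn] := Pi1P tg0 tgS rX q0 T0 hw.
split; first exact: time_derivative_primitive dz bL.
by have := zn 0%N N0; rewrite tg0.
Qed.

(** An affine relation between functionals of several functions holds for
    their projections too: it passes to the derivatives, then to their
    projections, and so to the primitives of those, which start from the same
    values; continuity gives these initial values. *)
Lemma Pi1_relation (X Y Z : normedModType R) (L : X -> R) (M : Y -> R) (K : Z -> R)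
    (f : R -> X) (u : R -> Y) (p : R -> Z) :
  riesz_space X -> riesz_space Y -> riesz_space Z ->
  bounded_functional L -> bounded_functional M -> bounded_functional K ->
  H1 (tg N) f -> H1 (tg N) u -> H1 (tg N) p ->
  (forall t, 0 < t < tg N -> M (u t) - K (p t) = L (f t)) ->
  forall t, 0 <= t <= tg N ->
    M (Pi1 N tg q u t) - K (Pi1 N tg q p t) = L (Pi1 N tg q f t).
Proof.
move=> rX rY rZ bL bM bK hf hu hp fup.
pose h t := M (u t) - K (p t) - L (f t).
pose dh t := M (time_derivative (tg N) u t) - K (time_derivative (tg N) p t)
  - L (time_derivative (tg N) f t).
have Ph : primitive (tg N) h dh.
  apply: primitiveB; first apply: primitiveB.
  - exact: time_derivative_primitive (time_derivativeP hu) bM.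
  - exact: time_derivative_primitive (time_derivativeP hp) bK.
  - exact: time_derivative_primitive (time_derivativeP hf) bL.
have [h0 _ dh0] : [/\ h 0 = (0 : {poly R}).[0], h (tg N) = (0 : {poly R}).[tg N] &
    {ae mu, forall t, `]0, tg N[%classic t -> dh t = (0 : {poly R})^`().[t]}].
  apply: (primitive_horner Ph) => // t t0; by rewrite /h fup// subrr horner0.
rewrite horner0 in h0.
pose r t := M (Pi1 N tg q u t) - K (Pi1 N tg q p t) - L (Pi1 N tg q f t).
pose dr t := M (Pi0 N tg q.-1 (time_derivative (tg N) u) t)
  - K (Pi0 N tg q.-1 (time_derivative (tg N) p) t)
  - L (Pi0 N tg q.-1 (time_derivative (tg N) f) t).
have [Pu u0] := Pi1_primitive rY bM hu.
have [Pp p0] := Pi1_primitive rZ bK hp.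
have [Pf f0] := Pi1_primitive rX bL hf.
have Pr : primitive (tg N) r dr by apply: primitiveB => //; exact: primitiveB.
have r0 : r 0 = 0 by rewrite /r u0 p0 f0.
have iu := time_derivative_weakly (time_derivativeP hu).
have ip := time_derivative_weakly (time_derivativeP hp).
have if_ := time_derivative_weakly (time_derivativeP hf).
have dr0 : {ae mu, forall t, `]0, tg N[%classic t -> dr t = 0}.
  apply: grid_ae => // m mN; apply: aeW => t; rewrite /= in_itv/= => tm.
  have [cu [_ ucE]] := piecewise_vpoly (Pi0_piecewise tg0 tgS rY q.-1 iu) mN.
  have [cp [_ pcE]] := piecewise_vpoly (Pi0_piecewise tg0 tgS rZ q.-1 ip) mN.
  have [cf [_ fcE]] := piecewise_vpoly (Pi0_piecewise tg0 tgS rX q.-1 if_) mN.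
  pose P := component_poly M cu - component_poly K cp - component_poly L cf.
  have drP s : tg m < s < tg m.+1 -> dr s = P.[s].
    move=> sm; rewrite /dr ucE// pcE// fcE// !horner_component//.
    by rewrite !hornerD !hornerN.
  have sP : (size P <= q.-1.+1)%N.
    rewrite (leq_trans (size_polyD _ _))// geq_max size_polyN size_component andbT.
    by rewrite (leq_trans (size_polyD _ _))// geq_max size_polyN !size_component.
  suff -> : dr t = (0 : {poly R}).[t] by rewrite horner0.
  rewrite drP// (_ : P = 0)//; apply: (Rint_sqr_horner_eq0 (tgS mN)).
  have cell (Y' : normedModType R) (L' : Y' -> R) w : bounded_functional L' ->
      weakly_integrable `]0, tg N[ w ->
      ae_integrable `]tg m, tg m.+1[ (fun s => P.[s] * L' (w s)).
    move=> bL' iw; apply: ae_integrable_hornerM.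
    exact: (weakly_integrable_cell tg0 tgS mN iw).1.
  have zu := piecewise_weakly tg0 tgS rY.1 (Pi0_piecewise tg0 tgS rY q.-1 iu).
  have zp := piecewise_weakly tg0 tgS rZ.1 (Pi0_piecewise tg0 tgS rZ q.-1 ip).
  have zf := piecewise_weakly tg0 tgS rX.1 (Pi0_piecewise tg0 tgS rX q.-1 if_).
  transitivity (\int[mu]_(s in `]tg m, tg m.+1[) (P.[s] * dr s))%R.
    by apply: eq_Rintegral => s; rewrite inE/= in_itv/= => sm; rewrite drP// expr2.
  transitivity (\int[mu]_(s in `]tg m, tg m.+1[) (P.[s] * dh s))%R.
    have split3 A B C : ae_integrable `]tg m, tg m.+1[ (fun s => P.[s] * A s) ->
        ae_integrable `]tg m, tg m.+1[ (fun s => P.[s] * B s) ->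
        ae_integrable `]tg m, tg m.+1[ (fun s => P.[s] * C s) ->
        (\int[mu]_(s in `]tg m, tg m.+1[) (P.[s] * (A s - B s - C s)) =
         \int[mu]_(s in `]tg m, tg m.+1[) (P.[s] * A s) -
         \int[mu]_(s in `]tg m, tg m.+1[) (P.[s] * B s) -
         \int[mu]_(s in `]tg m, tg m.+1[) (P.[s] * C s))%R.
      move=> iA iB iC; rewrite -RintB// -RintB//; last exact: ae_integrableB.
      by apply: eq_Rintegral => s _; rewrite !mulrBr.
    rewrite split3; [|exact: cell..].
    rewrite [RHS]split3; [|exact: cell..].
    by rewrite -!(Pi0_test tg0 tgS _ _ mN sP).
  rewrite -[RHS](@Rint0 _ `]tg m, tg m.+1[)//; apply: eq_Rintegral_ae => //.
  apply: ae_imp _ dh0 => s dh0 sm.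
  by rewrite dh0 ?deriv0 ?horner0 ?mulr0//; exact: grid_subset mN (leqnn N) _ sm.
move=> t t0T; apply/eqP; rewrite -subr_eq0; apply/eqP; rewrite -/(r t).
have := Pr.2 t t0T; rewrite r0 subr0 => ->; rewrite -[RHS](@Rint0 _ `]0, t[)//.
apply: eq_Rintegral_ae => //; apply: ae_imp _ dr0 => s dr0.
rewrite /= in_itv/= => /andP[s0 st]; rewrite dr0//= in_itv/= s0 (lt_le_trans st)//.
by case/andP: t0T.
Qed.

End ProjectedRelation.

Section Scheme.
Context {R : realType} {V Q : completeNormedModType R}.
Notation mu := (@lebesgue_measure R).
Hypotheses (hV : hilbertian V) (hQ : hilbertian Q).
Let rV : riesz_space V := riesz_representation hV.
Let rQ : riesz_space Q := riesz_representation hQ.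

Variables (b : V -> Q -> R).
Hypotheses (bl : forall x, @bounded_functional R V (fun v => b v x)).
Hypotheses (br : forall v, @bounded_functional R Q (b v)).

(** [PV] and [PQ] are the orthogonal projections onto the discrete spaces,
    and [A] represents the coupling of the pressure error, so that the
    elliptic projection is [(PV (u + A p), PQ p)]. *)
Variables (Vh : set V) (Qh : set Q) (PV : V -> V) (PQ : Q -> Q) (A : Q -> V).
Hypotheses (bPV : bounded_map PV) (PVh : forall v, Vh (PV v))
  (PVo : forall v w, Vh w -> inner (PV v) w = inner v w)
  (VhB : forall v w, Vh v -> Vh w -> Vh (v - w))
  (VhZ : forall l v, Vh v -> Vh (l *: v))
  (VhS : forall n (F : 'I_n -> V), (forall i, Vh (F i)) -> Vh (\sum_(i < n) F i)).
Hypotheses (bPQ : bounded_map PQ) (PQh : forall x, Qh (PQ x))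
  (PQo : forall x y, Qh y -> inner (PQ x) y = inner x y)
  (PQle : forall x, `|PQ x| <= `|x|)
  (QhB : forall x y, Qh x -> Qh y -> Qh (x - y))
  (QhZ : forall l x, Qh x -> Qh (l *: x))
  (QhS : forall n (F : 'I_n -> Q), (forall i, Qh (F i)) -> Qh (\sum_(i < n) F i)).
Hypotheses (bA : bounded_map A)
  (AE : forall x v, inner (A x) v = b v (PQ x - x)).

Variables (N : nat) (tg : nat -> R).
Hypotheses (tg0 : tg 0%N = 0) (tgS : forall n, (n < N)%N -> tg n < tg n.+1)
  (T0 : 0 < tg N).
Variables (q : nat).

Variables (u ut Uh : R -> V) (p pt Ph : R -> Q).
Hypotheses (hu : H1 (tg N) u) (hp : H1 (tg N) p).
Hypotheses (hUh : H1 (tg N) Uh) (hPh : H1 (tg N) Ph).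
Hypotheses (utE : forall t, 0 <= t <= tg N -> ut t = PV (u t + A (p t)))
  (ptE : forall t, 0 <= t <= tg N -> pt t = PQ (p t)).
Hypotheses (pUh : piecewise_poly N tg q.+1 Vh Uh)
  (pPh : piecewise_poly N tg q.+1 Qh Ph).
Hypothesis Uh0 : Uh 0 = ut 0.

Notation du := (time_derivative (tg N) u).
Notation dut := (time_derivative (tg N) ut).
Notation dUh := (time_derivative (tg N) Uh).
Notation dp := (time_derivative (tg N) p).
Notation Pu := (Pi1 N tg q.+1 u).
Notation Pp := (Pi1 N tg q.+1 p).

(** The first equation of the scheme and the projection in time of the
    continuous one have the same right hand side, which is eliminated. *)
Hypothesis first_eq : forall t, 0 < t <= tg N -> forall v, Vh v ->
  inner (Uh t) v - b v (Ph t) = inner (Pu t) v - b v (Pp t).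

(** The second equations of the scheme and of the continuous problem, tested on
    each cell; the right hand sides and the projections have been eliminated. *)
Hypothesis second_eq : forall m, (m < N)%N -> forall (r : {poly R}) x,
  (size r <= q.+1)%N -> Qh x ->
  (\int[mu]_(t in `]tg m, tg m.+1[) (r.[t] * (b (dUh t) x + inner x (Ph t))) =
   \int[mu]_(t in `]tg m, tg m.+1[) (r.[t] * (b (du t) x + inner x (p t))))%R.

(** The discrete solution minus the elliptic projection of the projections in
    time: a discrete function in space and time, with a constraint that has no
    right hand side. *)
Let Eu t := Uh t - PV (Pu t + A (Pp t)).
Let Ep t := Ph t - PQ (Pp t).

Let bi (X : completeNormedModType R) (hX : hilbertian X) (x : X) := inner_bounded x hX.

Lemma error_constraint t v : 0 < t <= tg N -> Vh v -> inner (Eu t) v = b v (Ep t).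
Proof.
move=> t0T Vv; rewrite /Eu /Ep innerBl// PVo// innerDl// AE.
have := first_eq t0T Vv.
rewrite !(bfunB _ _ (br v)); lra.
Qed.

Let Pi1_node X (rX : riesz_space X) (w : R -> X) n : H1 (tg N) w -> (n <= N)%N ->
  Pi1 N tg q.+1 w (tg n) = w (tg n).
Proof.
move=> hw nN; apply: (inner_inj rX.1) => x; rewrite !(innerC _ x).
have bx := inner_bounded x rX.1.
have [dz w0] := Pi1_primitive tg0 tgS T0 (ltn0Sn q) rX bx hw.
have dw := time_derivative_primitive (time_derivativeP hw) bx.
apply: (Pi0_primitive_node tg0 tgS rX nN _ dw dz); last by rewrite w0.
exact: time_derivative_weakly (time_derivativeP hw).
Qed.

Lemma error_node n : (n <= N)%N ->
  Eu (tg n) = Uh (tg n) - ut (tg n) /\ Ep (tg n) = Ph (tg n) - pt (tg n).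
Proof.
move=> nN.
have tn : 0 <= tg n <= tg N by rewrite (grid_ge0 tg0 tgS)// (grid_le tgS).
by rewrite /Eu /Ep utE// ptE// (Pi1_node rV)// (Pi1_node rQ).
Qed.

Let idu := time_derivative_weakly (time_derivativeP hu).
Let idp := time_derivative_weakly (time_derivativeP hp).
Let idUh := time_derivative_weakly (time_derivativeP hUh).

Let is_dut : is_time_derivative (tg N) ut (fun t => PV (du t + A (dp t))).
Proof.
apply: (@is_time_derivative_ext _ _ T0 _ (fun t => PV (u t + A (p t)))).
  by move=> t t0T; rewrite utE.
apply: is_time_derivative_map => //; apply: is_time_derivativeD => //.
  exact: time_derivativeP.
by apply: is_time_derivative_map => //; exact: time_derivativeP.
Qed.

Let hut : H1 (tg N) ut.
Proof. by exists (fun t => PV (du t + A (dp t))). Qed.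

Let idut := time_derivative_weakly (time_derivativeP hut).

Let pPu : piecewise_poly N tg q.+1 setT Pu.
Proof. by have [] := Pi1P tg0 tgS rV (ltn0Sn q) T0 hu. Qed.

Let pPp : piecewise_poly N tg q.+1 setT Pp.
Proof. by have [] := Pi1P tg0 tgS rQ (ltn0Sn q) T0 hp. Qed.

(** Functionals of [Eu] are primitives, so that continuity extends the polynomial
    of a cell to its ends and uniqueness of derivatives identifies its
    derivative.  Tests of degree [q] do not see the projections in time, so the
    second equation applies to that derivative. *)
Lemma error_cell m : (m < N)%N -> exists c : 'I_q.+2 -> V,
  [/\ forall i, Vh (c i),
      forall t, tg m <= t <= tg m.+1 -> Eu t = vpoly c t &
      forall (r : {poly R}) x, (size r <= q.+1)%N -> Qh x ->
      (\int[mu]_(t in `]tg m, tg m.+1[) (r.[t] * b (vpoly (derive_coef c) t) x) =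
       \int[mu]_(t in `]tg m, tg m.+1[)
         (r.[t] * (b (du t - dut t) x + inner x (p t - Ph t))))%R].
Proof.
move=> mN.
have [cU [VcU UE]] := piecewise_vpoly pUh mN.
have [cu [_ uE]] := piecewise_vpoly pPu mN.
have [cp [_ pE]] := piecewise_vpoly pPp mN.
have mN' : tg m.+1 <= tg N by rewrite (grid_le tgS).
have m0 : 0 <= tg m by rewrite (grid_ge0 tg0 tgS)// ltnW.
have mm := tgS mN.
pose c i := cU i - PV (cu i + A (cp i)).
have EE t : tg m < t < tg m.+1 -> Eu t = vpoly c t.
  move=> tm; rewrite /Eu UE// uE// pE// (bmap_sum _ bA) -big_split/= (bmap_sum _ bPV).
  rewrite -sumrB; apply: eq_bigr => i _.
  by rewrite /c (bmapZ _ _ bA) -scalerDr (bmapZ _ _ bPV) -scalerBr.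
have EP (L : V -> R) : bounded_functional L -> primitive (tg N) (fun t => L (Eu t))
    (fun t => L (dUh t) - L (PV (Pi0 N tg q du t + A (Pi0 N tg q dp t)))).
  move=> bL.
  have P1 := time_derivative_primitive (time_derivativeP hUh) bL.
  have bLP := bfun_comp bL bPV.
  have [P2 _] := Pi1_primitive tg0 tgS T0 (ltn0Sn q) rV bLP hu.
  have bLA := bfun_comp bLP bA.
  have [P3 _] := Pi1_primitive tg0 tgS T0 (ltn0Sn q) rQ bLA hp.
  have := primitiveB P1 (primitiveD P2 P3).
  congr primitive; apply/funext => t /=.
    by rewrite /Eu (bfunB _ _ bL) (bmapD _ _ bPV) (bfunD _ _ bL).
  by rewrite (bmapD _ _ bPV) (bfunD _ _ bL).
have ends (L : V -> R) (bL : bounded_functional L) :=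
  primitive_horner (EP L bL) m0 mm mN'
    (fun t tm => etrans (congr1 L (EE t tm)) (horner_component c t bL)).
exists c; split=> [i|t|r x sr Qx].
- by apply: VhB.
- move=> /andP[]; rewrite le_eqVlt => /predU1P[<- _|mt].
    apply: (inner_inj hV) => v; rewrite !(innerC _ v).
    by have [-> _ _] := ends _ (bi hV v); rewrite horner_component//; exact: bi.
  rewrite le_eqVlt => /predU1P[->|tm]; last by rewrite EE// mt.
  apply: (inner_inj hV) => v; rewrite !(innerC _ v).
  by have [_ -> _] := ends _ (bi hV v); rewrite horner_component//; exact: bi.
- have [_ _ dE] := ends _ (bl x).
  pose L v := b v x; have bL : bounded_functional L := bl x.
  have bLP := bfun_comp bL bPV; have bLA := bfun_comp bLP bA.
  have cell (X : normedModType R) (K : X -> R) w : bounded_functional K ->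
      weakly_integrable `]0, tg N[ w ->
      ae_integrable `]tg m, tg m.+1[ (fun s => r.[s] * K (w s)).
    move=> bK iw; apply: ae_integrable_hornerM.
    exact: (weakly_integrable_cell tg0 tgS mN iw).1.
  have zu := piecewise_weakly tg0 tgS hV (Pi0_piecewise tg0 tgS rV q idu).
  have zp := piecewise_weakly tg0 tgS hQ (Pi0_piecewise tg0 tgS rQ q idp).
  have ip := H1_weakly T0 hQ hp; have iPh := H1_weakly T0 hQ hPh.
  transitivity (\int[mu]_(t in `]tg m, tg m.+1[) (r.[t] * L (dUh t)
      - (r.[t] * L (PV (Pi0 N tg q du t)) + r.[t] * L (PV (A (Pi0 N tg q dp t))))))%R.
    apply: eq_Rintegral_ae => //; apply: ae_imp _ dE => t dE tm.
    rewrite (horner_component_derive c t (bl x)) -dE//.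
    by rewrite -/(L _) -/(L _) (bmapD _ _ bPV) (bfunD _ _ bL); ring.
  have iU := cell _ L _ bL idUh.
  have iu0 := cell _ _ _ bLP zu; have ip0 := cell _ _ _ bLA zp.
  have iu := cell _ _ _ bLP idu; have ipA := cell _ _ _ bLA idp.
  rewrite (RintB _ iU (ae_integrableD _ iu0 ip0))// (RintD _ iu0 ip0)//.
  have := Pi0_test tg0 tgS rV idu mN sr bLP.
  rewrite /comp => <-.
  have := Pi0_test tg0 tgS rQ idp mN sr bLA.
  rewrite /comp => <-.
  rewrite -(RintD _ iu ipA)//.
  have -> : (\int[mu]_(t in `]tg m, tg m.+1[)
      (r.[t] * L (PV (du t)) + r.[t] * L (PV (A (dp t)))) =
     \int[mu]_(t in `]tg m, tg m.+1[) (r.[t] * L (dut t)))%R.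
    have := primitive_unique (time_derivative_primitive is_dut bL)
      (time_derivative_primitive (time_derivativeP hut) bL) => H.
    apply: eq_Rintegral_ae => //; apply: ae_imp _ H => t H tm.
    rewrite -H; last exact: grid_subset mN (leqnn N) _ tm.
    by rewrite (bmapD _ _ bPV) (bfunD _ _ bL); ring.
  have iLU := cell _ L _ bL idUh; have iLut := cell _ L _ bL idut.
  have iLu := cell _ L _ bL idu.
  have iph := cell _ _ _ (bi hQ x) iPh; have ipp := cell _ _ _ (bi hQ x) ip.
  have := second_eq mN sr Qx.
  transitivity (\int[mu]_(t in `]tg m, tg m.+1[) (r.[t] * L (dUh t)) +
    \int[mu]_(t in `]tg m, tg m.+1[) (r.[t] * inner x (Ph t)) -
    \int[mu]_(t in `]tg m, tg m.+1[) (r.[t] * inner x (Ph t)) -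
    \int[mu]_(t in `]tg m, tg m.+1[) (r.[t] * L (dut t)))%R.
    by rewrite addrK.
  rewrite -RintD//.
  have -> : (\int[mu]_(t in `]tg m, tg m.+1[) (r.[t] * L (dUh t) + r.[t] * inner x (Ph t)) =
    \int[mu]_(t in `]tg m, tg m.+1[) (r.[t] * L (du t) + r.[t] * inner x (p t)))%R.
    have := second_eq mN sr Qx.
    under eq_Rintegral do rewrite mulrDr.
    by under [in X in _ = X -> _]eq_Rintegral do rewrite mulrDr.
  rewrite -RintB//; last exact: ae_integrableD.
  rewrite -RintB//; last by apply: ae_integrableB => //; exact: ae_integrableD.
  apply: eq_Rintegral => t _.
  by rewrite innerBr// (bfunB _ _ (bl x)) /L; ring.
Qed.

Let ip := H1_weakly T0 hQ hp.
Let iPh := H1_weakly T0 hQ hPh.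
Let iPp := piecewise_weakly tg0 tgS hQ pPp.

Let ipPh : weakly_integrable `]0, tg N[ (fun t => p t - Ph t).
Proof. exact: weakly_integrableB. Qed.

Let ipPp : weakly_integrable `]0, tg N[ (fun t => p t - Pp t).
Proof. exact: weakly_integrableB. Qed.

(** The test pressure [e] combines the two projected pressure errors so that it
    represents [Ep] against discrete pressures of degree [q]. *)
Let z := Pi0 N tg q (fun t => p t - Ph t).
Let w := Pi0 N tg q (fun t => p t - Pp t).
Let e t := PQ (w t - z t).

Let pz : piecewise_poly N tg q setT z. Proof. exact: Pi0_piecewise. Qed.
Let pw : piecewise_poly N tg q setT w. Proof. exact: Pi0_piecewise. Qed.
Let pe : piecewise_poly N tg q Qh e.
Proof. by apply: piecewise_poly_map => //; exact: piecewise_polyB. Qed.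

Let cell_integrable (X : normedModType R) (K : X -> R) v m (r : {poly R}) :
  (m < N)%N -> bounded_functional K -> weakly_integrable `]0, tg N[ v ->
  ae_integrable `]tg m, tg m.+1[ (fun s => r.[s] * K (v s)).
Proof.
move=> mN bK iv; apply: ae_integrable_hornerM.
exact: (weakly_integrable_cell tg0 tgS mN iv).1.
Qed.

Lemma pressure_error_test m (r : {poly R}) x : (m < N)%N -> (size r <= q.+1)%N ->
  Qh x -> (\int[mu]_(t in `]tg m, tg m.+1[) (r.[t] * inner x (Ep t)) =
  \int[mu]_(t in `]tg m, tg m.+1[) (r.[t] * inner x (e t)))%R.
Proof.
move=> mN sr Qx.
have bx := bi hQ x.
have h1 := Pi0_test tg0 tgS rQ ipPp mN sr bx.
have h2 := Pi0_test tg0 tgS rQ ipPh mN sr bx.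
have i1 := cell_integrable r mN bx ipPp; have i2 := cell_integrable r mN bx ipPh.
have i3 := cell_integrable r mN bx (piecewise_weakly tg0 tgS hQ pw).
have i4 := cell_integrable r mN bx (piecewise_weakly tg0 tgS hQ pz).
transitivity (\int[mu]_(t in `]tg m, tg m.+1[) (r.[t] * inner x (p t - Pp t)
   - r.[t] * inner x (p t - Ph t)))%R.
  apply: eq_Rintegral => t _; rewrite /Ep !innerBr// (innerC x (PQ _)) PQo//.
  by rewrite (innerC x (Pp t)); ring.
rewrite (RintB _ i1 i2)// h1 h2 -(RintB _ i3 i4)//; apply: eq_Rintegral => t _.
by rewrite /e (innerC x (PQ _)) PQo// innerBl// !(innerC x) mulrBr.
Qed.

(** Half the increment of the squared error is the integral of
    [inner Eu (Eu^`())].  The constraint turns it into the coupling of the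
    derivative with [Ep]; as the derivative has degree [q], the pressure may be
    replaced by its projection [e], and then the second equation applies. *)
Lemma energy_cell m : (m < N)%N ->
  ae_integrable `]tg m, tg m.+1[ (fun t => b (du t - dut t) (e t)) /\
  2^-1 * (`|Eu (tg m.+1)| ^+ 2 - `|Eu (tg m)| ^+ 2) =
  (\int[mu]_(t in `]tg m, tg m.+1[) (b (du t - dut t) (e t)
     + inner (z t) (e t)))%R.
Proof.
move=> mN.
have [c [Vc cE ctest]] := error_cell mN.
have [x [Qx ex]] := piecewise_vpoly pe mN.
have [cP [QcP cPE]] := piecewise_vpoly pPh mN.
have mm := tgS mN.
have mN' : tg m.+1 <= tg N by rewrite (grid_le tgS).
have m0 : 0 <= tg m by rewrite (grid_ge0 tg0 tgS)// ltnW.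
have iD : weakly_integrable `]0, tg N[ (fun t => du t - dut t).
  exact: weakly_integrableB.
have iDx (j : 'I_q.+1) : ae_integrable `]tg m, tg m.+1[ (fun t => b (du t - dut t) (x j)).
  exact: (weakly_integrable_cell tg0 tgS mN iD).1 _ (bl (x j)).
have tI t : `]tg m, tg m.+1[%classic t -> tg m < t < tg m.+1.
  by rewrite /= in_itv.
split.
  apply: (@ae_integrable_eq _ _ (fun t => \sum_(j < q.+1) ('X^j : {poly R}).[t] *
      b (du t - dut t) (x j))).
    move=> t /tI tm; rewrite ex// (bfun_vpoly _ _ (br _)).
    by apply: eq_bigr => j _; rewrite hornerXn.
  by apply: ae_integrable_sum => // j; exact: ae_integrable_hornerM.
pose c' := derive_coef c.
have Vc' i : Vh (c' i) by exact: VhZ.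
have Vvc' t : Vh (vpoly c' t) by apply: VhS => i; exact: VhZ.
have QEp t : tg m < t < tg m.+1 -> Qh (Ep t).
  move=> tm; rewrite /Ep; apply: QhB => //; rewrite cPE//.
  by apply: QhS => i; exact: QhZ.
rewrite !cE ?lexx ?ltW// -(Rint_energy c hV (ltW mm)).
transitivity (\int[mu]_(t in `]tg m, tg m.+1[)
    (\sum_(i < q.+1) t ^+ i * b (c' i) (Ep t)))%R.
  apply: eq_Rintegral => t /set_mem/tI tm; rewrite -cE; last first.
    by case/andP: tm => ? ?; rewrite !ltW.
  rewrite error_constraint// ?(bfun_vpoly _ _ (bl _))//.
  by case/andP: tm => mt tm; rewrite (le_lt_trans m0)// (le_trans (ltW tm)).
(* Against discrete pressures the coupling with [v] is the inner product with
   a discrete pressure. *)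
have brep v : exists2 r, Qh r & forall s, Qh s -> b v s = inner r s.
  have [r rP] := rQ.2 _ (br v); exists (PQ r) => // s Qs.
  by rewrite rP PQo.
have Qe t : Qh (e t) by exact: PQh.
have iEp : weakly_integrable `]0, tg N[ Ep.
  apply: weakly_integrableB => //; exact: weakly_integrable_map.
have ie : weakly_integrable `]0, tg N[ e.
  by apply: (piecewise_weakly tg0 tgS hQ) (piecewise_polyT pe).
have cellb (v : V) (s : R -> Q) : weakly_integrable `]0, tg N[ s ->
    ae_integrable `]tg m, tg m.+1[ (fun t => b v (s t)).
  by move=> is_; exact: (weakly_integrable_cell tg0 tgS mN is_).1 _ (br v).
transitivity (\int[mu]_(t in `]tg m, tg m.+1[)
    (\sum_(i < q.+1) t ^+ i * b (c' i) (e t)))%R.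
  apply: Rint_coefficients => [i|i|i]; [exact: cellb|exact: cellb|].
  have [r Qr rP] := brep (c' i).
  have sX : (size ('X^i : {poly R}) <= q.+1)%N by rewrite size_polyXn.
  transitivity (\int[mu]_(t in `]tg m, tg m.+1[) (('X^i : {poly R}).[t] * inner r (Ep t)))%R.
    by apply: eq_Rintegral => t /set_mem/tI tm; rewrite rP//; exact: QEp.
  rewrite (pressure_error_test mN sX Qr).
  by apply: eq_Rintegral => t _; rewrite rP.
transitivity (\int[mu]_(t in `]tg m, tg m.+1[)
    (\sum_(j < q.+1) t ^+ j * b (vpoly c' t) (x j)))%R.
  apply: eq_Rintegral => t /set_mem/tI tm.
  by rewrite -(bfun_vpoly _ _ (bl (e t))) ex// (bfun_vpoly _ _ (br _)).
have iz := piecewise_weakly tg0 tgS hQ pz.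
have celli (s : R -> Q) (y : Q) : weakly_integrable `]0, tg N[ s ->
    ae_integrable `]tg m, tg m.+1[ (fun t => inner y (s t)).
  by move=> is_; exact: (weakly_integrable_cell tg0 tgS mN is_).1 _ (bi hQ y).
transitivity (\int[mu]_(t in `]tg m, tg m.+1[)
    (\sum_(j < q.+1) t ^+ j * (b (du t - dut t) (x j) + inner (x j) (z t))))%R.
  apply: Rint_coefficients => [j|j|j].
  - exact: ae_integrable_component (bl (x j)).
  - by apply: ae_integrableD => //; exact: celli.
  have sX : (size ('X^j : {poly R}) <= q.+1)%N by rewrite size_polyXn.
  rewrite (ctest _ _ sX (Qx j)).
  have i1 : ae_integrable `]tg m, tg m.+1[
      (fun t => ('X^j : {poly R}).[t] * b (du t - dut t) (x j)).
    exact: ae_integrable_hornerM.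
  have i2 := cell_integrable ('X^j) mN (bi hQ (x j)) ipPh.
  have i3 := cell_integrable ('X^j) mN (bi hQ (x j)) iz.
  transitivity (\int[mu]_(t in `]tg m, tg m.+1[) (('X^j : {poly R}).[t] * b (du t - dut t) (x j)
    + ('X^j : {poly R}).[t] * inner (x j) (p t - Ph t)))%R.
    by apply: eq_Rintegral => t _; rewrite mulrDr.
  rewrite (RintD _ i1 i2)// (Pi0_test tg0 tgS rQ ipPh mN sX (bi hQ (x j))).
  rewrite -(RintD _ i1 i3)//; apply: eq_Rintegral => t _; by rewrite mulrDr.
apply: eq_Rintegral => t /set_mem/tI tm.
rewrite ex// (bfun_vpoly _ _ (br _)) (bfun_vpoly _ _ (bi hQ (z t))) -big_split /=.
by apply: eq_bigr => j _; rewrite mulrDr (innerC (x j)).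
Qed.

Lemma error_initial : Eu 0 = 0.
Proof.
by have := (error_node (leq0n N)).1; rewrite tg0 Uh0 subrr.
Qed.

Lemma energy_identity n : (n <= N)%N ->
  ae_integrable `]0, tg n[ (fun t => b (du t - dut t) (e t)) /\
  2^-1 * `|Eu (tg n)| ^+ 2 =
  (\int[mu]_(t in `]0, tg n[) b (du t - dut t) (e t))%R
  + (\int[mu]_(t in `]0, tg n[) inner (z t) (e t))%R.
Proof.
move=> nN.
have cell m (mn : (m < n)%N) := energy_cell (leq_trans mn nN).
have [ib _] := grid_integral tg0 tgS nN (fun m mn => (cell m mn).1).
have ize := piecewise_inner_integrable tg0 tgS hQ nN pz (piecewise_polyT pe).
have ibz : ae_integrable `]0, tg n[
    (fun t => b (du t - dut t) (e t) + inner (z t) (e t)) by exact: ae_integrableD.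
split=> //; rewrite -RintD//.
have icell m : (m < n)%N -> ae_integrable `]tg m, tg m.+1[
    (fun t => b (du t - dut t) (e t) + inner (z t) (e t)).
  by move=> mn; apply: ae_integrableS ibz => //; exact: (grid_subset tg0 tgS).
have [_ ->] := grid_integral tg0 tgS nN icell.
transitivity (\sum_(m < n) 2^-1 * (`|Eu (tg m.+1)| ^+ 2 - `|Eu (tg m)| ^+ 2)).
  rewrite -mulr_sumr -(big_mkord xpredT (fun m => `|Eu (tg m.+1)| ^+ 2 - `|Eu (tg m)| ^+ 2)).
  rewrite (telescope_sumr (fun m => `|Eu (tg m)| ^+ 2)) ?leq0n//.
  by rewrite tg0 error_initial normr0 expr0n subr0.
by apply: eq_bigr => m _; rewrite (cell m (ltn_ord m)).2.
Qed.

(** The square of the norm is the integral of the inner product of [p - Pp]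
    with the projected function, to which Hoelder's inequality applies. *)
Lemma projected_pressure_bound n Ct : (n <= N)%N -> 0 <= Ct ->
  L2norm `]0, tg n[ (fun t => p t - Pp t) = Ct%:E ->
  Num.sqrt (\int[mu]_(t in `]0, tg n[) (`|PQ (w t)| ^+ 2))%R <= Ct.
Proof.
move=> nN Ct0 CtE.
pose d t := PQ (w t).
have pd : piecewise_poly N tg q Qh d by exact: piecewise_poly_map.
have id2 := piecewise_sqr_integrable tg0 tgS hQ nN (piecewise_polyT pd).
have cell m : (m < n)%N ->
    ae_integrable `]tg m, tg m.+1[ (fun t => inner (p t - Pp t) (d t)) /\
    (\int[mu]_(t in `]tg m, tg m.+1[) (`|d t| ^+ 2) =
     \int[mu]_(t in `]tg m, tg m.+1[) inner (p t - Pp t) (d t))%R.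
  move=> mn; have mN := leq_trans mn nN.
  have [x [Qx dx]] := piecewise_vpoly pd mN.
  have tI t : `]tg m, tg m.+1[%classic t -> tg m < t < tg m.+1 by rewrite /= in_itv.
  have celli (s : R -> Q) (y : Q) : weakly_integrable `]0, tg N[ s ->
      ae_integrable `]tg m, tg m.+1[ (fun t => inner y (s t)).
    by move=> is_; exact: (weakly_integrable_cell tg0 tgS mN is_).1 _ (bi hQ y).
  have iw := piecewise_weakly tg0 tgS hQ pw.
  have dE (s : R -> Q) t : tg m < t < tg m.+1 ->
      inner (s t) (d t) = \sum_(j < q.+1) t ^+ j * inner (x j) (s t).
    move=> tm; rewrite dx// (bfun_vpoly _ _ (bi hQ (s t))).
    by apply: eq_bigr => j _; rewrite innerC.
  split.
    apply: (@ae_integrable_eq _ _ (fun t => \sum_(j < q.+1) ('X^j : {poly R}).[t] *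
        inner (x j) (p t - Pp t))).
      move=> t /tI tm; rewrite (dE (fun t => p t - Pp t))//.
      by apply: eq_bigr => j _; rewrite hornerXn.
    by apply: ae_integrable_sum => // j; apply: ae_integrable_hornerM; exact: celli.
  transitivity (\int[mu]_(t in `]tg m, tg m.+1[)
      (\sum_(j < q.+1) t ^+ j * inner (x j) (w t)))%R.
    apply: eq_Rintegral => t /set_mem/tI tm; rewrite -(dE w)// -innerxx.
    by rewrite {1}/d PQo//; exact: PQh.
  transitivity (\int[mu]_(t in `]tg m, tg m.+1[)
      (\sum_(j < q.+1) t ^+ j * inner (x j) (p t - Pp t)))%R; last first.
    by apply: eq_Rintegral => t /set_mem/tI tm; rewrite (dE (fun t => p t - Pp t)).
  apply: Rint_coefficients => [j|j|j]; [exact: celli|exact: celli|].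
  have sX : (size ('X^j : {poly R}) <= q.+1)%N by rewrite size_polyXn.
  by rewrite (Pi0_test tg0 tgS rQ ipPp mN sX (bi hQ (x j))).
have [iF FE] := grid_integral tg0 tgS nN (fun m mn => (cell m mn).1).
have icell m : (m < n)%N -> ae_integrable `]tg m, tg m.+1[ (fun t => `|d t| ^+ 2).
  by move=> mn; apply: ae_integrableS id2 => //; exact: (grid_subset tg0 tgS).
have [_ dd] := grid_integral tg0 tgS nN icell.
have D0 : 0 <= (\int[mu]_(t in `]0, tg n[) (`|d t| ^+ 2))%R.
  by apply: Rintegral_ge0 => t _; exact: sqr_ge0.
have : (\int[mu]_(t in `]0, tg n[) (`|d t| ^+ 2))%R <=
    Ct * Num.sqrt (\int[mu]_(t in `]0, tg n[) (`|d t| ^+ 2))%R.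
  rewrite {1}dd (eq_bigr _ (fun (m : 'I_n) _ => (cell m (ltn_ord m)).2)) -FE.
  apply: (@Rint_le_lower_hoelder _ _ _ (fun t => `|p t - Pp t|)) => //.
    by move=> t _; rewrite normr_id; exact: inner_le.
  under eq_integral do rewrite normr_id.
  exact: L2norm_integral_le CtE.
rewrite -/(d _); set S := (\int[mu]_(t in `]0, tg n[) (`|d t| ^+ 2))%R in D0 *.
rewrite -{1}(sqr_sqrtr D0) expr2.
have [->//|S0] := eqVneq (Num.sqrt S) 0.
by rewrite ler_pM2r// lt_neqAle eq_sym S0 sqrtr_ge0.
Qed.

(** With [y = - PQ z] and [d = PQ w], the test pressure is [y + d], and the
    energy identity bounds half the squared velocity error plus
    [inner y (y + d)]. *)
Lemma error_estimate (X : normedModType R) (h : R -> X) n C Ct : (n <= N)%N ->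
  (forall t x, `|b (du t - dut t) x| <= `|h t| * `|x|) ->
  0 <= C -> L2norm `]0, tg n[ h = C%:E ->
  0 <= Ct -> L2norm `]0, tg n[ (fun t => p t - Pp t) = Ct%:E ->
  `|Eu (tg n)| <= C + Ct /\
  Num.sqrt (\int[mu]_(t in `]0, tg n[) (`|PQ (z t)| ^+ 2))%R <= C + Ct.
Proof.
move=> nN bh C0 CE Ct0 CtE.
have [ib En] := energy_identity nN.
pose y t := PQ (- z t); pose d t := PQ (w t).
have bN : bounded_map (fun x => PQ (- x)).
  apply: (bmap_comp bPQ); split=> [l x1 x2|]; first by rewrite opprD scalerN.
  by exists 1; split=> // x; rewrite normrN mul1r.
have py : piecewise_poly N tg q setT y.
  by apply: (piecewise_poly_map bN).
have pd : piecewise_poly N tg q setT d by apply: (piecewise_poly_map bPQ).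
have eE t : e t = y t + d t by rewrite /e addrC (bmapD _ _ bPQ).
have dC := projected_pressure_bound nN Ct0 CtE.
have ie2 := piecewise_sqr_integrable tg0 tgS hQ nN (piecewise_polyT pe).
have hb : (\int[mu]_(t in `]0, tg n[) b (du t - dut t) (e t))%R <=
    C * Num.sqrt (\int[mu]_(t in `]0, tg n[) (`|e t| ^+ 2))%R.
  apply: (@Rint_le_lower_hoelder _ _ _ (fun t => `|h t|)) => //.
    by move=> t _; rewrite normr_id (le_trans (ler_norm _)).
  under eq_integral do rewrite normr_id.
  exact: L2norm_integral_le CE.
have iyd := piecewise_inner_integrable tg0 tgS hQ nN py pd.
have iy2 := piecewise_sqr_integrable tg0 tgS hQ nN py.
have hz : (\int[mu]_(t in `]0, tg n[) inner (z t) (e t))%R =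
    - ((\int[mu]_(t in `]0, tg n[) (`|y t| ^+ 2))%R +
       (\int[mu]_(t in `]0, tg n[) inner (y t) (d t))%R).
  rewrite -RintD// -mulN1r -RintZ//; last exact: ae_integrableD.
  apply: eq_Rintegral => t _; rewrite mulN1r -innerxx -innerDr// -eE.
  by rewrite {1}/y PQo ?innerNl ?opprK//; exact: PQh.
have e2 : (\int[mu]_(t in `]0, tg n[) (`|e t| ^+ 2))%R =
    (\int[mu]_(t in `]0, tg n[) (`|y t + d t| ^+ 2))%R.
  by apply: eq_Rintegral => t _; rewrite eE.
have := piecewise_norm_sqrD tg0 tgS hQ nN py pd; rewrite -e2.
have := piecewise_inner_le tg0 tgS hQ nN py pd.
have zy : (\int[mu]_(t in `]0, tg n[) (`|PQ (z t)| ^+ 2))%R =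
    (\int[mu]_(t in `]0, tg n[) (`|y t| ^+ 2))%R.
  apply: eq_Rintegral => t _; rewrite /y -[- z t]sub0r (bmapB _ _ bPQ) (bmap0 bPQ).
  by rewrite sub0r normrN.
rewrite zy; move: En hb; rewrite hz => En hb hs he.
have nn (k : R -> Q) : 0 <= (\int[mu]_(t in `]0, tg n[) (`|k t| ^+ 2))%R.
  by apply: Rintegral_ge0 => t _; exact: sqr_ge0.
rewrite -(sqr_sqrtr (nn e)) -(sqr_sqrtr (nn y)) -(sqr_sqrtr (nn d)) in he.
rewrite -(sqr_sqrtr (nn y)) in En.
have H : 2^-1 * `|Eu (tg n)| ^+ 2 <= C * Num.sqrt (\int[mu]_(t in `]0, tg n[) (`|e t| ^+ 2))%R
   - (Num.sqrt (\int[mu]_(t in `]0, tg n[) (`|y t| ^+ 2))%R ^+ 2 +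
     (\int[mu]_(t in `]0, tg n[) inner (y t) (d t))%R).
  by rewrite En lerD2r.
have [h1 h2] := energy_algebra (normr_ge0 _) (sqrtr_ge0 _) (sqrtr_ge0 _)
  (sqrtr_ge0 _) C0 hs he H.
by split; [apply: le_trans h1 _|apply: le_trans h2 _]; rewrite lerD2l.
Qed.

Lemma pressure_node m : (m < N)%N -> Qh (Ph (tg m.+1)).
Proof.
move=> mN; have [c [Qc cE]] := piecewise_vpoly pPh mN.
suff -> : Ph (tg m.+1) = vpoly c (tg m.+1) by apply: QhS => i; exact: QhZ.
apply: (inner_inj hQ) => x; rewrite !(innerC _ x).
have Pp_ := time_derivative_primitive (time_derivativeP hPh) (bi hQ x).
have [_ -> _] := primitive_horner Pp_ (grid_ge0 tg0 tgS (ltnW mN)) (tgS mN)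
  (grid_le tgS mN (leqnn N))
  (fun t tm => etrans (congr1 (inner x) (cE t tm)) (horner_component c t (bi hQ x))).
by rewrite horner_component//; exact: bi.
Qed.

Let zt := Pi0 N tg q (fun t => p t - pt t).

Let hpt : H1 (tg N) pt.
Proof.
exists (fun t => PQ (dp t)).
apply: (@is_time_derivative_ext _ _ T0 _ (fun t => PQ (p t))).
  by move=> t t0T; rewrite ptE.
by apply: is_time_derivative_map => //; exact: time_derivativeP.
Qed.

Let ippt : weakly_integrable `]0, tg N[ (fun t => p t - pt t).
Proof. by apply: weakly_integrableB => //; exact: H1_weakly. Qed.

Let pzt : piecewise_poly N tg q setT zt. Proof. exact: Pi0_piecewise. Qed.

Let PQ_sym x y : inner x (PQ y) = inner (PQ x) y.
Proof. by rewrite -PQo// innerC PQo// innerC. Qed.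

Let bQ : bounded_map (fun x => x - PQ x).
Proof.
split=> [l x y|].
  by rewrite bPQ.1 scalerBr opprD addrACA.
by exists 2; split=> // x; rewrite (le_trans (ler_normB _ _))// mulr_natl mulr2n lerD2l.
Qed.

(** Orthogonally to the discrete pressures the discrete solution and the
    elliptic projection both vanish, so that the projected errors agree. *)
Lemma pressure_complement m t : (m < N)%N -> tg m < t < tg m.+1 ->
  z t - PQ (z t) = zt t - PQ (zt t).
Proof.
move=> mN tm.
have pD : piecewise_poly N tg q setT (fun t => (z t - zt t) - PQ (z t - zt t)).
  by apply: (piecewise_poly_map bQ) => //; exact: piecewise_polyB.
have [c [_ cE]] := piecewise_vpoly pD mN.
suff : (z t - zt t) - PQ (z t - zt t) = 0.
  move=> E; apply/eqP; rewrite -subr_eq0 -[X in _ == X]E (bmapB _ _ bPQ) !opprB.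
  by rewrite addrACA [X in _ == X]addrACA [- zt t + _]addrC.
rewrite (cE t tm); apply: (vpoly_eq0 hQ (tgS mN)) => r x sr.
pose y := x - PQ x; have by_ := bi hQ y.
have [cP [QcP cPE]] := piecewise_vpoly pPh mN.
have i1 := cell_integrable r mN by_ ipPh; have i2 := cell_integrable r mN by_ ippt.
have i3 := cell_integrable r mN by_ (piecewise_weakly tg0 tgS hQ pz).
have i4 := cell_integrable r mN by_ (piecewise_weakly tg0 tgS hQ pzt).
transitivity (\int[mu]_(s in `]tg m, tg m.+1[)
    (r.[s] * inner y (z s) - r.[s] * inner y (zt s)))%R.
  apply: eq_Rintegral => s; rewrite inE/= in_itv/= => sm.
  by rewrite -cE// innerBr// PQ_sym -innerBl// -/y innerBr// mulrBr.
rewrite (RintB _ i3 i4)// -(Pi0_test tg0 tgS rQ ipPh mN sr by_).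
rewrite -(Pi0_test tg0 tgS rQ ippt mN sr by_) -(RintB _ i1 i2)//.
rewrite -[RHS](@Rint0 _ `]tg m, tg m.+1[)//; apply: eq_Rintegral => s.
rewrite inE/= in_itv/= => sm.
have Qs : Qh (pt s - Ph s).
  apply: QhB; last by rewrite cPE//; apply: QhS => i; exact: QhZ.
  rewrite ptE//; case/andP: sm => ms sm; rewrite !ltW//.
    by rewrite (lt_le_trans sm)// (grid_le tgS).
  by rewrite (le_lt_trans _ ms)// (grid_ge0 tg0 tgS)// ltnW.
rewrite -mulrBr -innerBr// opprB addrC subrKA.
by rewrite /y innerBl// (PQo x Qs) subrr mulr0.
Qed.

Lemma projected_error_bound n : (n <= N)%N ->
  (L2norm `]0%R, tg n[ z <= L2norm `]0%R, tg n[ zt +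
    (Num.sqrt (\int[mu]_(t in `]0%R, tg n[) (`|PQ (z t)| ^+ 2))%R)%:E)%E.
Proof.
move=> nN.
have iz2 := piecewise_sqr_integrable tg0 tgS hQ nN pz.
have izt2 := piecewise_sqr_integrable tg0 tgS hQ nN pzt.
rewrite !L2normE// -EFinD lee_fin.
have pzQ : piecewise_poly N tg q setT (fun t => z t - PQ (z t)).
  exact: (piecewise_poly_map bQ).
have pPz : piecewise_poly N tg q setT (fun t => PQ (z t)).
  exact: (piecewise_poly_map bPQ).
have := piecewise_minkowski tg0 tgS hQ nN pzQ pPz.
under eq_Rintegral do rewrite subrK.
move=> /le_trans; apply; rewrite lerD2r ler_wsqrtr//.
have izQ := piecewise_sqr_integrable tg0 tgS hQ nN pzQ.
apply: le_Rint => //; apply: (grid_ae tg0 nN) => m mn; apply: aeW => t.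
rewrite /= in_itv/= => tm; rewrite (pressure_complement (leq_trans mn nN) tm).
have PzE : inner (zt t) (PQ (zt t)) = `|PQ (zt t)| ^+ 2.
  by rewrite -innerxx PQo//; exact: PQh.
rewrite normB_sqr// PzE (_ : _ - _ + _ = `|zt t| ^+ 2 - `|PQ (zt t)| ^+ 2).
  by rewrite lerBlDr lerDl sqr_ge0.
by ring.
Qed.

End Scheme.
(** * The error estimates *)

Lemma projection_fixed {R : realType} {X : normedModType R} (S : set X)
    (P : X -> X) x : hilbertian X -> (forall x, S (P x)) ->
  (forall x s, S s -> inner (P x) s = inner x s) -> S x -> P x = x.
Proof.
move=> hX SP oP Sx; apply/eqP; rewrite -subr_eq0 -normr_eq0 -sqrf_eq0 -innerxx.
by rewrite innerBr// !innerBl// !oP// !subrr.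
Qed.

Lemma symmetric_form_inner {R : realType} {X : normedModType R}
    (a : {bilinear X -> X -> R | *%R & *%R}) : sym_form a ->
  (forall x, `|x| ^+ 2 = a x x) -> forall x y, a x y = inner x y.
Proof.
move=> sa na x y.
have e1 : a (x + y) (x + y) = a x x + 2 * a x y + a y y.
  by rewrite linearDl /= !linearDr /= (sa y x); ring.
have e2 : a (x - y) (x - y) = a x x - 2 * a x y + a y y.
  by rewrite linearBl /= !linearBr /= (sa y x); ring.
rewrite /inner !na e1 e2 (_ : _ - _ = a x y * 4); last by ring.
by rewrite mulfK// pnatr_eq0.
Qed.

Theorem theorem19 (R : realType)
  (V Q Q0 : completeNormedModType R)
  (hV : hilbertian V) (hQ : hilbertian Q) (hQ0 : hilbertian Q0)
  (* Gelfand triple Q c Q0 = Q0^* c Q^* with compact embedding iota *)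
  (iota : {linear Q -> Q0})
  (iota_inj : injective iota)
  (iota_dense : dense (range iota))
  (iota_compact : precompact (iota @` [set x : Q | `|x| <= 1]))
  (a : {bilinear V -> V -> R | *%R & *%R})
  (k : {bilinear Q -> Q -> R | *%R & *%R})
  (b : {bilinear V -> Q0 -> R | *%R & *%R})
  (A1 : [/\ bounded_form a, elliptic_form a & sym_form a])
  (A2 : [/\ bounded_form k, elliptic_form k & sym_form k])
  (A3 : exists Cb beta : R, [/\ 0 < Cb, 0 < beta,
     forall v x, b v x <= Cb * `|v| * `|x| &
     forall x, beta * `|x| <= sup [set b v x | v in [set v : V | `|v| = 1]]])
  (normV : forall v : V, `|v| ^+ 2 = a v v)
  (normQ : forall x : Q, `|x| ^+ 2 = k x x)
  (norm_iota : forall x : Q, `|iota x| <= `|x|)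
  (B : V -> dual Q0) (hB : forall v x, B v x = b v x)
  (* continuous problem *)
  (T : R) (T0 : 0 < T)
  (f : R -> dual V) (hf : H1 T f)
  (g : R -> dual Q) (hg : L2 `]0, T[ g)
  (u : R -> V) (p : R -> Q) (hu : H1 T u) (hp : H1 T p)
  (hup1 : forall t : R, 0 < t < T ->
     forall v, a (u t) v - b v (iota (p t)) = f t v)
  (hup2 : {ae @lebesgue_measure R, forall t : R, 0 < t < T ->
     forall x, b (time_derivative T u t) (iota x) + k (p t) x = g t x})
  (* elliptic projection *)
  (Vh : set V) (Qh : set Q)
  (hVh : findim_subspace Vh) (hQh : findim_subspace Qh)
  (ut : R -> V) (pt : R -> Q)
  (hut : forall t : R, 0 <= t <= T -> Vh (ut t))
  (hpt : forall t : R, 0 <= t <= T -> Qh (pt t))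
  (hell1 : forall t : R, 0 <= t <= T -> forall v, Vh v ->
     a (ut t - u t) v - b v (iota (pt t - p t)) = 0)
  (hell2 : forall t : R, 0 <= t <= T -> forall x, Qh x -> k (pt t - p t) x = 0)
  (* fully discrete scheme *)
  (N : nat) (tg : nat -> R) (htg : time_grid T N tg)
  (q : nat) (q0 : (0 < q)%N)
  (Uh : R -> V) (Ph : R -> Q)
  (hUh1 : H1 T Uh) (hUhq : piecewise_poly N tg q Vh Uh)
  (hPh1 : H1 T Ph) (hPhq : piecewise_poly N tg q Qh Ph)
  (hUh0 : Uh 0 = ut 0) (hPh0 : Ph 0 = pt 0)
  (hscheme1 : forall t : R, 0 < t <= T -> forall v, Vh v ->
     a (Uh t) v - b v (iota (Ph t)) = Pi1 N tg q f t v)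
  (hscheme2 : {ae @lebesgue_measure R, forall t : R, 0 < t < T -> forall x, Qh x ->
     b (time_derivative T Uh t) (iota x) + k (Pi0 N tg q.-1 Ph t) x =
     Pi0 N tg q.-1 g t x}) :
  let Ch n := L2norm `]0, tg n[
    (fun t => B (time_derivative T u t - time_derivative T ut t)) in
  let Ctau n := L2norm `]0, tg n[ (fun t => p t - Pi1 N tg q p t) in
  [/\ (forall n, (n <= N)%N ->
        (`|u (tg n) - Uh (tg n)|%:E <=
         `|u (tg n) - ut (tg n)|%:E + Ch n + Ctau n)%E),
      (forall n, (n <= N)%N ->
        (L2norm `]0%R, tg n[ (Pi0 N tg q.-1 (fun t => p t - Ph t)%R) <=
         L2norm `]0%R, tg n[ (Pi0 N tg q.-1 (fun t => p t - pt t)%R)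
           + Ch n + Ctau n)%E) &
      (forall betah : R, 0 < betah ->
        (forall x, Qh x -> betah * `|iota x| <=
           sup [set b v (iota x) | v in [set v | Vh v /\ `|v| = 1]]) ->
        forall n, (n <= N)%N ->
        (`|iota (p (tg n) - Ph (tg n))|%:E <=
         `|iota (p (tg n) - pt (tg n))|%:E
           + betah^-1%:E * (Ch n + Ctau n))%E)].
Proof.
case: htg => tg0 tN tgS; subst T.
case: q q0 hUhq hPhq hscheme1 hscheme2 => // q' _ pUh pPh scheme1 scheme2 Ch Ctau.
have rV := riesz_representation hV; have rQ := riesz_representation hQ.
have aE := symmetric_form_inner (let: And3 _ _ s := A1 in s) normV.
have kE := symmetric_form_inner (let: And3 _ _ s := A2 in s) normQ.
have [Cb [_ [Cb0 _ bCb _]]] := A3.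
have bCb' v x : `|b v x| <= Cb * `|v| * `|x|.
  rewrite ler_norml bCb andbT lerNl -[`|v|]normrN.
  by apply: le_trans (bCb _ _); rewrite linearNl.
pose bq v x := b v (iota x).
have bq_le v x : `|bq v x| <= Cb * `|v| * `|x|.
  by apply: le_trans (bCb' _ _) _; rewrite ler_wpM2l// mulr_ge0// ltW.
have bl x : @bounded_functional R V (fun v => bq v x).
  split=> [l v1 v2|]; first by rewrite /bq linearPl.
  exists (Cb * `|x|); split; first by rewrite mulr_ge0// ltW.
  by move=> v; rewrite mulrAC bq_le.
have br v : @bounded_functional R Q (bq v).
  split=> [l x1 x2|]; first by rewrite /bq linearP linearPr.
  exists (Cb * `|v|); split=> //; first by rewrite mulr_ge0// ltW.
(* The elliptic projection in terms of orthogonal projections. *)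
have [PV [bPV PVh PVo PVle]] := orthogonal_projection hV hVh.
have [PQ [bPQ PQh PQo PQle]] := orthogonal_projection hQ hQh.
have VhP v : Vh v -> PV v = v by exact: projection_fixed.
have QhP x : Qh x -> PQ x = x by exact: projection_fixed.
have VhB v w : Vh v -> Vh w -> Vh (v - w).
  by move=> /VhP <- /VhP <-; rewrite -(bmapB _ _ bPV).
have QhB x y : Qh x -> Qh y -> Qh (x - y).
  by move=> /QhP <- /QhP <-; rewrite -(bmapB _ _ bPQ).
have VhZ l v : Vh v -> Vh (l *: v) by move=> /VhP <-; rewrite -(bmapZ _ _ bPV).
have QhZ l x : Qh x -> Qh (l *: x) by move=> /QhP <-; rewrite -(bmapZ _ _ bPQ).
have VhS n (F : 'I_n -> V) : (forall i, Vh (F i)) -> Vh (\sum_(i < n) F i).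
  move=> VF; rewrite (eq_bigr (fun i => PV (F i))); last by move=> i _; rewrite VhP.
  by rewrite -(bmap_sum _ bPV).
have QhS n (F : 'I_n -> Q) : (forall i, Qh (F i)) -> Qh (\sum_(i < n) F i).
  move=> QF; rewrite (eq_bigr (fun i => PQ (F i))); last by move=> i _; rewrite QhP.
  by rewrite -(bmap_sum _ bPQ).
have /choice[A AP] : forall x, exists r, forall v, bq v (PQ x - x) = inner r v.
  by move=> x; exact: rV.2 _ (bl (PQ x - x)).
have AE x v : inner (A x) v = bq v (PQ x - x) by rewrite AP.
have bA : bounded_map A.
  split=> [l x y|].
    apply: (inner_inj hV) => v; rewrite innerDl// innerZl// !AE.
    rewrite -(bfunZ _ _ (br v)) -(bfunD _ _ (br v)); congr bq.
    by rewrite bPQ.1 scalerBr opprD addrACA.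
  exists (Cb * 2); split=> [|x]; first by rewrite mulr_ge0// ltW.
  apply: norm_le_inner => // [|v]; first by rewrite !mulr_ge0// ltW.
  rewrite AE (le_trans (ler_norm _))// (le_trans (bq_le _ _))//.
  rewrite mulrAC ler_wpM2r// -mulrA ler_wpM2l ?(ltW Cb0)//.
  by rewrite (le_trans (ler_normB _ _))// mulr_natl mulr2n lerD2r.
have ptE t : 0 <= t <= tg N -> pt t = PQ (p t).
  move=> t0T; apply/eqP; rewrite -subr_eq0 -normr_eq0 -sqrf_eq0 -innerxx.
  set y := pt t - PQ (p t); have Qy : Qh y by apply: QhB => //; exact: hpt.
  rewrite innerBl// (PQo (p t) y Qy) -innerBl// -kE.
  by rewrite (hell2 _ t0T _ Qy).
have utE t : 0 <= t <= tg N -> ut t = PV (u t + A (p t)).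
  move=> t0T; apply/eqP; rewrite -subr_eq0 -normr_eq0 -sqrf_eq0 -innerxx.
  set y := ut t - PV _; have Vy : Vh y by apply: VhB => //; exact: hut.
  rewrite innerBl// (PVo _ y Vy) innerDl// AE /bq -ptE//.
  have := hell1 _ t0T _ Vy; rewrite aE innerBl// => /eqP; rewrite subr_eq0 => /eqP <-.
  by apply/eqP; ring.
have first_eq t : 0 < t <= tg N -> forall v, Vh v ->
    inner (Uh t) v - bq v (Ph t) =
    inner (Pi1 N tg q'.+1 u t) v - bq v (Pi1 N tg q'.+1 p t).
  move=> t0T v Vv; rewrite -aE (scheme1 _ t0T _ Vv).
  have bv : @bounded_functional R V (fun x => inner x v).
    have := inner_bounded v hV; congr bounded_functional.
    by apply/funext => y; rewrite innerC.
  have := Pi1_relation tg0 tgS T0 (ltn0Sn q') (riesz_dual rV) rV rQ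
    (eval_bounded v) bv (br v) hf hu hp; move=> -> //.
    by move=> s s0T; rewrite -aE; exact: hup1.
  by case/andP: t0T => t0 ->; rewrite ltW.
have idu := time_derivative_weakly (time_derivativeP hu).
have idUh := time_derivative_weakly (time_derivativeP hUh1).
have ip := H1_weakly T0 hQ hp; have iPh := H1_weakly T0 hQ hPh1.
have ig := L2_weakly hg.
have second_eq m : (m < N)%N -> forall (r : {poly R}) x,
    (size r <= q'.+1)%N -> Qh x ->
    (\int[lebesgue_measure]_(t in `]tg m, tg m.+1[)
       (r.[t] * (bq (time_derivative (tg N) Uh t) x + inner x (Ph t))) =
     \int[lebesgue_measure]_(t in `]tg m, tg m.+1[)
       (r.[t] * (bq (time_derivative (tg N) u t) x + inner x (p t))))%R.
  move=> mN r x sr Qx.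
  have cell (X : normedModType R) (K : X -> R) w : bounded_functional K ->
      weakly_integrable `]0, tg N[ w ->
      ae_integrable `]tg m, tg m.+1[ (fun s => r.[s] * K (w s)).
    move=> bK iw; apply: ae_integrable_hornerM.
    exact: (weakly_integrable_cell tg0 tgS mN iw).1.
  have bx := inner_bounded x hQ.
  have iU := cell _ _ _ (bl x) idUh; have iP := cell _ _ _ bx iPh.
  have iP0 := cell _ _ _ bx
    (piecewise_weakly tg0 tgS hQ (Pi0_piecewise tg0 tgS rQ q' iPh)).
  have tT t : `]tg m, tg m.+1[%classic t -> 0 < t < tg N.
    move=> tm; have := grid_subset tg0 tgS mN (leqnn N) tm.
    by rewrite /= in_itv.
  transitivity (\int[lebesgue_measure]_(t in `]tg m, tg m.+1[)
     (r.[t] * bq (time_derivative (tg N) Uh t) x + r.[t] * inner x (Ph t)))%R.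
    by apply: eq_Rintegral => t _; rewrite mulrDr.
  rewrite (RintD _ iU iP)// (Pi0_test tg0 tgS rQ iPh mN sr bx) -(RintD _ iU iP0)//.
  transitivity (\int[lebesgue_measure]_(t in `]tg m, tg m.+1[)
     (r.[t] * Pi0 N tg q' g t x))%R.
    apply: eq_Rintegral_ae => //; apply: ae_imp _ scheme2 => t scheme2 tm.
    by rewrite -(scheme2 (tT _ tm) _ Qx) -mulrDr kE innerC.
  rewrite -(Pi0_test tg0 tgS (riesz_dual rQ) ig mN sr (eval_bounded x)).
  apply: eq_Rintegral_ae => //; apply: ae_imp _ hup2 => t hup2 tm.
  by rewrite -(hup2 (tT _ tm)) kE innerC.
(* Infinite projection errors make all claims trivial. *)
have estimate n : (n <= N)%N -> (Ch n + Ctau n = +oo)%E \/ exists c : R,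
    [/\ (Ch n + Ctau n = c%:E)%E, `|Uh (tg n) - ut (tg n)| <= c,
     (L2norm `]0%R, tg n[ (Pi0 N tg q' (fun t => p t - Ph t)%R) <=
      L2norm `]0%R, tg n[ (Pi0 N tg q' (fun t => p t - pt t)%R) + c%:E)%E &
     forall v, (0 < n)%N -> Vh v -> `|v| = 1 ->
       b v (iota (Ph (tg n) - pt (tg n))) <= c].
  move=> nN.
  have C0 : (0 <= Ch n)%E by rewrite /Ch L2norm_ge0.
  have Ct0 : (0 <= Ctau n)%E by rewrite /Ctau L2norm_ge0.
  case CE : (Ch n) C0 => [C| |] // C0; last by left; rewrite addye// gt_eqF// (lt_le_trans _ Ct0).
  case CtE : (Ctau n) Ct0 => [Ct| |] // Ct0; last by left.
  right; exists (C + Ct); rewrite !lee_fin in C0 Ct0.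
  have bh t x : `|bq (time_derivative (tg N) u t - time_derivative (tg N) ut t) x| <=
      `|B (time_derivative (tg N) u t - time_derivative (tg N) ut t)| * `|x|.
    rewrite /bq -hB (le_trans (dual_le _ _))// ler_wpM2l//.
  have [h1 h2] := error_estimate hV hQ bl br bPV PVh PVo VhB VhZ VhS bPQ PQh PQo
    QhB QhZ QhS bA AE tg0 tgS T0 hu hp hUh1 hPh1 utE ptE pUh pPh hUh0
    first_eq second_eq nN bh C0 CE Ct0 CtE.
  have [EuE EpE] := @error_node _ _ _ hV hQ PV PQ A _ _ tg0 tgS T0 q' _ _ Uh _ _ Ph hu hp utE ptE _ nN.
  split=> //.
  - by rewrite -EuE.
  - have h3 := projected_error_bound hQ bPQ PQh PQo PQle QhB QhZ QhS tg0 tgS T0 hp hPh1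
      ptE pPh nN.
    by apply: le_trans h3 _; rewrite leeD2l// lee_fin.
  - move=> v n0 Vv v1; rewrite -EpE -/(bq _ _).
    have tn : 0 < tg n <= tg N.
      rewrite (grid_le tgS nN (leqnn N)) andbT.
      case: n n0 nN {C0 Ct0 CE CtE h1 h2 EuE EpE} => // n _ nN.
      by rewrite (le_lt_trans (grid_ge0 tg0 tgS (ltnW nN)))// tgS.
    rewrite -(error_constraint hV br PVo AE first_eq tn Vv).
    by rewrite (le_trans (inner_le hV _ _))// v1 mulr1.
have estimate' n (nN : (n <= N)%N) (x : \bar R) : x != -oo%E ->
    (Ch n + Ctau n = +oo)%E -> (x + Ch n + Ctau n)%E = +oo%E.
  by move=> xNy E; rewrite -addeA E addey.
split.
- move=> n nN; case: (estimate n nN) => [E|[c [E h _ _]]].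
    by rewrite estimate'// leey.
  rewrite -addeA E -EFinD lee_fin (le_trans (ler_distD (ut (tg n)) _ _))//.
  by rewrite lerD2l distrC.
- move=> n nN; case: (estimate n nN) => [E|[c [E _ h _]]].
    rewrite estimate' ?leey// gt_eqF// (lt_le_trans _ (L2norm_ge0 _ _))//.
  by rewrite -addeA E.
- move=> betah b0 A3h n nN.
  case: (estimate n nN) => [E|[c [E hc _ h]]].
    by rewrite E gt0_muley ?lte_fin ?invr_gt0// addey// leey.
  rewrite E -EFinM -EFinD lee_fin.
  have -> : iota (p (tg n) - Ph (tg n)) =
      iota (p (tg n) - pt (tg n)) - iota (Ph (tg n) - pt (tg n)).
    by rewrite -linearB opprB addrA subrK.
  rewrite (le_trans (ler_normB _ _))// lerD2l ler_pdivlMl//.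
  have c0 : 0 <= c by apply: le_trans hc.
  (* The scheme starts after the initial time, where the pressures agree. *)
  case: n nN E hc h => [|n] nN E hc h.
    by rewrite tg0 hPh0 subrr linear0 normr0 mulr0.
  have tn : 0 <= tg n.+1 <= tg N.
    by rewrite (grid_ge0 tg0 tgS nN) (grid_le tgS nN (leqnn N)).
  have Qe : Qh (Ph (tg n.+1) - pt (tg n.+1)).
    apply: QhB; first exact: (pressure_node hQ QhZ QhS tg0 tgS hPh1 pPh nN).
    by rewrite ptE.
  apply: le_trans (A3h _ Qe) _.
  set S := [set _ | _ in _].
  (* If no discrete velocity has norm one, the supremum is zero by convention. *)
  have [->|/set0P S0] := eqVneq S set0; first by rewrite sup0.
  by apply: ge_sup => // _ [v [Vv v1] <-]; exact: h.
Qed.
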